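(* The gauged differential operator $\widetilde{H}\in\mathbb{D}_M(\mathbf{V}^{\mathfrak{m}})^W$ is explicitly given by \[ \widetilde{H}=\sum_{j=1}^r\partial_{x_j}^2+V+\sigma_r^*(\Omega_{\mathfrak{m}})-(t_\rho,t_\rho), \] where \[ V:=-\sum_{\lambda\in\Sigma}\frac{k(\lambda)}{(\xi_\lambda-\xi_{-\lambda})^2}-\sum_{\lambda\in\Sigma}\frac{\sigma_{\ell;n}(\Upsilon_\lambda)+\sigma_r^*(\Upsilon_\lambda)+(\xi_\lambda+\xi_{-\lambda})(\sigma_{\ell;n}\otimes\sigma_r^* )(\upsilon_\lambda)}{(\xi_\lambda-\xi_{-\lambda})^2}, \] with $k(\lambda):=\mathrm{mtp}(\lambda)\bigl(\mathrm{mtp}(2\lambda)+\tfrac{\mathrm{mtp}(\lambda)}{2}-1\bigr)(t_\lambda,t_\lambda)$.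
   Context: Let $G$ be a connected real semisimple Lie group with finite center and Lie algebra $\mathfrak{g}_{\mathbb{R}}$. Fix a Cartan involution $\theta_{\mathbb{R}}$ of $\mathfrak{g}_{\mathbb{R}}$, with Cartan decomposition $\mathfrak{g}_{\mathbb{R}}=\mathfrak{k}_{\mathbb{R}}\oplus\mathfrak{p}_{\mathbb{R}}$ into $(+1)$- and $(-1)$-eigenspaces, and a maximal abelian subspace $\mathfrak{a}_{\mathbb{R}}\subset\mathfrak{p}_{\mathbb{R}}$ of dimension $r$. Omitting the subscript $\mathbb{R}$ denotes complexification; $\theta$ is the complex linear extension of $\theta_{\mathbb{R}}$ and $B$ is the Killing form of $\mathfrak{g}$. Fix a basis $\{x_1,\ldots,x_r\}$ of $\mathfrak{a}_{\mathbb{R}}$, orthonormal with respect to $(x,y):=-B(x,\theta_{\mathbb{R}}(y))$. Let $K\subset G$ be the (maximal compact) connected Lie subgroup with Lie algebra $\mathfrak{k}_{\mathbb{R}}$, $A=\exp(\mathfrak{a}_{\mathbb{R}})$ with $\log:A\to\mathfrak{a}_{\mathbb{R}}$ the inverse of $\exp$, $M:=Z_K(A)$, $\mathfrak{m}_{\mathbb{R}}:=Z_{\mathfrak{k}_{\mathbb{R}}}(\mathfrak{a}_{\mathbb{R}})$ and $W:=N_K(A)/M$. Let $\Sigma\subset\mathfrak{a}_{\mathbb{R}}^*\setminus\{0\}$ be the restricted root system, with a choice $\Sigma^+$ of positive roots. For $\lambda\in\mathfrak{a}^*$ write $\xi_\lambda(a)=a^\lambda:=e^{\lambda(\log a)}$;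 $A_{\mathrm{reg}}:=\{a\in A: a^\lambda\neq 1\ \forall\lambda\in\Sigma\}$; $\mathcal{R}$ is the unital subalgebra of $C^\infty(A_{\mathrm{reg}})$ generated by $(1\pm\xi_\lambda)^{-1}$ ($\lambda\in\Sigma$). Roots and tensors. Fix a maximal abelian subspace $\mathfrak{t}_{\mathbb{R}}\subset\mathfrak{m}_{\mathbb{R}}$; $\mathfrak{h}=\mathfrak{t}\oplus\mathfrak{a}$ is a Cartan subalgebra of $\mathfrak{g}$ with root system $R$. For $\alpha\in R$ let $h_\alpha\in\mathfrak{h}$ be defined by $B(h,h_\alpha)=\alpha(h)$ for all $h\in\mathfrak{h}$, and choose root vectors $e_\alpha$ with $[e_\alpha,e_{-\alpha}]=h_\alpha$. Let $R_\lambda:=\{\alpha\in R:\alpha|_{\mathfrak{a}_{\mathbb{R}}}=\lambda\}$ and $\mathrm{mtp}(\lambda):=\#R_\lambda$ (so $\mathrm{mtp}(2\lambda)=0$ if $2\lambda\notin\Sigma$). For $\nu\in\mathfrak{a}^*$ let $t_\nu\in\mathfrak{a}$ be defined by $B(t_\nu,h)=\nu(h)$ for $h\in\mathfrak{a}$. $\rho:=\frac12\sum_{\lambda\in\Sigma^+}\mathrm{mtp}(\lambda)\lambda$. For $\lambda\in\Sigma$ and $y_\alpha:=e_\alpha+\theta(e_\alpha)$ put $\upsilon_\lambda:=\sum_{\alpha\in R_\lambda}y_{-\alpha}\otimes y_\alpha\in\mathfrak{k}\otimes\mathfrak{k}$, $\Upsilon_\lambda:=\sum_{\alpha\in R_\lambda}y_{-\alpha}y_\alpha\in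 U(\mathfrak{k})$. $\Omega_{\mathfrak{m}}=\sum_sc_sc_s'\in Z(U(\mathfrak{m}))$ for bases $\{c_s\},\{c_s'\}$ of $\mathfrak{m}$ dual with respect to $B|_{\mathfrak{m}\times\mathfrak{m}}$. Representations. $(\sigma_\ell,V_\ell)$, $(\sigma_r,V_r)$ are finite-dimensional smooth $K$-representations, $(\tau_i,U_i)$ ($1\le i\le n$) finite-dimensional smooth $G$-representations; derived representations of enveloping algebras are denoted by the same symbols. $\underline{U}=U_1\otimes\cdots\otimes U_n$, $\sigma_{\ell;n}$ is the diagonal $K$-representation on $V_\ell\otimes\underline{U}$, $\sigma_r^*$ is dual to $\sigma_r$, $\mathbf{V}:=V_\ell\otimes\underline{U}\otimes V_r^*$ with diagonal $K$-action and $\mathbf{V}^{\mathfrak{m}}$ is its subspace of $\mathfrak{m}$-invariants. All endomorphisms in the formulas (extended by the identity to the other tensor factors) are viewed as operators on $\mathbf{V}^{\mathfrak{m}}$. Differential operators. $\mathbb{D}_M(\mathbf{V}^{\mathfrak{m}})$ is the algebra of differential operators $\sum_{\mathbf{m}}q_{\mathbf{m}}\partial_{x_1}^{m_1}\cdots\partial_{x_r}^{m_r}$ (finite sums) on $A_{\mathrm{reg}}$ with $q_{\mathbf{m}}\in\mathcal{R}\otimes\mathrm{End}_M(\mathbf{V}^{\mathfrak{m}})$, where $(\partial_hf)(a)=\frac{d}{dt}|_{t=0}f(a\exp(th))$ for $h\in\mathfrak{a}_{\mathbb{R}}$ (extended linearly to $\mathfrak{a}$). $W=N_K(A)/M$ acts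 on it by $gM\cdot(q\,\partial(h))=(g\cdot q)\,\partial(\mathrm{Ad}_g(h))$, $(g\cdot q)(a)=g\circ q(g^{-1}ag)\circ g^{-1}$; the superscript $W$ denotes invariants. Gauge. $D\mapsto\widetilde{D}$ is the $W$-equivariant, $\mathcal{R}\otimes\mathrm{End}_M(\mathbf{V}^{\mathfrak{m}})$-linear algebra automorphism of $\mathbb{D}_M(\mathbf{V}^{\mathfrak{m}})$ with $\widetilde{\partial_h}=\partial_h+\frac14\sum_{\lambda\in\Sigma}\lambda(h)\,\mathrm{mtp}(\lambda)\Bigl(\frac{1+\xi_{2\lambda}}{1-\xi_{2\lambda}}\Bigr)$ for all $h\in\mathfrak{a}_{\mathbb{R}}$. $\widetilde{H}$ is the image under it of \[ H:=\sum_{j=1}^r\partial_{x_j}^2+\frac12\sum_{\lambda\in\Sigma}\mathrm{mtp}(\lambda)\Bigl(\frac{\xi_\lambda+\xi_{-\lambda}}{\xi_\lambda-\xi_{-\lambda}}\Bigr)\partial_{t_\lambda}+\sigma_r^*(\Omega_{\mathfrak{m}})-\sum_{\lambda\in\Sigma}\frac{\sigma_{\ell;n}(\Upsilon_\lambda)+\sigma_r^*(\Upsilon_\lambda)+(\xi_\lambda+\xi_{-\lambda})(\sigma_{\ell;n}\otimes\sigma_r^* )(\upsilon_\lambda)}{(\xi_\lambda-\xi_{-\lambda})^2}\in\mathbb{D}_M(\mathbf{V}^{\mathfrak{m}})^W. \] *)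

(* Defs.v *)
From HB Require Import structures.
From mathcomp Require Import all_boot all_order all_algebra.
From mathcomp Require Import finmap.
From mathcomp Require Import all_classical all_reals all_analysis.
From mathcomp Require Import complex.
Set Implicit Arguments.
Unset Strict Implicit.
Unset Printing Implicit Defensive.
Import Order.TTheory GRing.Theory Num.Theory.
Import numFieldNormedType.Exports.
Local Open Scope classical_set_scope.
Local Open Scope ring_scope.

(* [U] is meant to be open; the spaces are finite dimensional in all uses, so
   that continuity of all iterated directional derivatives is smoothness. *)
Fixpoint Ck (R : realType) (k : nat) (V W : normedModType R) (U : set V)
    (f : V -> W) : Prop :=
  if k is k'.+1 then
    (forall x, U x -> differentiable f x) /\ (forall v, Ck k' U ('D_v f))
  else forall x, U x -> {for x, continuous f}.

Definition smooth (R : realType) (V W : normedModType R) (U : set V)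
  (f : V -> W) : Prop := forall k, Ck k U f.

Definition csmooth (R : realType) (V : normedModType R) (U : set V)
    (f : V -> R[i]) : Prop :=
  smooth U (fun x => complex.Re (f x) : R^o) /\
  smooth U (fun x => complex.Im (f x) : R^o).

Definition cderive (R : realType) (f : R -> R[i]) : R[i] :=
  Complex (derive1 (fun t => complex.Re (f t) : R^o) 0)
          (derive1 (fun t => complex.Im (f t) : R^o) 0).

#[short(type="topGroupType")]
HB.structure Definition TopGroup := {T of Group T & Topological T}.

Record chart (R : realType) (N : nat) (T : topologicalType) := Chart {
  cdom : set T;
  cmap : T -> 'rV[R]_N;
  cinv : 'rV[R]_N -> T;
  cdom_open : open cdom;
  cimg_open : open (cmap @` cdom);
  cmapK : forall x, cdom x -> cinv (cmap x) = x;
  cmap_continuous : forall x, cdom x -> {for x, continuous cmap};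
  cinv_continuous : forall u, (cmap @` cdom) u -> {for u, continuous cinv} }.

Definition cimg (R : realType) (N : nat) (T : topologicalType)
  (c : chart R N T) : set 'rV[R]_N := cmap c @` cdom c.

Definition smooth_into (R : realType) (N : nat) (T : topologicalType)
    (At : set (chart R N T)) (V : normedModType R) (U : set V) (f : V -> T) :=
  (forall x, U x -> {for x, continuous f}) /\
  (forall c, At c -> smooth (U `&` f @^-1` cdom c) (cmap c \o f)).

Record lieGroup (R : realType) (N : nat) := LieGroup {
  lg_sort :> topGroupType;
  lg_hausdorff : hausdorff_space lg_sort;
  lg_countable : @second_countable lg_sort;
  atlas : set (chart R N lg_sort);
  atlas_cover : forall a : lg_sort, exists2 c, atlas c & cdom c a;
  atlas_compat : forall c, atlas c -> smooth_into atlas (cimg c) (cinv c);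
  mul_smooth : forall c d, atlas c -> atlas d ->
    smooth_into atlas
      [set p : 'rV[R]_N * 'rV[R]_N | cimg c p.1 /\ cimg d p.2]
      (fun p => (cinv c p.1 * cinv d p.2)%g);
  inv_smooth : forall c, atlas c ->
    smooth_into atlas (cimg c) (fun u => ((cinv c u)^-1)%g) }.

Section LieAlgebra.
Variables (R : realType) (N : nat) (G : lieGroup R N).

(* The tangent space at the identity is identified with R^N by a chart. *)
Definition velocity (c : chart R N G) (gam : R -> G) (v : 'rV[R]_N) : Prop :=
  is_derive (0 : R) (1 : R) (cmap c \o gam) v.

Definition one_param (gam : R -> G) : Prop :=
  (forall s t, gam (s + t) = (gam s * gam t)%g) /\
  smooth_into (@atlas _ _ G) [set: R^o] gam.

(* Differential at the identity of conjugation by [a]. *)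
Definition chart_Ad (c : chart R N G) (a : G) (v : 'rV[R]_N) : 'rV[R]_N :=
  derive1 (fun t : R =>
    cmap c (a * cinv c (cmap c (1%g : G) + t *: v)%R * a^-1)%g) 0.

Record lieAlgebra := LieAlgebra {
  la_chart : chart R N G;
  la_chart_atlas : atlas la_chart;
  la_chart_1 : cdom la_chart (1%g : G);
  expg : 'rV[R]_N -> G;
  expg_smooth : smooth_into (@atlas _ _ G) [set: 'rV[R]_N] expg;
  expgP : forall v gam, one_param gam /\ velocity la_chart gam v <->
                        gam = (fun t => expg (t *: v));
  lbr : 'rV[R]_N -> 'rV[R]_N -> 'rV[R]_N;
  lbr_linearl : forall y, linear (lbr^~ y);
  lbr_linearr : forall x, linear (lbr x);
  lbr_alt : forall x, lbr x x = 0;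
  lbr_jacobi : forall x y z,
    lbr x (lbr y z) + lbr y (lbr z x) + lbr z (lbr x y) = 0;
  (* the bracket is the differential of Ad *)
  lbrE : forall x y,
    lbr x y = derive1 (fun t : R => chart_Ad la_chart (expg (t *: x)) y) 0 }.

Definition Ad (g : lieAlgebra) : G -> 'rV[R]_N -> 'rV[R]_N :=
  chart_Ad (la_chart g).

Definition killing (g : lieAlgebra) (x y : 'rV[R]_N) : R :=
  \tr (lin1_mx (lbr g x) *m lin1_mx (lbr g y)).

Definition abelian_sub (g : lieAlgebra) (U : {vspace 'rV[R]_N}) : Prop :=
  forall x y, x \in U -> y \in U -> lbr g x y = 0.

Definition semisimple (g : lieAlgebra) : Prop :=
  forall I : {vspace 'rV[R]_N},
    (forall x y, y \in I -> lbr g x y \in I) -> abelian_sub g I -> I = 0%VS.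

Definition maximal_abelian (g : lieAlgebra) (U P : {vspace 'rV[R]_N}) : Prop :=
  [/\ (U <= P)%VS, abelian_sub g U &
      forall U' : {vspace 'rV[R]_N},
        (U <= U')%VS -> (U' <= P)%VS -> abelian_sub g U' -> U' = U].

Definition centralizer_in (g : lieAlgebra) (P U : {vspace 'rV[R]_N}) :
    {vspace 'rV[R]_N} :=
  (P :&: \bigcap_(i < \dim U) lker (linfun (lbr g (vbasis U)`_i)))%VS.

Definition finite_center : Prop :=
  finite_set [set z : G | forall a, (z * a = a * z)%g].

End LieAlgebra.

Section Complexification.
Variables (R : realType) (N : nat) (G : lieGroup R N) (g : lieAlgebra G).
Local Notation C := R[i].

Definition cplx (x : 'rV[R]_N) : 'rV[C]_N := map_mx (real_complex R) x.
Definition reV (X : 'rV[C]_N) : 'rV[R]_N := map_mx (@complex.Re R) X.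
Definition imV (X : 'rV[C]_N) : 'rV[R]_N := map_mx (@complex.Im R) X.

Definition cvspace (U : {vspace 'rV[R]_N}) : {vspace 'rV[C]_N} :=
  <<map cplx (vbasis U)>>%VS.

Definition lbrC (X Y : 'rV[C]_N) : 'rV[C]_N :=
  cplx (lbr g (reV X) (reV Y) - lbr g (imV X) (imV Y)) +
  'i%C *: cplx (lbr g (reV X) (imV Y) + lbr g (imV X) (reV Y)).

Definition killingC (X Y : 'rV[C]_N) : C :=
  \tr (lin1_mx (lbrC X) *m lin1_mx (lbrC Y)).

Definition linC (f : 'End('rV[R]_N)) (X : 'rV[C]_N) : 'rV[C]_N :=
  cplx (f (reV X)) + 'i%C *: cplx (f (imV X)).

End Complexification.

Section CartanInvolution.
Variables (R : realType) (N : nat) (G : lieGroup R N) (g : lieAlgebra G).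

Definition cartan_involution (theta : 'End('rV[R]_N)) : Prop :=
  [/\ forall x, theta (theta x) = x,
      forall x y, theta (lbr g x y) = lbr g (theta x) (theta y) &
      forall x, x != 0 -> 0 < - killing g x (theta x)].

Definition restricted_root (U : {vspace 'rV[R]_N})
    (lam : 'Hom(subvs_of U, R^o)) : Prop :=
  lam != 0 /\ exists x, x != 0 /\
    forall h : subvs_of U, lbr g (vsval h) x = lam h *: x.

End CartanInvolution.

Record cartanData (R : realType) (N : nat) (G : lieGroup R N)
    (g : lieAlgebra G) := CartanData {
  theta : 'End('rV[R]_N);
  theta_cartan : cartan_involution g theta;
  aR : {vspace 'rV[R]_N};
  aR_maximal : maximal_abelian g aR (lker (theta + \1%VF));
  rk : nat;
  xb : rk.-tuple 'rV[R]_N;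
  xb_basis : basis_of aR xb;
  xb_orthonormal : forall i j : 'I_rk,
    - killing g (tnth xb i) (theta (tnth xb j)) = (i == j)%:R;
  logA : G -> 'rV[R]_N;
  logA_exp : forall x, x \in aR -> logA (expg g x) = x;
  posroots : set 'Hom(subvs_of aR, R^o);
  (* the roots that are positive on some Weyl chamber *)
  posrootsP : exists h0 : subvs_of aR,
    (forall lam : 'Hom(subvs_of aR, R^o),
       restricted_root g lam -> lam h0 != 0) /\
    posroots = [set lam | restricted_root g lam /\ 0 < lam h0];
  tR : {vspace 'rV[R]_N};
  tR_maximal :
    maximal_abelian g tR (centralizer_in g (fixedSpace theta) aR) }.

Arguments posroots {R N G g} _ _.

Section Restricted.
Variables (R : realType) (N : nat) (G : lieGroup R N) (g : lieAlgebra G).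
Variable D : cartanData g.
Local Notation C := R[i].
Local Notation aR := (aR D).

Definition kR : {vspace 'rV[R]_N} := fixedSpace (theta D).
Definition mR : {vspace 'rV[R]_N} := centralizer_in g kR aR.
Definition mC : {vspace 'rV[C]_N} := cvspace mR.
Definition hC : {vspace 'rV[C]_N} := (cvspace (tR D) + cvspace aR)%VS.

Local Notation rdual := 'Hom(subvs_of aR, R^o).
Local Notation hdual := 'Hom(subvs_of hC, C^o).

Definition inner (x y : 'rV[R]_N) : R := - killing g x (theta D y).

Definition Sigma : set rdual := [set lam | restricted_root g lam].

Definition root_space (al : hdual) (X : 'rV[C]_N) : Prop :=
  forall H : subvs_of hC, lbrC g (vsval H) X = al H *: X.

Definition roots : set hdual :=
  [set al | al != 0 /\ exists X, X != 0 /\ root_space al X].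

Definition roots_over (lam : rdual) : set hdual :=
  [set al | roots al /\ forall x, x \in aR ->
     al (vsproj hC (cplx x)) = (lam (vsproj aR x))%:C%C].

Definition mtp (lam : rdual) : nat := #|` fset_set (roots_over lam)|.

Definition rho : rdual :=
  2^-1 *: \sum_(lam \in posroots D) (mtp lam)%:R *: lam.

(* the connected subgroup with Lie algebra [kR] is generated by exp(kR) *)
Definition K : set G := [set a | forall H : set G,
  H 1%g -> (forall x y, H x -> H y -> H (x * y)%g) ->
  (forall x, H x -> H (x^-1)%g) ->
  (forall x, x \in kR -> H (expg g x)) -> H a].

Definition A : set G := [set expg g x | x in [set x | x \in aR]].
Definition M : set G := [set k | K k /\ forall a, A a -> (k * a = a * k)%g].
Definition NKA : set G :=
  [set k | K k /\ forall a, A a <-> A (k * a * k^-1)%g].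

Definition xi (lam : rdual) (a : G) : R := expR (lam (vsproj aR (logA D a))).

Definition Areg : set G :=
  [set a | A a /\ forall lam, Sigma lam -> xi lam a != 1].

(* Functions on [Areg] are represented by functions on [G], up to equality on
   [Areg]. *)
Inductive calR : (G -> C) -> Prop :=
| calR_cst c : calR (fun=> c)
| calR_genD lam : Sigma lam -> calR (fun a => ((1 + xi lam a)^-1)%:C%C)
| calR_genB lam : Sigma lam -> calR (fun a => ((1 - xi lam a)^-1)%:C%C)
| calR_add q q' : calR q -> calR q' -> calR (fun a => q a + q' a)
| calR_mul q q' : calR q -> calR q' -> calR (fun a => q a * q' a)
| calR_ext q q' : calR q -> (forall a, Areg a -> q a = q' a) -> calR q'.

End Restricted.

Arguments Sigma {R N G g} _ _.

Record rootData (R : realType) (N : nat) (G : lieGroup R N)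
    (g : lieAlgebra G) (D : cartanData g) := RootData {
  hvec : 'Hom(subvs_of (hC D), R[i]^o) -> 'rV[R[i]]_N;
  hvec_in : forall al, roots al -> hvec al \in hC D;
  hvecP : forall al, roots al -> forall H : subvs_of (hC D),
    killingC g (vsval H) (hvec al) = al H;
  evec : 'Hom(subvs_of (hC D), R[i]^o) -> 'rV[R[i]]_N;
  evec_root : forall al, roots al -> root_space al (evec al);
  evec_br : forall al, roots al -> lbrC g (evec al) (evec (- al)) = hvec al;
  tvec : 'Hom(subvs_of (aR D), R^o) -> 'rV[R]_N;
  tvec_in : forall nu, tvec nu \in aR D;
  tvecP : forall nu (h : subvs_of (aR D)), killing g (tvec nu) (vsval h) = nu h;
  mdim : nat;
  cb : mdim.-tuple 'rV[R[i]]_N;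
  cb_basis : basis_of (mC D) cb;
  cb' : mdim.-tuple 'rV[R[i]]_N;
  cb'_basis : basis_of (mC D) cb';
  cb_dual : forall i j : 'I_mdim,
    killingC g (tnth cb i) (tnth cb' j) = (i == j)%:R }.

(* Only the values on [K] matter; [X |-> k exp(X)], for [X] in [kR], are the
   charts of the Lie group [K]. *)
Record krep (R : realType) (N : nat) (G : lieGroup R N)
    (g : lieAlgebra G) (D : cartanData g) (d : nat) := KRep {
  krep_fun :> G -> 'M[R[i]]_d;
  krep1 : krep_fun 1%g = 1%:M;
  krepM : forall a b, K D a -> K D b ->
    krep_fun (a * b)%g = krep_fun a *m krep_fun b;
  krep_smooth : forall k, K D k -> forall i j,
    csmooth [set: 'rV[R]_N]
      (fun X => krep_fun (k * expg g (projv (kR D) X))%g i j) }.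

Record grep (R : realType) (N : nat) (G : lieGroup R N) (d : nat) := GRep {
  grep_fun :> G -> 'M[R[i]]_d;
  grep1 : grep_fun 1%g = 1%:M;
  grepM : forall a b, grep_fun (a * b)%g = grep_fun a *m grep_fun b;
  grep_smooth : forall c, @atlas _ _ G c -> forall i j,
    csmooth (cimg c) (fun u => grep_fun (cinv c u) i j) }.

Record repData (R : realType) (N : nat) (G : lieGroup R N)
    (g : lieAlgebra G) (D : cartanData g) := RepData {
  dl : nat;
  sigl : krep D dl;
  dr : nat;
  sigr : krep D dr;
  nU : nat;
  dU : 'I_nU -> nat;
  tau : forall i : 'I_nU, grep G (dU i) }.

Section Operators.
Variables (R : realType) (N : nat) (G : lieGroup R N) (g : lieAlgebra G).
Variables (D : cartanData g) (S : repData D).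
Local Notation C := R[i].
Local Notation rdual := 'Hom(subvs_of (aR D), R^o).

(* Indices of the tensor product basis of V_l (x) U_1 (x) ... (x) U_n (x) V_r^*,
   and the Kronecker product of endomorphisms of the tensor factors. *)
Definition tidx : finType :=
  ('I_(dl S) * {dffun forall i : 'I_(nU S), 'I_(dU i)} * 'I_(dr S))%type.

Definition dimV : nat := #|tidx|.

Definition tens (Ml : 'M[C]_(dl S)) (MU : forall i : 'I_(nU S), 'M[C]_(dU i))
    (Mr : 'M[C]_(dr S)) : 'M[C]_dimV :=
  \matrix_(p, q) (
    let I : tidx := enum_val p in let J : tidx := enum_val q in
    Ml I.1.1 J.1.1 * (\prod_(i < nU S) MU i (I.1.2 i) (J.1.2 i))
    * Mr I.2 J.2).

Definition dual_rep (k : G) : 'M[C]_(dr S) := (invmx (sigr S k))^T.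

Definition rho_l (k : G) : 'M[C]_dimV :=
  tens (sigl S k) (fun i => tau i k) 1%:M.
Definition rho_r (k : G) : 'M[C]_dimV :=
  tens 1%:M (fun i => 1%:M) (dual_rep k).
Definition rho_diag (k : G) : 'M[C]_dimV :=
  tens (sigl S k) (fun i => tau i k) (dual_rep k).

(* the derived representation of [kR], extended linearly to [k] *)
Definition drepR (r : G -> 'M[C]_dimV) (X : 'rV[R]_N) : 'M[C]_dimV :=
  \matrix_(p, q) cderive (fun t => r (expg g (t *: X)) p q).
Definition drep (r : G -> 'M[C]_dimV) (X : 'rV[C]_N) : 'M[C]_dimV :=
  drepR r (reV X) + 'i%C *: drepR r (imV X).

Definition inVm (v : 'cV[C]_dimV) : Prop :=
  forall X, X \in mC D -> drep rho_diag X *m v = 0.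

(* Endomorphisms of the subspace V^m are represented by matrices preserving it,
   up to equality on it. *)
Definition EndM (T : 'M[C]_dimV) : Prop :=
  forall v, inVm v -> inVm (T *m v) /\
    forall k, M D k -> T *m (rho_diag k *m v) = rho_diag k *m (T *m v).

Section Tensors.
Variable E : rootData D.

Definition yvec (al : 'Hom(subvs_of (hC D), C^o)) : 'rV[C]_N :=
  evec E al + linC (theta D) (evec E al).

Definition Upsilon (r : G -> 'M[C]_dimV) (lam : rdual) : 'M[C]_dimV :=
  \sum_(al \in roots_over lam) (drep r (yvec (- al)) *m drep r (yvec al)).

(* the tensor in k (x) k acting through [r] (x) [r'] *)
Definition upsilon (r r' : G -> 'M[C]_dimV) (lam : rdual) : 'M[C]_dimV :=
  \sum_(al \in roots_over lam) (drep r (yvec (- al)) *m drep r' (yvec al)).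

Definition Omega_m (r : G -> 'M[C]_dimV) : 'M[C]_dimV :=
  \sum_(s < mdim E) (drep r (tnth (cb E) s) *m drep r (tnth (cb' E) s)).

End Tensors.

(* Sections over [Areg] are functions on [G], of which only the values on
   [Areg] matter; their smoothness is expressed in the coordinates of [A]
   given by the exponential map. *)
Definition sect := G -> 'cV[C]_dimV.

Definition smooth_sect (f : sect) : Prop :=
  (forall a, Areg D a -> inVm (f a)) /\
  let e (u : 'rV[R]_(rk D)) := expg g (\sum_j u 0 j *: tnth (xb D) j) in
  forall i, csmooth (e @^-1` Areg D) (fun u => f (e u) i 0).

Definition dop := sect -> sect.

(* equality of operators on smooth V^m-valued functions on [Areg] *)
Definition dop_eq (P Q : dop) : Prop :=
  forall f, smooth_sect f -> forall a, Areg D a -> P f a = Q f a.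

Definition partial (h : 'rV[R]_N) : dop := fun f a =>
  \col_i cderive (fun t => f (a * expg g (t *: h))%g i 0).

Definition mult (q : G -> 'M[C]_dimV) : dop := fun f a => q a *m f a.

Definition smult (q : G -> C) : dop := mult (fun a => (q a)%:M).

Definition REndM (q : G -> 'M[C]_dimV) : Prop :=
  exists (n : nat) (c : 'I_n -> G -> C) (T : 'I_n -> 'M[C]_dimV),
    [/\ forall i, calR D (c i), forall i, EndM (T i) &
        forall a, Areg D a -> q a = \sum_i c i a *: T i].

Definition term : Type := (G -> 'M[C]_dimV) * {ffun 'I_(rk D) -> nat}.

(* q d_{y_1}^{m_1} ... d_{y_r}^{m_r} *)
Definition term_op (y : 'I_(rk D) -> 'rV[R]_N) (p : term) : dop :=
  mult p.1 \o \big[(fun P Q : dop => P \o Q)/id]_j iter (p.2 j) (partial (y j)).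

Definition DM (P : dop) : Prop := exists s : seq term,
  (forall i, (i < size s)%N -> REndM (nth (fun=> 0, [ffun=> 0%N]) s i).1) /\
  dop_eq P (\sum_(p <- s) term_op (tnth (xb D)) p).

Definition act_coef (k : G) (q : G -> 'M[C]_dimV) : G -> 'M[C]_dimV :=
  fun a => rho_diag k *m q (k^-1 * a * k)%g *m rho_diag k^-1%g.

(* [P'] is the image of [P] under the class of [k] in the Weyl group *)
Definition W_act (k : G) (P P' : dop) : Prop := exists s : seq term,
  [/\ forall i, (i < size s)%N -> REndM (nth (fun=> 0, [ffun=> 0%N]) s i).1,
      dop_eq P (\sum_(p <- s) term_op (tnth (xb D)) p) &
      dop_eq P' (\sum_(p <- s)
        term_op (fun j => Ad g k (tnth (xb D) j)) (act_coef k p.1, p.2))].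

Definition DM_W (P : dop) : Prop :=
  DM P /\ forall k, NKA D k -> W_act k P P.

Record is_gauge (Gam : dop -> dop) : Prop := IsGauge {
  gauge_DM : forall P, DM P -> DM (Gam P);
  gauge_eq : forall P Q, DM P -> DM Q -> dop_eq P Q <-> dop_eq (Gam P) (Gam Q);
  gauge_surj : forall Q, DM Q -> exists2 P, DM P & dop_eq (Gam P) Q;
  gauge_add : forall P Q, DM P -> DM Q -> dop_eq (Gam (P + Q)) (Gam P + Gam Q);
  gauge_mul : forall P Q, DM P -> DM Q ->
    dop_eq (Gam (P \o Q)) (Gam P \o Gam Q);
  gauge_one : dop_eq (Gam id) id;
  gauge_lin : forall q P, REndM q -> DM P ->
    dop_eq (Gam (mult q \o P)) (mult q \o Gam P);
  gauge_W : forall k P P', NKA D k -> DM P -> DM P' -> W_act k P P' ->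
    W_act k (Gam P) (Gam P');
  gauge_partial : forall h : subvs_of (aR D),
    dop_eq (Gam (partial (vsval h)))
      (partial (vsval h) + (4^-1 : C) *: \sum_(lam \in Sigma D)
         smult (fun a => (lam h * (mtp lam)%:R *
           ((1 + xi (lam *+ 2) a) / (1 - xi (lam *+ 2) a)))%:C%C)) }.

Section Hamiltonian.
Variable E : rootData D.

Definition spin_term (lam : rdual) : dop :=
  mult (fun a => (((xi lam a - xi (- lam) a) ^- 2)%:C%C) *:
    (Upsilon E rho_l lam + Upsilon E rho_r lam +
     (xi lam a + xi (- lam) a)%:C%C *: upsilon E rho_l rho_r lam)).

Definition H_op : dop :=
  \sum_(j < rk D) iter 2 (partial (tnth (xb D) j))
  + (2^-1 : C) *: (\sum_(lam \in Sigma D)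
      (smult (fun a => ((mtp lam)%:R *
         ((xi lam a + xi (- lam) a) / (xi lam a - xi (- lam) a)))%:C%C)
       \o partial (tvec E lam)))
  + mult (fun=> Omega_m E rho_r)
  - \sum_(lam \in Sigma D) spin_term lam.

Definition coupling (lam : rdual) : R :=
  (mtp lam)%:R * ((mtp (lam *+ 2))%:R + (mtp lam)%:R / 2 - 1)
  * inner D (tvec E lam) (tvec E lam).

Definition potential : dop :=
  - (\sum_(lam \in Sigma D)
       smult (fun a => (coupling lam / (xi lam a - xi (- lam) a) ^+ 2)%:C%C))
  - \sum_(lam \in Sigma D) spin_term lam.

End Hamiltonian.
End Operators.

(* Main.v *)
(* The real Lie group only enters through Ad and exp: the adjoint action is a
   group of automorphisms with d/dt Ad(exp tX) = ad X, which makes Upsilon,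
   upsilon and Omega equivariant under N_K(A), hence H Weyl invariant; Gam
   inherits the invariance.  The formula for Gam(H) comes from
   Gam(d_h) = d_h - phi_h with phi_h = 1/4 sum_lambda mtp(lambda) lambda(h) c_lambda,
   where c_lambda = coth(lambda).  Squaring and using c' = 1 - c^2, the
   first-order terms cancel against Gam of the drift term, and what remains is

     - 1/16 sum mtp(lambda) mtp(mu) (lambda,mu) c_lambda c_mu
     + 1/4 sum mtp(lambda) (lambda,lambda) (c_lambda^2 - 1).

   To evaluate the double sum, take a basis (E_i) of g, unitary for
   -B(X, sigma Y), of joint eigenvectors of the Cartan subalgebra, with
   restricted weights lambda_i, and the cubic form
   S_ijk = |B([E_i, E_j], E_k)|^2, which vanishes unless
   lambda_i + lambda_j + lambda_k = 0.  The inner products (lambda_i, lambda_j)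
   are sums of differences of S, so for odd c the double sum is a sum over
   zero-sum triples of S_ijk (c_i c_j + c_j c_k + c_k c_i).  For nonzero weights
   the cyclic sum is -1 both for coth and for the sign of lambda on the positive
   chamber; for the sign function the double sum is 16 (rho, rho).  The
   difference of the two double sums therefore comes from triples containing a
   zero weight, and this gives the multiplicities in k(lambda); it needs that
   lambda and 3 lambda are never both restricted roots. *)
Require Import Defs.
From HB Require Import structures.
From mathcomp Require Import all_boot all_order all_algebra.
From mathcomp Require Import all_classical all_reals all_analysis.
From mathcomp Require Import complex.
From mathcomp Require Import ring lra zify.
Set Implicit Arguments.
Unset Strict Implicit.
Unset Printing Implicit Defensive.
Import Order.TTheory GRing.Theory Num.Theory.
Import numFieldNormedType.Exports.
Local Open Scope classical_set_scope.
Local Open Scope ring_scope.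

(** The double sum is never evaluated root by root. Sums over restricted roots with multiplicities
    become sums over an eigenbasis of the whole algebra, zero weights included; such a sum is a
    trace, hence the same for every eigenbasis. Three changes of basis do the work. The map [sg]
    negates the weights and expresses inner products through S alone. Complex conjugation keeps the
    restricted weights but negates the eigenvalues of t, which removes the t-components of the
    coroots. Finally Ad k gives the equivariance under N_K(A).

    The triples (mu, -mu, 0) are counted by the same summation formula, applied to indicator
    functions. The one of nu = mu gives these triples minus the triples (mu, mu, -2 mu); the one of
    nu = 2 mu gives the latter, and would also meet (mu, 2 mu, -3 mu). This is where 3 mu must not
    be a root.

    Invariance of Gam(H) is not free: [is_gauge] transports the Weyl action only between operators
    of D_M. That H is one of them, and invariant, is a statement about the tensors, and Ad has to be
    developed for it from the exponential map. *)

(** * Iterated directional derivatives and their closure properties *)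

Section SmoothCalculus.
Variable R : realType.

Lemma near_eq_differentiable (V W : normedModType R) (f g : V -> W) x :
  (\forall y \near x, f y = g y) -> differentiable f x -> differentiable g x.
Proof.
move=> fg df; have fgx : f x = g x by exact: (nbhs_singleton fg).
have eqo : g \o shift x = cst (g x) + 'd f x +o_ (0 : V) id.
  apply/eqaddoP => e e0.
  have /eqaddoP/(_ _ e0) := diff_locally df.
  apply: filter_app => /=; rewrite !near_simpl.
  move: fg; rewrite (near_shift 0 x) /=; apply: filterS => h /=.
  rewrite subr0 => fgh.
  by rewrite -![(_ + _ : _ -> _) _]/(_ + _) -![(- _ : _ -> _) _]/(- _) /= fgx fgh.
apply/diff_locallyP.
rewrite (diff_unique (diff_continuous df) eqo).
by split; [exact: diff_continuous|exact: eqo].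
Qed.

Lemma Ck_sub k (V W : normedModType R) (U U' : set V) (f : V -> W) :
  U' `<=` U -> Ck k U f -> Ck k U' f.
Proof.
elim: k f => [|k IH] f sU; first (move=> Cf x /sU Ux; exact: (Cf x Ux)).
by move=> [df Df]; split=> [x /sU/df //|v]; exact: IH sU (Df v).
Qed.

(** [Ck] tests derivatives taken in the ambient space, at the points of the set only; so each point
    may serve as a domain of its own. *)
Lemma Ck_loc k (V W : normedModType R) (U : set V) (f : V -> W) :
  (forall x, U x -> Ck k [set x] f) -> Ck k U f.
Proof.
elim: k f => [|k IH] f H; first by move=> x Ux; exact: (H x Ux x erefl).
split=> [x Ux|v]; first by have [df _] := H _ Ux; exact: df.
by apply: IH => x Ux; have [_ Df] := H _ Ux; exact: Df.
Qed.

Lemma Ck_continuous k (V W : normedModType R) (U : set V) (f : V -> W) :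
  Ck k U f -> forall x, U x -> {for x, continuous f}.
Proof.
case: k => [//|k] [df _] x Ux.
by have := differentiable_continuous (df x Ux).
Qed.

Lemma CkS k (V W : normedModType R) (U : set V) (f : V -> W) :
  Ck k.+1 U f -> Ck k U f.
Proof.
elim: k f => [|k IH] f; first exact: Ck_continuous.
by move=> [df Df]; split=> // v; apply: IH; apply: Df.
Qed.

Lemma Ck_ext k (V W : normedModType R) (U : set V) (f g : V -> W) :
  open U -> (forall x, U x -> f x = g x) -> Ck k U f -> Ck k U g.
Proof.
move=> oU; elim: k f g => [|k IH] f g fg.
  move=> Cf x Ux; have fgn : \forall y \near x, f y = g y.
    by near=> y; apply: fg; near: y; exact: open_nbhs_nbhs.
  have cf : f y @[y --> x] --> f x := Cf x Ux.
  suff cg : g y @[y --> x] --> f x by move: cg; rewrite (fg x Ux).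
  by apply: cvg_trans cf; apply: near_eq_cvg; exact: fgn.
have fgn x : U x -> \forall y \near x, f y = g y.
  by move=> Ux; near=> y; apply: fg; near: y; exact: open_nbhs_nbhs.
move=> [df Df]; split=> [x Ux|v].
  by apply: near_eq_differentiable (fgn x Ux) (df x Ux).
apply: IH (Df v) => x Ux; apply: near_eq_derive; exact: fgn.
Unshelve. all: by end_near. Qed.

Lemma Ck_cst k (V W : normedModType R) (U : set V) (c : W) :
  Ck k U (fun=> c : W).
Proof.
elim: k c => [|k IH] c; first by move=> x _; apply: cst_continuous.
split=> [x _|v]; first exact: differentiable_cst.
rewrite (_ : 'D_v _ = fun=> 0); first exact: IH.
by apply/funext => x; rewrite derive_cst.
Qed.

Lemma Ck_linear k (V W Z : normedModType R) (U : set V) (f : V -> W)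
    (L : {linear W -> Z}) :
  continuous L -> open U -> Ck k U f -> Ck k U (L \o f).
Proof.
move=> cL oU; elim: k f => [|k IH] f.
  by move=> Cf x Ux; apply: continuous_comp; [exact: Cf|exact: cL].
have dL y : differentiable L y by exact: linear_differentiable.
move=> [df Df]; split=> [x Ux|v].
  by apply: differentiable_comp; [exact: df|].
apply: (Ck_ext oU _ (IH _ (Df v))) => x Ux /=.
have dfx := df x Ux.
have dLf : differentiable (L \o f) x by exact: differentiable_comp.
by rewrite !deriveE // (diff_comp dfx (dL (f x))) /= diff_lin.
Qed.

Lemma Ck_add k (V W : normedModType R) (U : set V) (f g : V -> W) :
  open U -> Ck k U f -> Ck k U g -> Ck k U (fun x => f x + g x).
Proof.
move=> oU; elim: k f g => [|k IH] f g.
  by move=> Cf Cg x Ux; apply: cvgD; [exact: Cf|exact: Cg].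
move=> [df Df] [dg Dg]; split=> [x Ux|v].
  by apply: differentiableD; [exact: df|exact: dg].
apply: (Ck_ext oU _ (IH _ _ (Df v) (Dg v))) => x Ux /=.
by rewrite deriveD //; apply: diff_derivable; [exact: df|exact: dg].
Qed.

Lemma Ck_sum k (V W : normedModType R) (U : set V) n (f : 'I_n -> V -> W) :
  open U -> (forall i, Ck k U (f i)) -> Ck k U (fun x => \sum_i f i x).
Proof.
move=> oU; elim: n f => [|n IH] f Hf.
  by under [X in Ck k U X]funext do rewrite big_ord0; exact: Ck_cst.
under [X in Ck k U X]funext do rewrite big_ord_recl.
by apply: Ck_add => //; apply: IH.
Qed.

(** The product rule is the chain rule for the continuous bilinear map sending (p, q) to
    [p *: q]. *)
Lemma scale_differentiable (V W : normedModType R) (a : V -> R^o) (f : V -> W) x :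
  differentiable a x -> differentiable f x ->
  differentiable (fun y => a y *: f y) x /\
  forall v, 'D_v (fun y => a y *: f y) x = 'D_v a x *: f x + a x *: 'D_v f x.
Proof.
move=> da df.
pose b (p : R^o) (q : W) : W := p *: q.
have bl1 (q : W) : linear (b^~ q) by move=> c p p'; rewrite /b scalerDl scalerA.
have bl2 (p : R^o) : linear (b p).
  by move=> c q q'; rewrite /b scalerDr !scalerA mulrC.
pose bL := GRing.isLinear.Build _ _ _ _ _ (bl1 _).
have bb : bilinear_for (GRing.Scale.Law.clone _ _ *:%R _)
   (GRing.Scale.Law.clone _ _ *:%R _) b by split=> q; [exact: bl1|exact: bl2].
pose bM := bilinear_isBilinear.Build R R^o W W _ _ b bb.
pose B : {bilinear R^o -> W -> W} := HB.pack b bM.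
have cB : continuous (fun p : R^o * W => B p.1 p.2).
  move=> [p q]; apply: cvgZ; [exact: cvg_fst|exact: cvg_snd].
have dB p : differentiable (fun p : R^o * W => B p.1 p.2) p.
  exact: differentiable_bilin.
have dp : differentiable (fun y => (a y, f y)) x by exact: differentiable_pair.
have H : differentiable (fun y => a y *: f y) x.
  exact: (@differentiable_comp _ _ _ _ (fun y => (a y, f y))
    (fun p : R^o * W => B p.1 p.2)).
split=> // v; rewrite !deriveE //.
rewrite -[(fun y => a y *: f y)]/((fun p : R^o * W => B p.1 p.2) \o
   (fun y => (a y, f y))).
rewrite (diff_comp dp (dB _)) /= (diff_pair da df) (diff_bilin _ cB) /=.
by rewrite addrC.
Qed.

Lemma Ck_scale k (V W : normedModType R) (U : set V) (a : V -> R^o)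
    (f : V -> W) :
  open U -> Ck k U a -> Ck k U f -> Ck k U (fun x => a x *: f x).
Proof.
move=> oU; elim: k a f => [|k IH] a f.
  by move=> Ca Cf x Ux; apply: cvgZ; [exact: Ca|exact: Cf].
move=> Ca Cf; have [da Da] := Ca; have [df Df] := Cf; split=> [x Ux|v].
  by have [] := scale_differentiable (da _ Ux) (df _ Ux).
have := Ck_add oU (IH _ _ (Da v) (CkS Cf)) (IH _ _ (CkS Ca) (Df v)).
apply: Ck_ext => // x Ux.
by have [_ ->] := scale_differentiable (da _ Ux) (df _ Ux).
Qed.

(** Finite dimension as the chain rule wants it: a varying direction is expanded in finitely many
    fixed ones, with continuous coordinates. *)
Definition findim (W : normedModType R) : Prop :=
  exists (n : nat) (b : 'I_n -> W) (l : 'I_n -> {linear W -> R^o}),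
    (forall j, continuous (l j)) /\ forall w, w = \sum_j l j w *: b j.

Lemma findimR : findim R^o.
Proof.
exists 1%N, (fun=> 1), (fun=> [the {linear R^o -> R^o} of idfun]).
split=> [_ x|w]; first exact: cvg_id.
by rewrite big_ord1 /= [RHS]mulr1.
Qed.

Lemma findim_rV n : findim 'rV[R]_n.
Proof.
pose l (j : 'I_n) (w : 'rV[R]_n) : R^o := w 0 j.
have ll j : linear (l j) by move=> a x y; rewrite /l !mxE.
pose L j : {linear 'rV[R]_n -> R^o} :=
  HB.pack (l j) (GRing.isLinear.Build _ _ _ _ _ (ll j)).
exists n, (fun j => delta_mx 0 j), L; split=> [j|w].
  by move=> x; apply: (@coord_continuous _ _ _ 0 j).
by rewrite {1}(row_sum_delta w).
Qed.

Lemma findim_prod (V W : normedModType R) :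
  findim V -> findim W -> findim (V * W)%type.
Proof.
move=> [n [b [l [cl Hl]]]] [m [c [k [ck Hk]]]].
pose e (j : 'I_(n + m)) (p : V * W) : R^o :=
  match fintype.split j with inl i => l i p.1 | inr i => k i p.2 end.
have el j : linear (e j).
  by move=> a p q; rewrite /e; case: (fintype.split j) => i /=; rewrite linearP.
pose L j : {linear (V * W)%type -> R^o} :=
  HB.pack (e j) (GRing.isLinear.Build _ _ _ _ _ (el j)).
exists (n + m)%N, (fun j => match fintype.split j with inl i => (b i, 0)
  | inr i => (0, c i) end), L; split=> [j p|[v w]].
  rewrite /= /e; case: (fintype.split j) => i.
    by apply: (@continuous_comp _ _ _ fst (l i)); [exact: cvg_fst|exact: cl].
  by apply: (@continuous_comp _ _ _ snd (k i)); [exact: cvg_snd|exact: ck].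
rewrite big_split_ord /= /e.
under eq_bigr do rewrite (unsplitK (inl _)) /=.
under [X in _ = _ + X]eq_bigr do rewrite (unsplitK (inr _)) /=.
have sp p (F : 'I_p -> V) (F' : 'I_p -> W) :
    \sum_i (F i, F' i) = (\sum_i F i, \sum_i F' i).
  elim: p F F' => [|p IH] F F'; first by rewrite !big_ord0.
  by rewrite !big_ord_recl IH.
have -> : \sum_(i < n) l i v *: ((b i, 0) : V * W) = (v, 0).
  rewrite (eq_bigr (fun i => (l i v *: b i, 0))); last first.
    by move=> i _; congr pair; rewrite scaler0.
  by rewrite sp -Hl big1.
have -> : \sum_(i < m) k i w *: ((0, c i) : V * W) = (0, w).
  rewrite (eq_bigr (fun i => (0, k i w *: c i))); last first.
    by move=> i _; congr pair; rewrite scaler0.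
  by rewrite sp -Hk big1.
by congr pair; rewrite ?addr0 ?add0r.
Qed.

(** In the derivative of [h \o f] along [v], the direction ['D_v f x] moves with [x], while [Ck]
    only speaks of fixed directions. Expanding it in the family [b] leaves a sum of products, to
    which the induction applies. *)
Lemma Ck_comp k (V W Z : normedModType R) (U : set V) (U' : set W)
    (f : V -> W) (h : W -> Z) :
  findim W -> open U -> (forall x, U x -> U' (f x)) ->
  Ck k U f -> Ck k U' h -> Ck k U (h \o f).
Proof.
move=> fW oU fU; have [n [b [l [cl Hl]]]] := fW.
elim: k f h fU => [|k IH] f h fU.
  by move=> Cf Cg x Ux; apply: continuous_comp; [exact: Cf|apply/Cg/fU].
move=> Cf [dg Dg]; have [df Df] := Cf; split=> [x Ux|v].
  by apply: differentiable_comp; [exact: df|apply/dg/fU].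
have : Ck k U (fun x => \sum_j (l j \o 'D_v f) x *: ('D_(b j) h \o f) x).
  apply: Ck_sum => // j; apply: Ck_scale => //.
    by apply: Ck_linear (Df v) => //; exact: cl.
  exact: IH fU (CkS Cf) (Dg (b j)).
apply: Ck_ext => // x Ux.
have dfx := df x Ux; have dhx := dg _ (fU _ Ux).
have dhf : differentiable (h \o f) x by exact: differentiable_comp.
rewrite [in RHS]deriveE // (diff_comp dfx dhx) /= -(deriveE _ dfx).
rewrite [in RHS](Hl ('D_v f x)) linear_sum; apply: eq_bigr => j _.
by rewrite linearZ /= -deriveE.
Qed.

Lemma Ck_lin k (V W : normedModType R) (U : set V) (L : {linear V -> W}) :
  continuous L -> Ck k U L.
Proof.
move=> cL; case: k => [|k]; first by move=> x _; exact: cL.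
have dL y : differentiable L y by exact: linear_differentiable.
split=> [x _|v]; first exact: dL.
rewrite (_ : 'D_v _ = fun=> L v); first exact: Ck_cst.
by apply/funext => x; rewrite deriveE // diff_lin.
Qed.

Lemma Ck_pair k (V W Z : normedModType R) (U : set V) (f : V -> W) (h : V -> Z) :
  open U -> Ck k U f -> Ck k U h -> Ck k U (fun x => (f x, h x)).
Proof.
move=> oU; elim: k f h => [|k IH] f h.
  by move=> Cf Ch x Ux; apply: cvg_pair; [exact: Cf|exact: Ch].
move=> [df Df] [dh Dh]; split=> [x Ux|v].
  by apply: differentiable_pair; [exact: df|exact: dh].
apply: (Ck_ext oU _ (IH _ _ (Df v) (Dh v))) => x Ux /=.
have dfx := df x Ux; have dhx := dh x Ux.
have dp : differentiable (fun x => (f x, h x)) x by exact: differentiable_pair.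
by rewrite !deriveE // diff_pair.
Qed.

End SmoothCalculus.

(** * Smooth maps into the Lie group *)

Section SmoothInto.
Variables (R : realType) (N : nat) (G : lieGroup R N).
Local Notation At := (@atlas _ _ G).

Lemma open_preim (V T : topologicalType) (U : set V) (f : V -> T) (W : set T) :
  open U -> open W -> (forall x, U x -> {for x, continuous f}) ->
  open (U `&` f @^-1` W).
Proof.
move=> oU oW cf; rewrite openE => x [Ux Wfx]; apply: filterI.
  exact: open_nbhs_nbhs.
by apply: (cf x Ux); exact: open_nbhs_nbhs.
Qed.

Lemma si_ext (V : normedModType R) (U : set V) (f h : V -> G) :
  open U -> (forall x, U x -> f x = h x) ->
  smooth_into At U f -> smooth_into At U h.
Proof.
move=> oU fh [cf sf].
have ch x : U x -> {for x, continuous h}.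
  move=> Ux; have cfx : f y @[y --> x] --> f x := cf x Ux.
  suff chx : h y @[y --> x] --> f x by move: chx; rewrite (fh x Ux).
  apply: cvg_trans cfx; apply: near_eq_cvg; near=> y.
  by apply: fh; near: y; exact: open_nbhs_nbhs.
split=> // c Ac k.
apply: (@Ck_ext _ _ _ _ _ (cmap c \o f)); first exact: open_preim (cdom_open c) ch.
  by move=> x [Ux _] /=; rewrite fh.
by apply: Ck_sub (sf c Ac k) => x [Ux]; split=> //=; rewrite fh.
Unshelve. all: by end_near. Qed.

Lemma si_loc (V : normedModType R) (U : set V) (f : V -> G) :
  (forall x, U x -> exists U', [/\ open U', U' x & smooth_into At U' f]) ->
  smooth_into At U f.
Proof.
move=> H; split=> [x /H[U' [_ U'x [cf _]]]|c Ac k]; first exact: cf.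
apply: Ck_loc => x [Ux fx]; have [U' [_ U'x [_ sf]]] := H x Ux.
by apply: Ck_sub (sf c Ac k) => y ->.
Qed.

Lemma si_cst (V : normedModType R) (U : set V) (a : G) :
  smooth_into At U (fun=> a).
Proof.
split=> [x _|c Ac k]; first exact: cst_continuous.
exact: Ck_cst.
Qed.

Lemma si_pre (V W : normedModType R) (U : set V) (U' : set W) (f : V -> G)
    (h : W -> V) :
  findim V -> open U' -> smooth_into At U f -> smooth U' h ->
  (forall x, U' x -> U (h x)) -> smooth_into At U' (f \o h).
Proof.
move=> fV oU' [cf sf] sh hU.
have chf x : U' x -> {for x, continuous (f \o h)}.
  move=> U'x; apply: continuous_comp; first exact: (sh 0%N x U'x).
  exact/cf/hU.
split=> // c Ac k.
rewrite compA; apply: (Ck_comp fV _ _ _ (sf c Ac k)).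
- exact: open_preim (cdom_open c) chf.
- by move=> x [U'x fhx]; split; [exact: hU|].
- by apply: Ck_sub (sh k) => x [].
Qed.

(** Near each point both factors lie in single charts, where the product is [mul_smooth] composed
    with the pair of coordinate maps; [si_loc] glues. *)
Lemma si_mul (V : normedModType R) (U : set V) (f h : V -> G) :
  open U -> smooth_into At U f -> smooth_into At U h ->
  smooth_into At U (fun x => (f x * h x)%g).
Proof.
move=> oU sf sh; apply: si_loc => x Ux.
have [c Ac cx] := atlas_cover (f x); have [d Ad dx] := atlas_cover (h x).
have [cf Sf] := sf; have [ch Sh] := sh.
pose U' := (U `&` f @^-1` cdom c) `&` (U `&` h @^-1` cdom d).
have oU' : open U'.
  by apply: openI; apply: open_preim => //; exact: cdom_open.
exists U'; split=> //.
apply: (@si_ext _ _ ((fun p : 'rV[R]_N * 'rV[R]_N =>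
   (cinv c p.1 * cinv d p.2)%g) \o (fun x => (cmap c (f x), cmap d (h x))))) => //.
  by move=> y [[Uy cy] [_ dy]] /=; rewrite !cmapK.
apply: (si_pre _ oU' (mul_smooth Ac Ad)).
- exact: findim_prod (@findim_rV R N) (@findim_rV R N).
- move=> k; apply: Ck_pair => //.
    by apply: Ck_sub (Sf c Ac k) => y [].
  by apply: Ck_sub (Sh d Ad k) => y [].
- by move=> y [[Uy cy] [_ dy]] /=; split; [exists (f y)|exists (h y)].
Qed.

End SmoothInto.

(** * Derivatives of curves *)

Section DerivFacts.
Variable R : realType.

Lemma findim_continuous (V W : normedModType R) (f : {linear V -> W}) :
  findim V -> continuous f.
Proof.
move=> [n [b [l [cl Hl]]]] x.
have -> : (f : V -> W) = (fun v => \sum_j l j v *: f (b j)).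
  apply/funext => v; rewrite {1}(Hl v) linear_sum.
  by apply: eq_bigr => j _; rewrite linearZ.
have : Ck 0 [set: V] (fun v => \sum_j l j v *: f (b j)); last by apply.
apply: Ck_sum; first exact: openT.
move=> j; apply: Ck_scale; [exact: openT| |exact: Ck_cst].
by move=> y _; exact: cl.
Qed.

Lemma is_derive_comp (V W : normedModType R) (F : V -> W) (h : R -> V) (t : R) dh :
  is_derive t (1 : R) h dh -> differentiable F (h t) ->
  is_derive t (1 : R) (F \o h) ('d F (h t) dh).
Proof.
move=> [dht <-] dF; have dh' : differentiable h t by apply/derivable1_diffP.
have dFh : differentiable (F \o h) t by exact: differentiable_comp.
apply: DeriveDef; first by apply/derivable1_diffP.
by rewrite !deriveE // (diff_comp dh' dF).
Qed.

Lemma is_derive_linear (V W : normedModType R) (L : {linear V -> W})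
    (h : R -> V) (t : R) dh :
  findim V -> is_derive t (1 : R) h dh -> is_derive t (1 : R) (L \o h) (L dh).
Proof.
move=> /findim_continuous cL hd.
have dL := linear_differentiable (h t) (cL _ L).
by have := is_derive_comp hd dL; rewrite diff_lin.
Qed.

Lemma is_derive_unique (V W : normedModType R) (h : V -> W) x v a b :
  is_derive x v h a -> is_derive x v h b -> a = b.
Proof. by move=> [_ <-] [_ <-]. Qed.

Lemma is_derive0_cst n (h : R -> 'rV[R]_n) :
  (forall t, is_derive t (1 : R) h 0) -> forall s t, h s = h t.
Proof.
move=> dh s t; apply/rowP => j.
apply: (@is_derive_0_is_cst _ (fun t => h t 0 j)) => x.
have [dhx E] := dh x.
apply: DeriveDef; first by move/derivable_mxP: dhx; apply.
by move: (derive_mx dhx); rewrite E => /rowP/(_ j); rewrite !mxE.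
Qed.

Lemma is_derive_shift0 (V : normedModType R) (h : R -> V) (t : R) dh :
  is_derive (0 : R) (1 : R) (fun s => h (s + t)) dh -> is_derive t (1 : R) h dh.
Proof.
move=> [d E].
have F : (fun k : R => k^-1 *: ((h \o shift t) (k *: (1 : R)) - h t)) =
  (fun k => k^-1 *: (((fun s => h (s + t)) \o shift 0) (k *: (1 : R)) - h (0 + t))).
  by apply/funext => k /=; rewrite addr0 add0r.
apply: DeriveDef; first by rewrite /derivable F.
by rewrite -E /derive F.
Qed.

End DerivFacts.

(** * The exponential map and the adjoint action *)

Section ExpAd.
Variables (R : realType) (N : nat) (G : lieGroup R N) (g : lieAlgebra G).
Local Notation At := (@atlas _ _ G).
Local Notation e := (expg g).
Local Notation c := (la_chart g).
Let u0 := cmap c (1%g : G).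

Lemma exp_line v : one_param (fun t => e (t *: v)) /\
  velocity c (fun t => e (t *: v)) v.
Proof. by have [_] := @expgP _ _ _ g v (fun t => e (t *: v)); apply. Qed.

(** The vector is the velocity at 0 of its one-parameter group. Identities for [Ad] are deduced
    through this from identities in the group. *)
Lemma exp_line_inj v w : (forall t : R, e (t *: v) = e (t *: w)) -> v = w.
Proof.
move=> E; have [_ dv] := exp_line v; have [_ dw] := exp_line w.
apply: is_derive_unique dv _.
by rewrite (_ : (fun t => e (t *: v)) = (fun t => e (t *: w)))//; exact/funext.
Qed.

Lemma exp_add (s t : R) v : e ((s + t) *: v) = (e (s *: v) * e (t *: v))%g.
Proof. by have [[-> _] _] := exp_line v. Qed.

Lemma exp0 : e 0 = 1%g.
Proof.
have /(congr1 (fun x => (x * (e 0)^-1)%g)) := exp_add 0 0 0.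
by rewrite add0r scale0r mulgV mulgK.
Qed.

Lemma expN v : e (- v) = (e v)^-1%g.
Proof.
have := exp_add (-1) 1 v; rewrite addNr scale0r exp0 scaleN1r scale1r => E.
by apply: (@mulIg _ (e v)); rewrite mulVg -E.
Qed.

Lemma exp_line_smooth v : smooth_into At [set: R^o] (fun t : R^o => e (t *: v)).
Proof. by have [[_ +] _] := exp_line v. Qed.

Definition conj_chart (k : G) (u : 'rV[R]_N) : 'rV[R]_N :=
  cmap c (k * cinv c u * k^-1)%g.

Lemma cinv_u0 : cinv c u0 = 1%g.
Proof. by rewrite cmapK //; exact: la_chart_1. Qed.

Lemma cimg_u0 : cimg c u0.
Proof. by exists 1%g => //; exact: la_chart_1. Qed.

Lemma conj_smooth k : exists W, [/\ open W, W u0 & smooth W (conj_chart k)].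
Proof.
have Ac := la_chart_atlas g.
have S : smooth_into At (cimg c) (fun u => (k * cinv c u * k^-1)%g).
  have oc := @cimg_open _ _ _ c.
  apply: si_mul => //; last exact: si_cst.
  by apply: si_mul => //; [exact: si_cst|exact: atlas_compat].
exists (cimg c `&` (fun u => (k * cinv c u * k^-1)%g) @^-1` cdom c).
have [cf sf] := S.
split; [apply: open_preim => //; [exact: (@cimg_open _ _ _ c)|exact: cdom_open]| |].
  split; first exact: cimg_u0.
  by rewrite /preimage /= cinv_u0 mulg1 mulgV; exact: la_chart_1.
exact: sf.
Qed.

Lemma conj_diff k : differentiable (conj_chart k) u0.
Proof. by have [W [_ Wu S]] := conj_smooth k; have [df _] := S 1%N; exact: (df u0 Wu). Qed.

Lemma AdE k X : Ad g k X = 'd (conj_chart k) u0 X.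
Proof.
rewrite /Ad /chart_Ad -deriveE; last exact: conj_diff.
rewrite /derive1 /derive; set d := (fun _ : R => _); set d' := (fun _ : R => _).
suff -> : d = d' by []; apply/funext => h; rewrite /d /d' /=.
by rewrite addr0 scale0r addr0 /conj_chart [h *: X + u0]addrC.
Qed.

Lemma Ad_linear k : linear (Ad g k).
Proof. by move=> a x y; rewrite !AdE linearP. Qed.
HB.instance Definition _ k :=
  GRing.isLinear.Build _ _ _ _ (Ad g k) (Ad_linear k).

(** Both sides are one-parameter groups with the same velocity, by the chain rule and [AdE]; by
    [expgP] the velocity determines the group. *)
Lemma conj_exp k X (t : R) : (k * e (t *: X) * k^-1)%g = e (t *: Ad g k X).
Proof.
suff /(congr1 (fun f => f t)) : (fun t : R => (k * e (t *: X) * k^-1)%g) =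
  (fun t => e (t *: Ad g k X)) by [].
have [+ _] := @expgP _ _ _ g (Ad g k X) (fun t => k * e (t *: X) * k^-1)%g.
apply; split; first split.
- by move=> s s'; rewrite exp_add !mulgA mulgVK.
- apply: si_mul; [exact: openT| |exact: si_cst].
  apply: si_mul; [exact: openT|exact: si_cst|exact: exp_line_smooth].
have [_ vX] := exp_line X.
have c0 : (cmap c \o (fun t : R => e (t *: X))) 0 = u0.
  by rewrite /= scale0r exp0.
have := is_derive_comp vX _ (F := conj_chart k).
rewrite c0 => /(_ (conj_diff k)); rewrite -AdE /velocity.
apply: near_eq_is_derive.
have [ce _] := exp_line_smooth X.
have : \forall t \near (0 : R), cdom c (e (t *: X)).
  apply: (ce 0) => //; rewrite scale0r exp0; apply: open_nbhs_nbhs.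
  by split; [exact: cdom_open|exact: la_chart_1].
by apply: filterS => s cs /=; rewrite /conj_chart cmapK.
Qed.

Lemma conj_exp1 k X : (k * e X * k^-1)%g = e (Ad g k X).
Proof. by have := conj_exp k X 1; rewrite !scale1r. Qed.

Lemma Ad_mul a b X : Ad g (a * b)%g X = Ad g a (Ad g b X).
Proof.
apply: exp_line_inj => t; rewrite -!conj_exp.
by rewrite invgM !mulgA.
Qed.

Lemma Ad1 X : Ad g 1%g X = X.
Proof. by apply: exp_line_inj => t; rewrite -conj_exp mul1g invg1 mulg1. Qed.

Lemma AdK k : cancel (Ad g k) (Ad g k^-1%g).
Proof. by move=> X; rewrite -Ad_mul mulVg Ad1. Qed.

Lemma AdVK k : cancel (Ad g k^-1%g) (Ad g k).
Proof. by move=> X; rewrite -Ad_mul mulgV Ad1. Qed.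

(** The value is [lbrE], but [derive1] is a total operation and says nothing about existence;
    differentiability is what has to be proved. *)
Lemma Ad_exp_derive0 X Y :
  is_derive (0 : R) (1 : R) (fun t : R => Ad g (e (t *: X)) Y) (lbr g X Y).
Proof.
suff d : derivable (fun t : R => Ad g (e (t *: X)) Y) (0 : R) (1 : R).
  by apply: DeriveDef => //; rewrite lbrE derive1E.
have Ac := la_chart_atlas g; have oc := @cimg_open _ _ _ c.
pose m (p : R^o * 'rV[R]_N) := (e (p.1 *: X) * cinv c p.2 * (e (p.1 *: X))^-1)%g.
pose U : set (R^o * 'rV[R]_N) := snd @^-1` cimg c.
have oU : open U by apply: open_comp => // p _; exact: cvg_snd.
pose S1 : {linear (R^o * 'rV[R]_N)%type -> R^o} := [the {linear _ -> _} of fst].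
pose S2 : {linear (R^o * 'rV[R]_N)%type -> 'rV[R]_N} := [the {linear _ -> _} of snd].
have sS1 : smooth U S1 by move=> k; apply: Ck_lin => p; exact: cvg_fst.
have sS2 : smooth U S2 by move=> k; apply: Ck_lin => p; exact: cvg_snd.
have Sm : smooth_into At U m.
  apply: si_mul => //; first apply: si_mul => //.
  - by apply: (si_pre (@findimR R) oU (exp_line_smooth X) sS1).
  - by apply: (si_pre (@findim_rV R N) oU (atlas_compat Ac) sS2).
  - apply: (@si_ext _ _ _ _ _ ((fun t : R^o => e (t *: - X)) \o S1)) => //.
      by move=> p _ /=; rewrite scalerN expN.
    by apply: (si_pre (@findimR R) oU (exp_line_smooth (- X)) sS1).
have [cm sm] := Sm.
(* [Ad] along the curve is a partial derivative in the second variable of [m] read in the chart; as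
   [m] is smooth in both variables, this derivative is again differentiable in [t]. *)
pose W := U `&` m @^-1` cdom c; pose F := 'D_(0, Y) (cmap c \o m).
have [dF _] : Ck 1 W F by have [_ D2] := sm c Ac 2%N; exact: D2.
have oW : open W by apply: open_preim => //; exact: cdom_open.
have W0 : W (0, u0).
  split; first exact: cimg_u0.
  by rewrite /preimage /m /= scale0r exp0 cinv_u0 !mulg1 mulgV; exact: la_chart_1.
have E : (fun t : R => Ad g (e (t *: X)) Y) = F \o (fun t : R => (t, u0)).
  apply/funext => t; rewrite /Ad /chart_Ad /F /= /derive1 /derive.
  set d := (fun _ : R => _); set d' := (fun _ : R => _).
  suff -> : d = d' by []; apply/funext => h; rewrite /d /d' /=.
  rewrite /m /= addr0 scale0r addr0 scaler0 add0r.
  by rewrite [_ + h *: Y]addrC.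
rewrite E; apply/derivable1_diffP; apply: differentiable_comp; last exact: dF.
apply: differentiable_pair; [by apply/derivable1_diffP; exact: derivable_id|exact: differentiable_cst].
Qed.

Lemma Ad_exp_derive X Y (t : R) :
  is_derive t (1 : R) (fun t : R => Ad g (e (t *: X)) Y)
    (Ad g (e (t *: X)) (lbr g X Y)).
Proof.
apply: is_derive_shift0.
rewrite (_ : (fun s => _) = Ad g (e (t *: X)) \o (fun s : R => Ad g (e (s *: X)) Y)).
  apply: is_derive_linear; first exact: findim_rV.
  exact: Ad_exp_derive0.
by apply/funext => s /=; rewrite addrC exp_add Ad_mul.
Qed.

(** Conjugating exp(tX) by [k] gives exp(t Ad_k X), so two expressions of one curve are
    differentiated at 0. *)
Lemma Ad_lbr k X Y : Ad g k (lbr g X Y) = lbr g (Ad g k X) (Ad g k Y).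
Proof.
have := Ad_exp_derive0 (Ad g k X) (Ad g k Y).
apply: is_derive_unique.
rewrite (_ : (fun t => _) = Ad g k \o (fun t : R => Ad g (e (t *: X)) Y)).
  by apply: is_derive_linear (Ad_exp_derive0 X Y); exact: findim_rV.
apply/funext => t /=; rewrite -conj_exp !Ad_mul AdK //.
Qed.

Lemma Ad_exp_fix X Y : lbr g X Y = 0 -> Ad g (e X) Y = Y.
Proof.
move=> XY; have := @is_derive0_cst _ _ (fun t : R => Ad g (e (t *: X)) Y) _ 1 0.
rewrite scale1r scale0r exp0 Ad1; apply => t.
by have := Ad_exp_derive X Y t; rewrite XY linear0.
Qed.

Lemma exp_comm X Y : lbr g X Y = 0 -> (e X * e Y = e Y * e X)%g.
Proof.
by move=> /Ad_exp_fix AY; rewrite -[in RHS]AY -conj_exp1 mulgVK.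
Qed.

HB.instance Definition _ X :=
  GRing.isLinear.Build _ _ _ _ (lbr g X) (lbr_linearr g X).

Lemma lbrDl X X' Y : lbr g (X + X') Y = lbr g X Y + lbr g X' Y.
Proof. by have := lbr_linearl g Y 1 X X'; rewrite !scale1r. Qed.

Lemma lbr0l Y : lbr g 0 Y = 0.
Proof. by apply: (addrI (lbr g 0 Y)); rewrite -lbrDl !addr0. Qed.

Lemma lbrZl a X Y : lbr g (a *: X) Y = a *: lbr g X Y.
Proof. by have := lbr_linearl g Y a X 0; rewrite !addr0 lbr0l addr0. Qed.

Lemma lbrNl X Y : lbr g (- X) Y = - lbr g X Y.
Proof. by rewrite -scaleN1r lbrZl scaleN1r. Qed.

Lemma lbrC0 X Y : lbr g X Y = - lbr g Y X.
Proof.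
apply/eqP; rewrite -addr_eq0; apply/eqP.
by have := lbr_alt g (X + Y); rewrite lbrDl !linearD /= !lbr_alt add0r addr0.
Qed.

(* The curve [t |-> Ad (e (- t X)) (T (Ad (e (t X)) Y))] has zero derivative. *)
Lemma Ad_exp_comm (T : {linear 'rV[R]_N -> 'rV[R]_N}) X :
  (forall Y, T (lbr g X Y) = lbr g X (T Y)) ->
  forall Y, T (Ad g (e X) Y) = Ad g (e X) (T Y).
Proof.
move=> TX Y.
pose v (t : R) := Ad g (e (t *: X)) Y.
pose w (t : R) (Z : 'rV[R]_N) := Ad g (e (- t *: X)) Z.
have dv t : is_derive t (1 : R) v (lbr g X (v t)).
  have := Ad_exp_derive X Y t; rewrite Ad_lbr.
  by have -> : Ad g (e (t *: X)) X = X by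
    apply: Ad_exp_fix; rewrite lbrZl lbr_alt scaler0.
have dw t Z : is_derive t (1 : R) (w^~ Z) (- w t (lbr g X Z)).
  have -> : w^~ Z = (fun t => Ad g (e (t *: - X)) Z).
    by apply/funext => s; rewrite /w scalerN -scaleNr.
  have := Ad_exp_derive (- X) Z t; rewrite lbrNl linearN.
  by rewrite /w scalerN -scaleNr.
suff H : forall t, is_derive t (1 : R) (fun t => w t (T (v t))) 0.
  have := is_derive0_cst H 1 0; rewrite /w /v oppr0 !scale0r exp0 !Ad1.
  by rewrite scaleN1r expN scale1r => <-; rewrite AdVK.
move=> t.
(* Both the operator and its argument move with [t]; in coordinates the product rule is needed only
   for a scalar times a curve. *)
have E : (fun t => w t (T (v t))) =
    (fun t => \sum_j (v t 0 j : R^o) *: w t (T (delta_mx 0 j))).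
  apply/funext => s; rewrite {1}[v s]row_sum_delta /w !linear_sum.
  by apply: eq_bigr => j _; rewrite !linearZ.
rewrite E.
have dvj j : is_derive t (1 : R) (fun t => v t 0 j : R^o) (lbr g X (v t) 0 j).
  have [d Ed] := dv t; apply: DeriveDef; first by move/derivable_mxP: d; apply.
  by move: (derive_mx d); rewrite Ed => /rowP/(_ j); rewrite !mxE.
have H j : is_derive t (1 : R) (fun t => (v t 0 j : R^o) *: w t (T (delta_mx 0 j)))
    (lbr g X (v t) 0 j *: w t (T (delta_mx 0 j)) +
     v t 0 j *: - w t (lbr g X (T (delta_mx 0 j)))).
  have [d1 E1] := dvj j; have [d2 E2] := dw t (T (delta_mx 0 j)).
  have /derivable1_diffP D1 := d1; have /derivable1_diffP D2 := d2.
  have [D E3] := scale_differentiable D1 D2.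
  apply: DeriveDef; first exact/derivable1_diffP.
  by rewrite E3 E1 E2.
rewrite -[X in is_derive _ _ X](_ : \sum_j (fun t => (v t 0 j : R^o) *:
    w t (T (delta_mx 0 j))) = _); last first.
  by apply/funext => s; rewrite fct_sumE.
apply: is_derive_eq (is_derive_sum _) _.
rewrite big_split /= -[in RHS](subrr (w t (T (lbr g X (v t))))); congr (_ + _).
  rewrite {2}[lbr g X (v t)]row_sum_delta /w !linear_sum.
  by apply: eq_bigr => j _; rewrite !linearZ.
rewrite TX {2}[v t]row_sum_delta /w !linear_sum /=.
by apply: eq_bigr => j _; rewrite !linearZ.
Qed.

(** The product of the two commuting one-parameter groups is again one. Its velocity is the
    differential of (s, t) |-> exp(sX) exp(tY) applied to (1, 1) = (1, 0) + (0, 1), that is X +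
    Y. *)
Lemma exp_addv X Y : lbr g X Y = 0 -> e (X + Y) = (e X * e Y)%g.
Proof.
move=> XY.
have cXY s t : (e (s *: X) * e (t *: Y) = e (t *: Y) * e (s *: X))%g.
  by apply: exp_comm; rewrite lbrZl linearZ /= XY !scaler0.
suff /(congr1 (fun f => f 1)) : (fun t : R => (e (t *: X) * e (t *: Y))%g) =
  (fun t => e (t *: (X + Y))) by rewrite !scale1r.
have [+ _] := @expgP _ _ _ g (X + Y) (fun t => e (t *: X) * e (t *: Y))%g.
apply; split; first split.
- move=> s t; rewrite !exp_add !mulgA -(mulgA (e (s *: X))) (cXY t s) !mulgA.
  by [].

- by apply: si_mul; [exact: openT| |]; exact: exp_line_smooth.
have Ac := la_chart_atlas g.
pose m (p : R^o * R^o) := (e (p.1 *: X) * e (p.2 *: Y))%g.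
pose S1 : {linear (R^o * R^o)%type -> R^o} := [the {linear _ -> _} of fst].
pose S2 : {linear (R^o * R^o)%type -> R^o} := [the {linear _ -> _} of snd].
have sS1 : smooth [set: (R^o * R^o)%type] S1 by move=> k; apply: Ck_lin => p; exact: cvg_fst.
have sS2 : smooth [set: (R^o * R^o)%type] S2 by move=> k; apply: Ck_lin => p; exact: cvg_snd.
have Sm : smooth_into At [set: (R^o * R^o)%type] m.
  apply: si_mul; first exact: openT.
    by apply: (si_pre (@findimR R) openT (exp_line_smooth X) sS1).
  by apply: (si_pre (@findimR R) openT (exp_line_smooth Y) sS2).
have dm : differentiable (cmap c \o m) ((0, 0) : R^o * R^o).
  have [_ /(_ _ Ac 1%N)[df _]] := Sm; apply: df; split=> //.
  by rewrite /preimage /m /= !scale0r exp0 mulg1; exact: la_chart_1.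
pose i1 (t : R) : R^o * R^o := (t, 0); pose i2 (t : R) : R^o * R^o := (0, t).
pose ii (t : R) : R^o * R^o := (t, t).
have did (t : R) : differentiable (fun t : R => t : R^o) t.
  by apply/derivable1_diffP; exact: derivable_id.
have dp (a b : R -> R^o) da db : is_derive (0 : R) (1 : R) a da ->
    is_derive (0 : R) (1 : R) b db ->
    is_derive (0 : R) (1 : R) (fun t => (a t, b t) : R^o * R^o) (da, db).
  move=> [d1 E1] [d2 E2].
  have /derivable1_diffP D1 := d1; have /derivable1_diffP D2 := d2.
  have D : differentiable (fun t => (a t, b t)) (0 : R) by exact: differentiable_pair.
  apply: DeriveDef; first exact/derivable1_diffP.
  by rewrite deriveE // (diff_pair D1 D2) /= -!deriveE // E1 E2.
have D1 : is_derive (0 : R) (1 : R) i1 (1, 0).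
  exact: dp.
have D2 : is_derive (0 : R) (1 : R) i2 (0, 1).
  exact: dp.
have D3 : is_derive (0 : R) (1 : R) ii (1, 1).
  exact: dp.
have F1 := is_derive_comp D1 (dm : differentiable _ (i1 0)).
have F2 := is_derive_comp D2 (dm : differentiable _ (i2 0)).
have F3 := is_derive_comp D3 (dm : differentiable _ (ii 0)).
have [_ vX] := exp_line X; have [_ vY] := exp_line Y.
have EX : 'd (cmap c \o m) ((0, 0) : R^o * R^o) (1, 0) = X.
  apply: is_derive_unique F1 _.
  have -> : (cmap c \o m) \o i1 = (cmap c \o (fun t : R => e (t *: X))); last exact: vX.
  by apply/funext => t; rewrite /m /= scale0r exp0 mulg1.
have EY : 'd (cmap c \o m) ((0, 0) : R^o * R^o) (0, 1) = Y.
  apply: is_derive_unique F2 _.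
  have -> : (cmap c \o m) \o i2 = (cmap c \o (fun t : R => e (t *: Y))); last exact: vY.
  by apply/funext => t; rewrite /m /= scale0r exp0 mul1g.
apply: is_derive_eq F3 _.
have -> : ((1, 1) : R^o * R^o) = (1, 0) + (0, 1).
  by congr pair; rewrite /= ?addr0 ?add0r.
by rewrite linearD EX EY.
Qed.

End ExpAd.

(** * Linear functions and invariance of the Killing form *)

Section LinearFun.
Variables (F : pzRingType) (U V : lmodType F) (f : U -> V).
Hypothesis lf : linear f.
Let L : {linear U -> V} := HB.pack f (GRing.isLinear.Build _ _ _ _ _ lf).

Lemma linD x y : f (x + y) = f x + f y. Proof. exact: (linearD L). Qed.
Lemma linN x : f (- x) = - f x. Proof. exact: (linearN L). Qed.
Lemma linB x y : f (x - y) = f x - f y. Proof. exact: (linearB L). Qed.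
Lemma lin0 : f 0 = 0. Proof. exact: (linear0 L). Qed.
Lemma linZ a x : f (a *: x) = a *: f x. Proof. exact: (linearZZ L). Qed.
Lemma lin_sum I r (P : pred I) E :
  f (\sum_(i <- r | P i) E i) = \sum_(i <- r | P i) f (E i).
Proof. exact: (linear_sum L). Qed.

End LinearFun.

Lemma lin1_mxP (F : comPzRingType) m n (f : 'rV[F]_m -> 'rV[F]_n) : linear f ->
  forall v, v *m lin1_mx f = f v.
Proof.
move=> lf v; pose L : {linear 'rV[F]_m -> 'rV[F]_n} :=
  HB.pack f (GRing.isLinear.Build _ _ _ _ _ lf).
exact: (mul_rV_lin1 L).
Qed.

Section KillingForm.
Variables (F : fieldType) (N : nat).
Variable br : 'rV[F]_N -> 'rV[F]_N -> 'rV[F]_N.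
Hypothesis br_l : forall y, linear (br^~ y).
Hypothesis br_r : forall x, linear (br x).

Definition kform (x y : 'rV[F]_N) : F := \tr (lin1_mx (br x) *m lin1_mx (br y)).

Lemma kformC x y : kform x y = kform y x.
Proof. exact: mxtrace_mulC. Qed.

Lemma kform_linear x : scalar (kform x).
Proof.
move=> a y y'; rewrite /kform (_ : lin1_mx (br (a *: y + y')) =
  a *: lin1_mx (br y) + lin1_mx (br y')); last first.
  apply/row_matrixP => i; rewrite !rowE mulmxDr -scalemxAr !lin1_mxP //.
  by have := br_l (delta_mx 0 i) a y y'.
by rewrite mulmxDr -scalemxAr mxtraceD mxtraceZ.
Qed.

(** The operator ad(f z) is conjugate to ad z by [f], and traces are invariant under conjugation. *)
Lemma kform_aut (f f' : 'rV[F]_N -> 'rV[F]_N) : linear f -> linear f' ->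
  cancel f f' -> cancel f' f -> (forall x y, f (br x y) = br (f x) (f y)) ->
  forall x y, kform (f x) (f y) = kform x y.
Proof.
move=> lf lf' fK f'K fbr x y.
have E z : lin1_mx (br (f z)) = lin1_mx f' *m lin1_mx (br z) *m lin1_mx f.
  apply/row_matrixP => i; rewrite !rowE !mulmxA !lin1_mxP //.
  by rewrite fbr f'K.
have ff' : lin1_mx f *m lin1_mx f' = 1%:M.
  by apply/row_matrixP => i; rewrite !rowE !mulmxA mulmx1 !lin1_mxP.
rewrite /kform !E -!mulmxA mxtrace_mulC -!mulmxA ff' mulmx1.
by rewrite [lin1_mx f *m _]mulmxA ff' mul1mx.
Qed.

Hypothesis br_alt : forall x, br x x = 0.
Hypothesis br_jacobi : forall x y z,
  br x (br y z) + br y (br z x) + br z (br x y) = 0.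

Lemma brN x y : br x y = - br y x.
Proof.
have := br_alt (x + y).
rewrite (linD (br_r _)) !(linD (br_l _)) !br_alt add0r addr0 addrC => /eqP.
by rewrite addr_eq0 => /eqP.
Qed.

Lemma jacobi_ad x y v : br (br x y) v = br x (br y v) - br y (br x v).
Proof.
have := br_jacobi x y v; rewrite (brN v x) (brN v (br x y)) (linN (br_r _)).
by move=> /eqP; rewrite subr_eq0 => /eqP <-.
Qed.

Lemma kform_inv x y z : kform (br x y) z = kform x (br y z).
Proof.
have lin1_br a b : lin1_mx (br (br a b)) =
    lin1_mx (br b) *m lin1_mx (br a) - lin1_mx (br a) *m lin1_mx (br b).
  apply/row_matrixP => i; rewrite !rowE mulmxBr !mulmxA !lin1_mxP //.
  exact: jacobi_ad.
rewrite /kform !lin1_br mulmxBl mulmxBr !raddfB /=.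
congr (_ - _); last by rewrite mulmxA.
by rewrite -mulmxA mxtrace_mulC -mulmxA.
Qed.

End KillingForm.

(** * Hermitian forms: orthonormal expansion and simultaneous diagonalization *)

Section Hermitian.
Variables (R : realType) (N : nat).
Local Notation C := R[i].
Local Notation VC := 'rV[C]_N.
Variable H : VC -> VC -> C.
Hypothesis H_lin : forall Y, scalar (H^~ Y).
Hypothesis H_conj : forall X Y, conjc (H X Y) = H Y X.
Hypothesis H_pos : forall X, X != 0 -> 0 < H X X.

Lemma HDl X X' Y : H (X + X') Y = H X Y + H X' Y.
Proof. by have := linD (V := C^o) (H_lin Y) X X'. Qed.
Lemma HZl a X Y : H (a *: X) Y = a * H X Y.
Proof. by have := linZ (V := C^o) (H_lin Y) a X. Qed.
Lemma HNl X Y : H (- X) Y = - H X Y.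
Proof. by rewrite -scaleN1r HZl mulN1r. Qed.
Lemma H0l Y : H 0 Y = 0.
Proof. by rewrite -[0](scale0r 0) HZl mul0r. Qed.
Lemma HDr X Y Y' : H X (Y + Y') = H X Y + H X Y'.
Proof. by rewrite -!(H_conj _ X) HDl rmorphD. Qed.
Lemma HZr a X Y : H X (a *: Y) = conjc a * H X Y.
Proof. by rewrite -!(H_conj _ X) HZl rmorphM. Qed.
Lemma HNr X Y : H X (- Y) = - H X Y.
Proof. by rewrite -!(H_conj _ X) HNl rmorphN. Qed.
Lemma Hsuml I r (P : pred I) E Y :
  H (\sum_(i <- r | P i) E i) Y = \sum_(i <- r | P i) H (E i) Y.
Proof. exact: (lin_sum (V := C^o) (H_lin Y)). Qed.
Lemma H_eq0 X : H X X = 0 -> X = 0.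
Proof.
move=> HX; apply/eqP; case: (eqVneq X 0) => // /H_pos.
by rewrite HX ltxx.
Qed.

Definition orthonormal_family k (E : 'I_k -> VC) :=
  forall i j, H (E i) (E j) = (i == j)%:R.

Lemma orthonormal_expand (E : 'I_N -> VC) : orthonormal_family E ->
  forall X, X = \sum_i H X (E i) *: E i.
Proof.
move=> oE X.
pose f (X : VC) : VC := \row_i H X (E i).
have lf : linear f.
  by move=> a x y; apply/rowP => i; rewrite !mxE HDl HZl.
pose M : 'M[C]_N := \matrix_i E i.
have MT : M *m lin1_mx f = 1%:M.
  apply/row_matrixP => i; rewrite row_mul rowK lin1_mxP //.
  by apply/rowP => j; rewrite !mxE oE.
(* [M] is square, so its right inverse is also a left inverse: [N] orthonormal vectors are
   complete. *)
have TM := mulmx1C MT.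
have -> : \sum_i H X (E i) *: E i = f X *m M.
  rewrite mulmx_sum_row; apply: eq_bigr => i _.
  by rewrite rowK mxE.
by rewrite -(lin1_mxP lf) -mulmxA TM mulmx1.
Qed.

Lemma parseval (E : 'I_N -> VC) : orthonormal_family E ->
  forall X Y, H X Y = \sum_i H X (E i) * conjc (H Y (E i)).
Proof.
move=> oE X Y; rewrite {1}(orthonormal_expand oE X) Hsuml.
by apply: eq_bigr => i _; rewrite HZl H_conj.
Qed.

(* One eigenvector is split off at a time; the adjoint condition makes the
   orthogonal complement of the vectors found so far stable. *)
Lemma unitary_codiagonalization (As : seq 'M[C]_N) :
  {in As &, forall A A', A *m A' = A' *m A} ->
  {in As, forall A, exists2 A', A' \in As & exists c, forall X Y,
     H (X *m A) Y = c * H X (Y *m A')} ->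
  exists E : 'I_N -> VC, orthonormal_family E /\
    forall i, {in As, forall A, exists a, E i *m A = a *: E i}.
Proof.
move=> cA adjA.
suff Hk k : (k <= N)%N -> exists E : 'I_k -> VC, orthonormal_family E /\
    forall i, {in As, forall A, exists a, E i *m A = a *: E i} by exact: Hk.
elim: k => [|k IH] lekN; first by exists (fun=> 0); split; case.
have [E [oE eE]] := IH (ltnW lekN).
pose f (X : VC) : 'rV[C]_k := \row_i H X (E i).
have lf : linear f by move=> a x y; apply/rowP => i; rewrite !mxE HDl HZl.
pose T := lin1_mx f.
have [W [WE Wf]] : exists W : 'M[C]_(\rank (kermx T), N),
    (W :=: kermx T)%MS /\ row_free W.
  by exists (row_base (kermx T)); split; [exact: eq_row_base|exact: row_base_free].
have WT : W *m T = 0.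
  by apply/sub_kermxP; rewrite WE.
have rW : (0 < \rank (kermx T))%N.
  rewrite mxrank_ker subn_gt0 (leq_ltn_trans (rank_leq_col _)) //.
have stabW A : A \in As -> (W *m A <= W)%MS.
  move=> As_A; rewrite WE; apply/sub_kermxP.
  apply/row_matrixP => i; rewrite !row_mul row0 lin1_mxP //.
  have Wi : f (row i W) = 0 by rewrite -lin1_mxP // -row_mul WT row0.
  apply/rowP => j; rewrite !mxE.
  have [A' As_A' [c ->]] := adjA A As_A.
  have [a ->] := eE j A' As_A'.
  move/rowP/(_ j): Wi; rewrite !mxE HZr => ->.
  by rewrite !mulr0.
(* [res A] is the matrix of [A] on the orthogonal complement, in the basis given by the rows of [W];
   these matrices commute and so share an eigenvector. *)
have [res resE] : exists res : 'M[C]_N -> 'M[C]_(\rank (kermx T)),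
    forall A, A \in As -> res A *m W = W *m A.
  exists (fun A => W *m A *m pinvmx W) => A As_A.
  by rewrite mulmxKpV ?stabW.
have cr : {in [seq res A | A <- As] &, forall A A', comm_mx A A'}.
  move=> _ _ /mapP[A As_A ->] /mapP[A' As_A' ->].
  apply: (row_free_inj Wf).
  rewrite -!mulmxA (resE A) // (resE A') // !mulmxA (resE A) // (resE A') //.
  by rewrite -!mulmxA cA.
have [v vn0 /allP ev] := @spectral.common_eigenvector _ _ _ rW cr.
pose u := v *m W.
have un0 : u != 0.
  apply: contraNneq vn0 => u0; apply/eqP.
  by apply: (row_free_inj Wf); rewrite mul0mx -u0.
have fu : f u = 0 by rewrite -lin1_mxP // -mulmxA WT mulmx0.
have eu A : A \in As -> exists a, u *m A = a *: u.
  move=> As_A; have /ev/sub_rVP[a Ea] : res A \in [seq res A | A <- As].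
    exact: map_f.
  by exists a; rewrite -mulmxA -resE // mulmxA Ea scalemxAl.
pose s := (sqrtC (H u u))^-1.
have s0 : 0 < s by rewrite invr_gt0 sqrtC_gt0 H_pos.
have sc : conjc s = s by have := gtr0_real s0 => /complex_realP[x ->]; rewrite conjc_real.
pose w := s *: u.
have Hww : H w w = 1.
  rewrite HZl HZr sc mulrA -expr2 exprVn sqrtCK mulVf //.
  by rewrite gt_eqF // H_pos.
have HwE j : H w (E j) = 0.
  by move/rowP/(_ j): fu; rewrite !mxE HZl => ->; rewrite mulr0.
have HEw j : H (E j) w = 0 by rewrite -H_conj HwE rmorph0.
exists (fun i => if unlift ord_max i is Some j then E j else w); split.
  move=> i j; case: (unliftP ord_max i) => [i'|] ->; case: (unliftP ord_max j) => [j'|] ->.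
  - by rewrite oE (inj_eq lift_inj).
  - by rewrite HEw eq_sym (negPf (neq_lift _ _)).
  - by rewrite HwE (negPf (neq_lift _ _)).
  - by rewrite Hww eqxx.
move=> i A As_A; case: (unliftP ord_max i) => [i'|] _; first exact: eE.
by have [a Ea] := eu A As_A; exists a; rewrite -scalemxAl Ea !scalerA mulrC.
Qed.

End Hermitian.

(** * The complexified Lie algebra *)

Section ComplexLie.
Variables (R : realType) (N : nat) (G : lieGroup R N) (g : lieAlgebra G).
Local Notation C := R[i].
Local Notation VC := 'rV[C]_N.
Local Notation cplx := (@cplx R N).

Definition conjV (X : VC) : VC := map_mx (@conjc R) X.

Lemma cplx_split (X : VC) : X = cplx (reV X) + 'i%C *: cplx (imV X).
Proof. by apply/rowP => j; rewrite !mxE -complexE. Qed.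

Lemma cplxD x y : cplx (x + y) = cplx x + cplx y.
Proof. exact: map_mxD. Qed.
Lemma cplxN x : cplx (- x) = - cplx x.
Proof. exact: map_mxN. Qed.
Lemma cplxZ a x : cplx (a *: x) = a%:C%C *: cplx x.
Proof. exact: map_mxZ. Qed.
Lemma cplx0 : cplx 0 = 0.
Proof. exact: map_mx0. Qed.

Lemma reVD X Y : reV (X + Y) = reV X + reV Y :> 'rV[R]_N.
Proof. by apply/rowP => j; rewrite !mxE; case: (X 0 j) (Y 0 j) => ? ? []. Qed.
Lemma imVD X Y : imV (X + Y) = imV X + imV Y :> 'rV[R]_N.
Proof. by apply/rowP => j; rewrite !mxE; case: (X 0 j) (Y 0 j) => ? ? []. Qed.
Lemma reVZ a X :
  reV (a *: X) = complex.Re a *: reV X - complex.Im a *: imV X :> 'rV[R]_N.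
Proof. by apply/rowP => j; rewrite !mxE; case: a (X 0 j) => ? ? []. Qed.
Lemma imVZ a X :
  imV (a *: X) = complex.Re a *: imV X + complex.Im a *: reV X :> 'rV[R]_N.
Proof. by apply/rowP => j; rewrite !mxE; case: a (X 0 j) => ? ? [] * /=; rewrite addrC. Qed.
Lemma reV_cplx x : reV (cplx x) = x.
Proof. by apply/rowP => j; rewrite !mxE. Qed.
Lemma imV_cplx x : imV (cplx x) = 0.
Proof. by apply/rowP => j; rewrite !mxE. Qed.
Lemma reV_conj X : reV (conjV X) = reV X :> 'rV[R]_N.
Proof. by apply/rowP => j; rewrite !mxE; case: (X 0 j). Qed.
Lemma imV_conj X : imV (conjV X) = - imV X :> 'rV[R]_N.
Proof. by apply/rowP => j; rewrite !mxE; case: (X 0 j). Qed.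
Lemma cplx_inj : injective cplx.
Proof. by move=> x y /(congr1 (@reV R N)); rewrite !reV_cplx. Qed.

Lemma conjVD X Y : conjV (X + Y) = conjV X + conjV Y.
Proof. exact: map_mxD. Qed.
Lemma conjVZ a X : conjV (a *: X) = conjc a *: conjV X.
Proof. exact: map_mxZ. Qed.
Lemma conjVK : involutive conjV.
Proof. by move=> X; apply/rowP => j; rewrite !mxE conjcK. Qed.
Lemma conjV_cplx x : conjV (cplx x) = cplx x.
Proof. by apply/rowP => j; rewrite !mxE conjc_real. Qed.

Lemma clin_ext (W : lmodType C) (f h : VC -> W) : linear f -> linear h ->
  (forall x, f (cplx x) = h (cplx x)) -> forall X, f X = h X.
Proof.
by move=> lf lh fh X; rewrite (cplx_split X) !(linD lf, linD lh) !(linZ lf, linZ lh) !fh.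
Qed.

(** The Jacobi expression is linear in each argument, so [clin_ext] reduces it to real vectors one
    argument at a time. *)
Lemma jacobi_ext (br : VC -> VC -> VC) :
  (forall Y, linear (br^~ Y)) -> (forall X, linear (br X)) ->
  (forall x y z, br (cplx x) (br (cplx y) (cplx z)) +
     br (cplx y) (br (cplx z) (cplx x)) + br (cplx z) (br (cplx x) (cplx y)) = 0) ->
  forall X Y Z, br X (br Y Z) + br Y (br Z X) + br Z (br X Y) = 0.
Proof.
move=> br_l br_r J X Y Z.
have lc : linear (fun _ : VC => 0 : VC) by move=> a x y; rewrite scaler0 addr0.
have D U U' W : br (U + U') W = br U W + br U' W by exact: (linD (br_l W)).
have Zl a U W : br (a *: U) W = a *: br U W by exact: (linZ (br_l W)).
have Dr U U' W : br W (U + U') = br W U + br W U' by exact: (linD (br_r W)).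
have Zr a U W : br W (a *: U) = a *: br W U by exact: (linZ (br_r W)).
move: X; apply: clin_ext => //.
  move=> a x y; rewrite !(D, Zl, Dr, Zr) !scalerDr.
  by rewrite [X in X + _ = _]addrACA [LHS]addrACA.
move=> x; move: Y; apply: clin_ext => //.
  move=> a y y'; rewrite !(D, Zl, Dr, Zr) !scalerDr.
  by rewrite [X in X + _ = _]addrACA [LHS]addrACA.
move=> y; move: Z; apply: clin_ext => //.
move=> a z z'; rewrite !(D, Zl, Dr, Zr) !scalerDr.
by rewrite [X in X + _ = _]addrACA [LHS]addrACA.
Qed.

Lemma linC_linear (f : 'End('rV[R]_N)) : linear (linC f).
Proof.
move=> a X Y; rewrite /linC reVD imVD reVZ imVZ !(linearD, linearN, linearZ) /=.
by apply/rowP => j; rewrite !mxE; case: a => p q; apply/eqP;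
  rewrite eq_complex /=; apply/andP; split; apply/eqP; ring.
Qed.

Lemma linC_cplx (f : 'End('rV[R]_N)) x : linC f (cplx x) = cplx (f x).
Proof. by rewrite /linC reV_cplx imV_cplx linear0 cplx0 scaler0 addr0. Qed.

Local Notation lbr := (lbr g).
Local Notation lbrC := (lbrC g).

Lemma lbrNr x y : lbr x (- y) = - lbr x y.
Proof. exact: linearN. Qed.

Lemma lbrC_cplx x y : lbrC (cplx x) (cplx y) = cplx (lbr x y).
Proof.
by rewrite /lbrC !reV_cplx !imV_cplx !linear0 !lbr0l ?subr0 !addr0 cplx0 scaler0 addr0.
Qed.

Lemma lbrC_anti X Y : lbrC X Y = - lbrC Y X.
Proof.
rewrite /lbrC opprD -!scalerN -!cplxN !opprB.
rewrite ![_ (reV X) _]lbrC0 ![_ (imV X) _]lbrC0 opprK.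
congr (cplx _ + _ *: cplx _); first by rewrite addrC.
by rewrite opprD addrC.
Qed.

Lemma lbrC_linl Y : linear (lbrC^~ Y).
Proof.
move=> a X X'; rewrite /lbrC reVD imVD reVZ imVZ !(lbrDl, lbrZl, lbrNl).
by apply/rowP => j; rewrite !mxE; case: a => p q; apply/eqP;
  rewrite eq_complex /=; apply/andP; split; apply/eqP; ring.
Qed.

Lemma lbrC_linr X : linear (lbrC X).
Proof.
move=> a Y Y'; rewrite ![lbrC X _]lbrC_anti (linD (lbrC_linl _)).
by rewrite (linZ (lbrC_linl _)) opprD scalerN.
Qed.

Lemma lbrC_alt X : lbrC X X = 0.
Proof.
rewrite /lbrC !lbr_alt subrr [lbr (reV X) _]lbrC0 addNr cplx0 scaler0.
exact: addr0.
Qed.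

Lemma lbrC_jacobi X Y Z :
  lbrC X (lbrC Y Z) + lbrC Y (lbrC Z X) + lbrC Z (lbrC X Y) = 0.
Proof.
apply: (jacobi_ext lbrC_linl lbrC_linr) => x y z.
by rewrite !lbrC_cplx -!cplxD lbr_jacobi cplx0.
Qed.

Lemma lbrC_ad X Y Z : lbrC (lbrC X Y) Z = lbrC X (lbrC Y Z) - lbrC Y (lbrC X Z).
Proof.
exact: (jacobi_ad lbrC_linl lbrC_linr lbrC_alt lbrC_jacobi).
Qed.

Local Notation B := (killingC g).

Lemma killingCC X Y : B X Y = B Y X.
Proof. exact: kformC. Qed.

Lemma killingC_lin X : scalar (B X).
Proof. exact: (kform_linear lbrC_linl lbrC_linr). Qed.

Lemma killingC_inv X Y Z : B (lbrC X Y) Z = B X (lbrC Y Z).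
Proof.
exact: (kform_inv lbrC_linl lbrC_linr lbrC_alt lbrC_jacobi).
Qed.

Lemma lin1_mx_cplx (f : 'rV[R]_N -> 'rV[R]_N) (F : VC -> VC) :
  linear f -> linear F -> (forall x, F (cplx x) = cplx (f x)) ->
  lin1_mx F = map_mx (real_complex R) (lin1_mx f).
Proof.
move=> lf lF E; apply/row_matrixP => i.
rewrite -map_row !rowE !lin1_mxP // -[RHS]E; congr F.
by apply/rowP => j; rewrite !mxE; case: (_ && _).
Qed.

Lemma killingC_cplx x y : B (cplx x) (cplx y) = (killing g x y)%:C%C.
Proof.
have E z : lin1_mx (lbrC (cplx z)) = map_mx (real_complex R) (lin1_mx (lbr z)).
  apply: lin1_mx_cplx; [exact: lbr_linearr|exact: lbrC_linr|].
  by move=> t; exact: lbrC_cplx.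
by rewrite /killingC !E -map_mxM trace_map_mx.
Qed.

Lemma conjV_lbrC X Y : conjV (lbrC X Y) = lbrC (conjV X) (conjV Y).
Proof.
rewrite /lbrC !reV_conj !imV_conj conjVD conjVZ !conjV_cplx.
have -> : conjc 'i%C = - 'i%C :> C by rewrite /= -[RHS]/(Complex (-0) (-1)) oppr0.
rewrite !lbrNl !lbrNr opprK.
by rewrite -opprD cplxN scalerN scaleNr.
Qed.

Lemma lin1_mx_conjV (f f' : VC -> VC) : linear f -> linear f' ->
  (forall X, f' (conjV X) = conjV (f X)) ->
  lin1_mx f' = map_mx (@conjc R) (lin1_mx f).
Proof.
move=> lf lf' E; apply/row_matrixP => i; rewrite -map_row 2!rowE.
rewrite (lin1_mxP lf) (lin1_mxP lf') -[RHS]/(conjV _) -E; congr f'.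
apply/rowP => j; rewrite !mxE.
by case: (_ && _); rewrite ?conjc1 ?conjc0.
Qed.

Lemma killingC_conj X Y : B (conjV X) (conjV Y) = conjc (B X Y).
Proof.
have E Z : lin1_mx (lbrC (conjV Z)) = map_mx (@conjc R) (lin1_mx (lbrC Z)).
  apply: lin1_mx_conjV; [exact: lbrC_linr|exact: lbrC_linr|].
  by move=> U; rewrite conjV_lbrC.
by rewrite /killingC (E X) (E Y) -map_mxM trace_map_mx.
Qed.

End ComplexLie.

(* Locked copies, so that unification does not unfold them into sums. *)
Definition br (R : realType) (N : nat) (G : lieGroup R N) (g : lieAlgebra G) :
  'rV[R[i]]_N -> 'rV[R[i]]_N -> 'rV[R[i]]_N := locked (lbrC g).

Definition thC (R : realType) (N : nat) (G : lieGroup R N) (g : lieAlgebra G)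
  (D : cartanData g) : 'rV[R[i]]_N -> 'rV[R[i]]_N := locked (linC (theta D)).

(** * The compact conjugation and its Hermitian form *)

Section CompactConjugation.
Variables (R : realType) (N : nat) (G : lieGroup R N) (g : lieAlgebra G).
Variable D : cartanData g.
Local Notation C := R[i].
Local Notation VC := 'rV[C]_N.
Local Notation cplx := (@cplx R N).
Local Notation conjV := (@conjV R N).
Local Notation br := (br g).
Local Notation B := (killingC g).
Local Notation th := (theta D).

Lemma brE : lbrC g = br. Proof. by rewrite /br -lock. Qed.

Lemma br_linl Y : linear (br^~ Y). Proof. rewrite -brE; exact: lbrC_linl. Qed.
Lemma br_linr X : linear (br X). Proof. rewrite -brE; exact: lbrC_linr. Qed.
Lemma br_cplx x y : br (cplx x) (cplx y) = cplx (lbr g x y).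
Proof. by rewrite -brE lbrC_cplx. Qed.
Lemma br_anti X Y : br X Y = - br Y X.
Proof. by rewrite -brE lbrC_anti. Qed.
Lemma br_ad X Y Z : br (br X Y) Z = br X (br Y Z) - br Y (br X Z).
Proof. by rewrite -brE lbrC_ad. Qed.
Lemma B_inv X Y Z : B (br X Y) Z = B X (br Y Z).
Proof. by rewrite -brE killingC_inv. Qed.
Lemma conjV_br X Y : conjV (br X Y) = br (conjV X) (conjV Y).
Proof. by rewrite -brE conjV_lbrC. Qed.
Lemma brDl X X' Y : br (X + X') Y = br X Y + br X' Y.
Proof. exact: (linD (br_linl Y)). Qed.
Lemma brZl a X Y : br (a *: X) Y = a *: br X Y.
Proof. exact: (linZ (br_linl Y)). Qed.
Lemma brNl X Y : br (- X) Y = - br X Y.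
Proof. exact: (linN (br_linl Y)). Qed.
Lemma brDr X X' Y : br Y (X + X') = br Y X + br Y X'.
Proof. exact: (linD (br_linr Y)). Qed.
Lemma brZr a X Y : br Y (a *: X) = a *: br Y X.
Proof. exact: (linZ (br_linr Y)). Qed.
Lemma brNr X Y : br Y (- X) = - br Y X.
Proof. exact: (linN (br_linr Y)). Qed.
Lemma br0l Y : br 0 Y = 0.
Proof. exact: (lin0 (br_linl Y)). Qed.
Lemma br0r Y : br Y 0 = 0.
Proof. exact: (lin0 (br_linr Y)). Qed.
Lemma BDr X Y Y' : B X (Y + Y') = B X Y + B X Y'.
Proof. exact: (linD (V := C^o) (@killingC_lin _ _ _ g X)). Qed.
Lemma BZr a X Y : B X (a *: Y) = a * B X Y.
Proof. exact: (linZ (V := C^o) (@killingC_lin _ _ _ g X)). Qed.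
Lemma BNr X Y : B X (- Y) = - B X Y.
Proof. by rewrite -scaleN1r BZr mulN1r. Qed.
Lemma BDl X X' Y : B (X + X') Y = B X Y + B X' Y.
Proof. by rewrite !(killingCC _ _ Y) BDr. Qed.
Lemma BZl a X Y : B (a *: X) Y = a * B X Y.
Proof. by rewrite !(killingCC _ _ Y) BZr. Qed.
Lemma BNl X Y : B (- X) Y = - B X Y.
Proof. by rewrite !(killingCC _ _ Y) BNr. Qed.

Lemma thetaK x : th (th x) = x.
Proof. by have [+ _ _] := theta_cartan D; apply. Qed.
Lemma theta_br x y : th (lbr g x y) = lbr g (th x) (th y).
Proof. by have [_ + _] := theta_cartan D; apply. Qed.
Lemma theta_pos x : x != 0 -> 0 < - killing g x (th x).
Proof. by have [_ _] := theta_cartan D; apply. Qed.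

Local Notation thC := (thC D).

Lemma thCE : linC th = thC. Proof. by rewrite /thC -lock. Qed.

Lemma thC_lin : linear thC. Proof. rewrite -thCE; exact: linC_linear. Qed.
Lemma thCD X Y : thC (X + Y) = thC X + thC Y. Proof. exact: (linD thC_lin). Qed.
Lemma thCZ a X : thC (a *: X) = a *: thC X. Proof. exact: (linZ thC_lin). Qed.
Lemma thC_cplx x : thC (cplx x) = cplx (th x).
Proof. by rewrite -thCE linC_cplx. Qed.

Lemma thCK X : thC (thC X) = X.
Proof.
apply: (clin_ext (f := fun X => thC (thC X)) (h := id)) => [a x y|a x y|x] //.
  by rewrite /= !(thCD, thCZ).
by rewrite /= !thC_cplx thetaK.
Qed.

Lemma thC_br X Y : thC (br X Y) = br (thC X) (thC Y).
Proof.
move: X; apply: (clin_ext (f := fun X => thC (br X Y))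
    (h := fun X => br (thC X) (thC Y))) => [a x y|a x y|x].
- by rewrite /= brDl brZl !(thCD, thCZ).
- by rewrite /= !(thCD, thCZ) brDl brZl.
move: Y; apply: (clin_ext (f := fun Y => thC (br (cplx x) Y))
    (h := fun Y => br (thC (cplx x)) (thC Y))) => [a y z|a y z|y].
- by rewrite /= brDr brZr !(thCD, thCZ).
- by rewrite /= !(thCD, thCZ) brDr brZr.
by rewrite /= br_cplx !thC_cplx br_cplx theta_br.
Qed.

Lemma thC_B X Y : B (thC X) (thC Y) = B X Y.
Proof.
have := thC_br; rewrite -brE => thbr.
exact: (kform_aut (lbrC_linr g) thC_lin thC_lin thCK thCK thbr).
Qed.

Lemma thC_conj X : thC (conjV X) = conjV (thC X).
Proof.
rewrite {1}(cplx_split X) {1}[in RHS](cplx_split X) conjVD conjVZ !conjV_cplx.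
by rewrite !(thCD, thCZ) !thC_cplx conjVD conjVZ !conjV_cplx.
Qed.

(** The conjugation of the complexified algebra with respect to the compact real form k + i p. *)
Definition sg : VC -> VC := locked (fun X => thC (conjV X)).

Lemma sgE X : sg X = thC (conjV X). Proof. by rewrite /sg -lock. Qed.

Lemma sgD X Y : sg (X + Y) = sg X + sg Y.
Proof. by rewrite !sgE conjVD (linD thC_lin). Qed.
Lemma sgZ a X : sg (a *: X) = conjc a *: sg X.
Proof. by rewrite !sgE conjVZ (linZ thC_lin). Qed.
Lemma sgN X : sg (- X) = - sg X.
Proof. by rewrite -scaleN1r sgZ rmorphN1 /= scaleN1r. Qed.
Lemma sgK X : sg (sg X) = X.
Proof. by rewrite !sgE -thC_conj thCK conjVK. Qed.
Lemma sg_cplx x : sg (cplx x) = cplx (th x).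
Proof. by rewrite !sgE conjV_cplx thC_cplx. Qed.
Lemma sg_br X Y : sg (br X Y) = br (sg X) (sg Y).
Proof. by rewrite !sgE conjV_br thC_br. Qed.
Lemma sg_B X Y : B (sg X) (sg Y) = conjc (B X Y).
Proof. by rewrite !sgE thC_B killingC_conj. Qed.
Lemma sg_conj X : sg (conjV X) = conjV (sg X).
Proof. by rewrite !sgE thC_conj. Qed.

Definition herm : VC -> VC -> C := locked (fun X Y => - B X (sg Y)).

Lemma hermE X Y : herm X Y = - B X (sg Y). Proof. by rewrite /herm -lock. Qed.

Lemma herm_lin Y : scalar (herm^~ Y).
Proof. by move=> a X X'; rewrite !hermE BDl BZl opprD mulrN. Qed.

Lemma herm_conj X Y : conjc (herm X Y) = herm Y X.
Proof. by rewrite !hermE rmorphN /= -sg_B sgK killingCC. Qed.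

Lemma innerC x y : inner D x y = inner D y x.
Proof.
apply: complexI; rewrite /inner !rmorphN /= -!killingC_cplx.
by rewrite -(thC_B (cplx x)) !thC_cplx thetaK killingCC.
Qed.

Lemma herm_cplx x y : herm (cplx x) (cplx y) = (inner D x y)%:C%C.
Proof. by rewrite !hermE sg_cplx killingC_cplx /inner rmorphN. Qed.

(** On real vectors the form is [inner], positive because theta is a Cartan involution; in general
    the mixed terms of real and imaginary part cancel by symmetry of [inner]. *)
Lemma herm_pos X : X != 0 -> 0 < herm X X.
Proof.
move=> X0.
have E : herm X X = (inner D (reV X) (reV X) + inner D (imV X) (imV X))%:C%C.
  have HZ := HZl herm_lin; have HZ' := HZr herm_lin herm_conj.
  rewrite {1 2}(cplx_split X) (HDl herm_lin) !(HDr herm_lin herm_conj).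
  rewrite !HZ !HZ' !herm_cplx (innerC (imV X) (reV X)).
  apply/eqP; rewrite eq_complex /=; apply/andP; split; apply/eqP; ring.
have pos (x : 'rV[R]_N) : 0 <= inner D x x.
  have [->|x0] := eqVneq x 0; last exact: ltW (theta_pos x0).
  rewrite (_ : inner D 0 0 = 0) //; apply: complexI.
  by rewrite -herm_cplx cplx0 (H0l herm_lin).
rewrite E ltcR; have [re0|re0] := eqVneq (reV X) 0.
  rewrite ltr_wpDl // theta_pos //; apply: contraNneq X0 => im0.
  by rewrite (cplx_split X) re0 im0 cplx0 scaler0 addr0.
by rewrite ltr_pwDl // theta_pos.
Qed.

(** Invariance of the Killing form: up to sign, ad(sg X) is the adjoint of ad X. *)
Lemma herm_adj X Y Z : herm (br X Y) Z = - herm Y (br (sg X) Z).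
Proof.
rewrite !hermE opprK (sg_br (sg X)) sgK (br_anti X Y) BNl opprK.
exact: B_inv.
Qed.

Lemma herm_sg X Y : herm (sg X) (sg Y) = conjc (herm X Y).
Proof. by rewrite !hermE sg_B rmorphN. Qed.

Lemma herm_conjV X Y : herm (conjV X) (conjV Y) = conjc (herm X Y).
Proof. by rewrite !hermE sg_conj killingC_conj rmorphN. Qed.

Lemma B_herm X Y : B X Y = - herm X (sg Y).
Proof. by rewrite !hermE sgK opprK. Qed.

Lemma mem_cvspace (U : {vspace 'rV[R]_N}) X :
  (X \in cvspace U) = (reV X \in U) && (imV X \in U).
Proof.
apply/idP/andP.
  move=> /(coord_span (X := [tuple of map cplx (vbasis U)])) ->.
  have bU (i : 'I_(\dim U)) : [tuple of map cplx (vbasis U)]`_i = cplx (vbasis U)`_i.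
    by rewrite /= (nth_map 0) // size_tuple.
  have H : forall (F : 'I_(\dim U) -> C), let Y := \sum_i F i *: cplx (vbasis U)`_i in
      reV Y \in U /\ imV Y \in U.
    move=> F Y; rewrite /Y; elim/big_ind: _.
    - by split; rewrite (_ : _ 0 = 0) ?mem0v //; apply/rowP => j; rewrite !mxE.
    - by move=> x y [? ?] [? ?]; rewrite reVD imVD !memvD.
    - move=> i _; rewrite reVZ imVZ reV_cplx imV_cplx !scaler0 subr0 add0r.
      by split; apply: memvZ; apply: vbasis_mem; rewrite mem_nth // size_tuple.
  by under eq_bigr do rewrite bU; exact: H.
move=> [re im].
have mem_c x : x \in U -> cplx x \in cvspace U.
  move=> /coord_vbasis ->.
  have -> (F : 'I_(\dim U) -> R) : cplx (\sum_i F i *: (vbasis U)`_i) =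
      \sum_i (F i)%:C%C *: cplx (vbasis U)`_i.
    rewrite (big_morph cplx (@cplxD R N) (cplx0 R N)); apply: eq_bigr => i _.
    by rewrite cplxZ.
  apply: memv_suml => i _; apply/memvZ/memv_span/map_f.
  by rewrite mem_nth // size_tuple.
by rewrite (cplx_split X) memvD ?memvZ ?mem_c.
Qed.

End CompactConjugation.

(** * The Cartan subalgebra *)

Section CartanSubalgebra.
Variables (R : realType) (N : nat) (G : lieGroup R N) (g : lieAlgebra G).
Variable D : cartanData g.
Local Notation C := R[i].
Local Notation VC := 'rV[C]_N.
Local Notation cplx := (@cplx R N).
Local Notation br := (br g).
Local Notation B := (killingC g).
Local Notation th := (theta D).
Local Notation sg := (sg D).
Local Notation herm := (herm D).
Local Notation aR := (aR D).
Local Notation tR := (tR D).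
Local Notation hC := (hC D).

Lemma centralizer_inP (P U : {vspace 'rV[R]_N}) x :
  reflect (x \in P /\ forall u, u \in U -> lbr g u x = 0)
    (x \in centralizer_in g P U).
Proof.
rewrite /centralizer_in memv_cap.
apply: (iffP andP) => -[xP H]; split=> //.
  move=> u /coord_vbasis ->.
  have lx : linear ((lbr g)^~ x) by exact: lbr_linearl.
  rewrite (lin_sum lx) big1 // => i _; rewrite (linZ lx).
  move: H; rewrite memvE => /subv_bigcapP/(_ i isT); rewrite -memvE memv_ker lfunE /=.
  by move=> /eqP ->; rewrite scaler0.
rewrite memvE; apply/subv_bigcapP => i _; rewrite -memvE memv_ker lfunE /=.
by apply/eqP/H/vbasis_mem; rewrite mem_nth // size_tuple.
Qed.

Lemma maximal_abelian_mem (U P : {vspace 'rV[R]_N}) x : maximal_abelian g U P ->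
  x \in P -> (forall u, u \in U -> lbr g u x = 0) -> x \in U.
Proof.
move=> [UP abU maxU] xP xU.
suff <- : (U + <[x]>)%VS = U by rewrite memvE addvSr.
apply: maxU; first exact: addvSl.
  by rewrite subv_add UP -memvE.
move=> _ _ /memv_addP[u uU [_ /vlineP[a ->] ->]] /memv_addP[v vU [_ /vlineP[b ->] ->]].
rewrite lbrDl !linearD /= !lbrZl !linearZ /= (abU u v) // (xU u) // lbr_alt.
by rewrite [lbr g x v]lbrC0 (xU v) // oppr0 !scaler0 !addr0.
Qed.

Lemma kRP x : reflect (th x = x) (x \in kR D).
Proof. exact: fixedSpaceP. Qed.

Lemma aR_theta x : x \in aR -> th x = - x.
Proof.
have [/subvP s _ _] := aR_maximal D; move/s.
by rewrite memv_ker add_lfunE id_lfunE addr_eq0 => /eqP.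
Qed.

Lemma aR_abelian x y : x \in aR -> y \in aR -> lbr g x y = 0.
Proof. by have [_ + _] := aR_maximal D; apply. Qed.

Lemma aR_mem x : th x = - x -> (forall h, h \in aR -> lbr g h x = 0) -> x \in aR.
Proof.
move=> tx; apply: maximal_abelian_mem (aR_maximal D) _.
by rewrite memv_ker add_lfunE id_lfunE tx addNr.
Qed.

Lemma tR_sub x : x \in tR -> x \in mR D.
Proof. by have [/subvP s _ _] := tR_maximal D; apply: s. Qed.

Lemma mR_theta x : x \in mR D -> th x = x.
Proof. by case/centralizer_inP => /kRP. Qed.

Lemma mR_comm x h : x \in mR D -> h \in aR -> lbr g h x = 0.
Proof. by case/centralizer_inP => _; apply. Qed.

Lemma tR_theta x : x \in tR -> th x = x.
Proof. by move/tR_sub/mR_theta. Qed.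

Lemma hC_ind (P : VC -> Prop) :
  (forall X Y, P X -> P Y -> P (X + Y)) -> (forall a X, P X -> P (a *: X)) ->
  (forall h, h \in aR -> P (cplx h)) -> (forall t, t \in tR -> P (cplx t)) ->
  forall H, H \in hC -> P H.
Proof.
move=> PD PZ Pa Pt H /memv_addP[X + [Y + ->]].
rewrite !mem_cvspace => /andP[X1 X2] /andP[Y1 Y2]; apply: (PD).
  by rewrite (cplx_split X); apply: (PD); [apply: Pt|apply/PZ/Pt].
by rewrite (cplx_split Y); apply: (PD); [apply: Pa|apply/PZ/Pa].
Qed.

Lemma aR_hC h : h \in aR -> cplx h \in hC.
Proof.
move=> ha; rewrite memvE (subv_trans _ (addvSr _ _)) // -memvE mem_cvspace.
by rewrite reV_cplx imV_cplx ha mem0v.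
Qed.

Lemma tR_hC h : h \in tR -> cplx h \in hC.
Proof.
move=> ha; rewrite memvE (subv_trans _ (addvSl _ _)) // -memvE mem_cvspace.
by rewrite reV_cplx imV_cplx ha mem0v.
Qed.

Lemma sg_hC H : H \in hC -> sg H \in hC.
Proof.
move: H; apply: (hC_ind (P := fun H => sg H \in hC)) => [X Y sX sY|a X sX|h ha|t ta].
- by rewrite sgD memvD.
- by rewrite sgZ memvZ.
- by rewrite sg_cplx aR_theta // cplxN memvN aR_hC.
- by rewrite sg_cplx tR_theta // tR_hC.
Qed.

Lemma hC_abelian H H' : H \in hC -> H' \in hC -> br H H' = 0.
Proof.
have at0 h t : h \in aR -> t \in tR -> br (cplx h) (cplx t) = 0.
  by move=> ha /tR_sub tm; rewrite br_cplx mR_comm // cplx0.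
move=> + H'h; move: H; apply: (hC_ind (P := fun H => br H H' = 0)).
- by move=> X Y X0 Y0; rewrite brDl X0 Y0 addr0.
- by move=> a X X0; rewrite brZl X0 scaler0.
- move=> h ha; move: H' H'h; apply: (hC_ind (P := fun H => br (cplx h) H = 0)).
  + by move=> X Y X0 Y0; rewrite brDr X0 Y0 addr0.
  + by move=> a X X0; rewrite brZr X0 scaler0.
  + by move=> h' ha'; rewrite br_cplx aR_abelian // cplx0.
  + by move=> t tt; exact: at0.
- move=> t tt; move: H' H'h; apply: (hC_ind (P := fun H => br (cplx t) H = 0)).
  + by move=> X Y X0 Y0; rewrite brDr X0 Y0 addr0.
  + by move=> a X X0; rewrite brZr X0 scaler0.
  + by move=> h ha; rewrite br_anti at0 // oppr0.
  + move=> t' tt'; rewrite br_cplx; have [_ ab _] := tR_maximal D.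
    by rewrite ab // cplx0.
Qed.

Lemma br_reV x X : reV (br (cplx x) X) = lbr g x (reV X).
Proof.
rewrite {1}(cplx_split X) brDr brZr !br_cplx reVD reVZ !reV_cplx imV_cplx.
by rewrite scale0r scaler0 subr0 addr0.
Qed.

Lemma br_imV x X : imV (br (cplx x) X) = lbr g x (imV X).
Proof.
rewrite {1}(cplx_split X) brDr brZr !br_cplx imVD imVZ !imV_cplx reV_cplx.
by rewrite scale1r scaler0 !add0r.
Qed.

(** Taking real and imaginary parts reduces to a real [x]. Its theta-antiinvariant part lies in [aR]
    and its theta-invariant part in [tR], in both cases by maximality. *)
Lemma hC_self_centralizing X :
  (forall H, H \in hC -> br H X = 0) -> X \in hC.
Proof.
move=> X0.
suff real x : (forall h, h \in aR -> lbr g h x = 0) ->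
    (forall t, t \in tR -> lbr g t x = 0) -> cplx x \in hC.
  have re0 h : cplx h \in hC -> lbr g h (reV X) = 0.
    by move=> /X0 bX; rewrite -br_reV bX; apply/rowP => j; rewrite !mxE.
  have im0 h : cplx h \in hC -> lbr g h (imV X) = 0.
    by move=> /X0 bX; rewrite -br_imV bX; apply/rowP => j; rewrite !mxE.
  rewrite (cplx_split X) memvD ?memvZ ?real // => h hh.
  - by rewrite re0 // aR_hC.
  - by rewrite re0 // tR_hC.
  - by rewrite im0 // aR_hC.
  - by rewrite im0 // tR_hC.
move=> xa xt.
have tha h : h \in aR -> lbr g h (th x) = 0.
  move=> ha; rewrite -[h]opprK -(aR_theta ha) lbrNl -theta_br xa // linear0.
  exact: oppr0.
have tht h : h \in tR -> lbr g h (th x) = 0.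
  by move=> ht; rewrite -[h]tR_theta // -theta_br xt // linear0.
have -> : x = 2^-1 *: (x + th x) + 2^-1 *: (x - th x).
  by apply/rowP => j; rewrite !mxE; field.
rewrite cplxD !cplxZ memvD // memvZ //; last first.
  apply/aR_hC/aR_mem => [|h ha]; first by rewrite linearB /= thetaK opprB.
  by rewrite linearB /= xa // tha // subr0.
apply: tR_hC; apply: maximal_abelian_mem (tR_maximal D) _ _ => [|u ut].
  apply/centralizer_inP; split; first by apply/kRP; rewrite linearD /= thetaK addrC.
  by move=> u ua; rewrite linearD /= xa // tha // addr0.
by rewrite linearD /= xt // tht // addr0.
Qed.

(** Theta is -1 on [aR], so [aR] acts by Hermitian operators; on [tR] it is 1, whence the
    skew-Hermitian [tR_herm]. Restricted weights are therefore real, eigenvalues of [tR]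
    imaginary. *)
Lemma aR_herm h X Y : h \in aR -> herm (br (cplx h) X) Y = herm X (br (cplx h) Y).
Proof.
by move=> ha; rewrite herm_adj sg_cplx aR_theta // cplxN brNl (HNr (herm_lin D) (herm_conj D)) opprK.
Qed.

Lemma tR_herm h X Y : h \in tR -> herm (br (cplx h) X) Y = - herm X (br (cplx h) Y).
Proof. by move=> ht; rewrite herm_adj sg_cplx tR_theta. Qed.

(** Since [hC] is stable under [sg], one may test against [sg X], and there the form is definite. *)
Lemma hC_nondegenerate X : X \in hC -> (forall H, H \in hC -> B H X = 0) -> X = 0.
Proof.
move=> Xh X0; apply: (H_eq0 (herm_pos D)).
by rewrite !hermE -(killingCC g) X0 ?oppr0 // sg_hC.
Qed.

End CartanSubalgebra.

(** * Orthonormal bases of weight vectors *)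

Section Bases.
Variables (R : realType) (N : nat) (G : lieGroup R N) (g : lieAlgebra G).
Variable D : cartanData g.
Local Notation C := R[i].
Local Notation VC := 'rV[C]_N.
Local Notation cplx := (@cplx R N).
Local Notation br := (br g).
Local Notation herm := (herm D).
Local Notation aR := (aR D).
Local Notation tR := (tR D).
Local Notation hC := (hC D).
Local Notation rdual := 'Hom(subvs_of aR, R^o).
Local Notation hdual := 'Hom(subvs_of hC, C^o).
Local Notation hl := (herm_lin D).
Local Notation hc := (herm_conj D).

Definition eigenbasis (E : 'I_N -> VC) (lam : 'I_N -> rdual) : Prop :=
  orthonormal_family herm E /\ forall i (h : subvs_of aR),
    br (cplx (vsval h)) (E i) = (lam i h)%:C%C *: E i.

Definition cartan_basis (E : 'I_N -> VC) (al : 'I_N -> hdual) : Prop :=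
  orthonormal_family herm E /\ forall i, root_space (al i) (E i).

(** The operators ad x, for x in bases of [aR] and [tR], commute and are their own adjoints up to
    sign, so they have a common orthonormal eigenbasis. The root of [E i] is then its diagonal
    matrix coefficient. *)
Lemma cartan_basis_ex : exists E al, cartan_basis E al.
Proof.
pose ad (x : 'rV[R]_N) := lin1_mx (br (cplx x)).
pose As := map ad (vbasis aR ++ vbasis tR).
have mem_aR x : x \in vbasis aR -> x \in aR by apply: vbasis_mem.
have mem_tR x : x \in vbasis tR -> x \in tR by apply: vbasis_mem.
have mem_h x : x \in vbasis aR ++ vbasis tR -> cplx x \in hC.
  by rewrite mem_cat => /orP[/mem_aR/aR_hC|/mem_tR/tR_hC].
have adE x X : X *m ad x = br (cplx x) X by apply: lin1_mxP; exact: br_linr.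
have [||E [oE eE]] := unitary_codiagonalization hl hc (herm_pos D) (As := As).
- move=> _ _ /mapP[x xh ->] /mapP[y yh ->]; apply/row_matrixP => i.
  rewrite !rowE !mulmxA !adE; apply/eqP; rewrite -subr_eq0 -br_ad.
  by rewrite (hC_abelian (mem_h _ yh) (mem_h _ xh)) br0l.
- move=> _ /mapP[x xh ->]; exists (ad x); first exact: map_f.
  move: xh; rewrite mem_cat => /orP[/mem_aR xa|/mem_tR xt].
    by exists 1 => X Y; rewrite !adE aR_herm // mul1r.
  by exists (-1) => X Y; rewrite !adE tR_herm // mulN1r.
have eig i H : H \in hC -> exists a, br H (E i) = a *: E i.
  have vb (U : {vspace 'rV[R]_N}) : {subset vbasis U <= vbasis aR ++ vbasis tR} ->
      forall x, x \in U -> exists a, br (cplx x) (E i) = a *: E i.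
    move=> sU x /coord_vbasis ->; elim/big_ind: _.
    - by exists 0; rewrite cplx0 scale0r br0l.
    - by move=> u v [a Ea] [b Eb]; exists (a + b); rewrite cplxD brDl Ea Eb scalerDl.
    - move=> k _.
      have /(map_f ad)/(eE i)[a Ea] : (vbasis U)`_k \in vbasis aR ++ vbasis tR.
        by apply: sU; rewrite mem_nth // size_tuple.
      by exists ((coord (vbasis U) k x)%:C%C * a); rewrite cplxZ brZl -adE Ea scalerA.
  apply: (hC_ind (P := fun H => exists a, br H (E i) = a *: E i)).
  - by move=> X Y [a Ea] [b Eb]; exists (a + b); rewrite brDl Ea Eb scalerDl.
  - by move=> c X [a Ea]; exists (c * a); rewrite brZl Ea scalerA.
  - by apply: vb => x xa; rewrite mem_cat xa.
  - by apply: vb => x xa; rewrite mem_cat xa orbT.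
pose f i (H : subvs_of hC) : C^o := herm (br (vsval H) (E i)) (E i).
have lf i : linear (f i).
  by move=> a X Y; rewrite /f linearP brDl brZl (HDl hl) (HZl hl).
pose L i : {linear subvs_of hC -> C^o} :=
  HB.pack (f i) (GRing.isLinear.Build _ _ _ _ _ (lf i)).
exists E, (fun i => linfun (L i)); split=> // i H.
rewrite lfunE /= /f brE; have [a ->] := eig i _ (subvsP H).
by rewrite (HZl hl) oE eqxx mulr1.
Qed.

(** Restriction of a root to [aR]. The real part makes it real valued for every linear form; on the
    roots of a Cartan basis nothing is lost, by [aR_hermE]. *)
Definition resa (al : hdual) : rdual :=
  linfun (fun h : subvs_of aR => complex.Re (al (vsproj hC (cplx (vsval h)))) : R^o).

Lemma resaE al (h : subvs_of aR) :
  resa al h = complex.Re (al (vsproj hC (cplx (vsval h)))).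
Proof.
pose f (h : subvs_of aR) : R^o := complex.Re (al (vsproj hC (cplx (vsval h)))).
have lf : linear f.
  move=> a x y; rewrite /f linearP cplxD cplxZ !linearP /=.
  case: (al _) (al _) => u v [u' v'] /=; rewrite mul0r subr0.
  by [].
pose L : {linear subvs_of aR -> R^o} :=
  HB.pack f (GRing.isLinear.Build _ _ _ _ _ lf).
by rewrite -[LHS]/((linfun L) h) lfunE.
Qed.

Lemma aR_hermE h X : h \in aR -> conjc (herm (br (cplx h) X) X) = herm (br (cplx h) X) X.
Proof. by move=> ha; rewrite hc -aR_herm. Qed.

Lemma cartan_eigenbasis E al : cartan_basis E al -> eigenbasis E (resa \o al).
Proof.
move=> [oE rE]; split=> // i h.
have hh := aR_hC (subvsP h).
have := rE i (vsproj hC (cplx (vsval h))); rewrite vsprojK // brE => eq_h.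
rewrite eq_h /= resaE; congr (_ *: _).
have := aR_hermE (E i) (subvsP h).
rewrite eq_h (HZl hl) oE eqxx mulr1.
by case: (al i _) => u v /= [/eqP]; rewrite eq_sym -addr_eq0 -mulr2n mulrn_eq0 /= => /eqP ->.
Qed.

Lemma eigenbasis_coef E E' lam lam' : eigenbasis E lam -> eigenbasis E' lam' ->
  forall i j, herm (E' i) (E j) != 0 -> lam' i = lam j.
Proof.
move=> [oE rE] [oE' rE'] i j nz; apply/lfunP => h.
have := aR_herm (E' i) (E j) (subvsP h).
rewrite rE rE' (HZl hl) (HZr hl hc) conjc_real => /(mulIf nz).
exact: complexI.
Qed.

(* The sum is the trace of the operator acting by [c] on the eigenspaces. *)
Lemma change_eigenbasis (Z : lmodType C) E E' lam lam' (c : rdual -> C)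
    (s : VC -> VC -> Z) :
  (forall X X' Y, s (X + X') Y = s X Y + s X' Y) ->
  (forall a X Y, s (a *: X) Y = conjc a *: s X Y) ->
  (forall X, linear (s X)) ->
  eigenbasis E lam -> eigenbasis E' lam' ->
  \sum_i c (lam i) *: s (E i) (E i) = \sum_i c (lam' i) *: s (E' i) (E' i).
Proof.
move=> sD sZ sl bE bE'; have [oE _] := bE; have [oE' _] := bE'.
have s0 Y : s 0 Y = 0 by rewrite -[0](scale0r 0) sZ rmorph0 scale0r.
have ssum I r (P : pred I) F Y : s (\sum_(i <- r | P i) F i) Y =
    \sum_(i <- r | P i) s (F i) Y.
  by rewrite (big_morph (s^~ Y) (fun X X' => sD X X' Y) (s0 Y)).
pose u i j := herm (E' i) (E j).
(* A coefficient [u i j] survives only between equal weights, so [c] may be evaluated at either of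
   them. *)
have cu i j : c (lam' i) * u i j = c (lam j) * u i j.
  have [->|nz] := eqVneq (u i j) 0; first by rewrite !mulr0.
  by rewrite (eigenbasis_coef bE bE' nz).
have sE' i : s (E' i) (E' i) = \sum_j \sum_k (conjc (u i j) * u i k) *: s (E j) (E k).
  rewrite {1}(orthonormal_expand hl oE (E' i)) ssum; apply: eq_bigr => j _.
  rewrite sZ [in s _ (E' i)](orthonormal_expand hl oE (E' i)) (lin_sum (sl _)) scaler_sumr.
  by apply: eq_bigr => k _; rewrite (linZ (sl _)) scalerA.
have uu j k : \sum_i conjc (u i j) * u i k = (j == k)%:R.
  rewrite -oE (parseval hl hc oE'); apply: eq_bigr => i _.
  by rewrite /u (hc (E' i) (E j)) (hc (E k) (E' i)).
have term j k : \sum_i c (lam' i) *: ((conjc (u i j) * u i k) *: s (E j) (E k)) =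
    (c (lam k) * (j == k)%:R) *: s (E j) (E k).
  rewrite -uu mulr_sumr scaler_suml; apply: eq_bigr => i _.
  by rewrite scalerA mulrCA cu mulrCA.
under [RHS]eq_bigr do rewrite sE' scaler_sumr.
rewrite exchange_big /=; apply: eq_bigr => j _.
under eq_bigr do rewrite scaler_sumr.
rewrite exchange_big /= (eq_bigr _ (fun k _ => term j k)) (bigD1 j) //=.
rewrite eqxx mulr1 big1 ?addr0 // => k kj.
by rewrite eq_sym (negPf kj) mulr0 scale0r.
Qed.

Lemma change_eigenbasis_scalar E E' lam lam' (c : rdual -> C) (s : VC -> VC -> C) :
  (forall X X' Y, s (X + X') Y = s X Y + s X' Y) ->
  (forall a X Y, s (a *: X) Y = conjc a * s X Y) ->
  (forall X, scalar (s X)) ->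
  eigenbasis E lam -> eigenbasis E' lam' ->
  \sum_i c (lam i) * s (E i) (E i) = \sum_i c (lam' i) * s (E' i) (E' i).
Proof. exact: (@change_eigenbasis C^o). Qed.

End Bases.

(** * Roots, coroots and restricted multiplicities *)

Section Roots.
Variables (R : realType) (N : nat) (G : lieGroup R N) (g : lieAlgebra G).
Variable D : cartanData g.
Local Notation C := R[i].
Local Notation VC := 'rV[C]_N.
Local Notation cplx := (@cplx R N).
Local Notation br := (br g).
Local Notation B := (killingC g).
Local Notation sg := (sg D).
Local Notation herm := (herm D).
Local Notation aR := (aR D).
Local Notation hC := (hC D).
Local Notation rdual := 'Hom(subvs_of aR, R^o).
Local Notation hdual := 'Hom(subvs_of hC, C^o).
Local Notation hl := (herm_lin D).
Local Notation hc := (herm_conj D).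

Lemma br_derivation X Y Z a b : br X Y = a *: Y -> br X Z = b *: Z ->
  br X (br Y Z) = (a + b) *: br Y Z.
Proof.
move=> XY XZ; have := br_ad g X Y Z; rewrite XY XZ brZl brZr => /eqP.
by rewrite eq_sym subr_eq -scalerDl => /eqP ->.
Qed.

Section Basis.
Variables (E : 'I_N -> VC) (al : 'I_N -> hdual).
Hypothesis bE : cartan_basis E al.
Let lam i := resa (al i).
Let oE := bE.1.
Let eE : eigenbasis E lam := cartan_eigenbasis bE.
Definition alv i (X : VC) : C := al i (vsproj hC X).

Lemma rootE X i : X \in hC -> br X (E i) = alv i X *: E i.
Proof.
by move=> Xh; have := bE.2 i (vsproj hC X); rewrite vsprojK // brE.
Qed.

Lemma lamE h i : h \in aR -> br (cplx h) (E i) = (lam i (vsproj aR h))%:C%C *: E i.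
Proof. by move=> ha; have := eE.2 i (vsproj aR h); rewrite vsprojK. Qed.

Lemma basis_neq0 i : E i != 0.
Proof.
apply/eqP => E0; have := oE i i; rewrite E0 (H0l hl) eqxx => /eqP.
by rewrite eq_sym oner_eq0.
Qed.

Lemma alv_aR i h : h \in aR -> alv i (cplx h) = (lam i (vsproj aR h))%:C%C.
Proof.
move=> ha; have := lamE i ha; rewrite rootE ?aR_hC // => /eqP.
by rewrite -subr_eq0 -scalerBl scaler_eq0 (negPf (basis_neq0 i)) orbF subr_eq0 => /eqP.
Qed.

Lemma alvE X i : X \in hC -> alv i X = herm (br X (E i)) (E i).
Proof. by move=> Xh; rewrite rootE // (HZl hl) oE eqxx mulr1. Qed.

Lemma alv_sg X i : X \in hC -> alv i (sg X) = - conjc (alv i X).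
Proof.
move=> Xh; rewrite !alvE ?sg_hC // herm_adj sgK.
by rewrite hc.
Qed.

Lemma root_sg X i : X \in hC -> br X (sg (E i)) = - alv i X *: sg (E i).
Proof.
move=> Xh; rewrite -[X in br X _](sgK D) -sg_br rootE ?sg_hC // sgZ alv_sg //.
by rewrite rmorphN /= conjcK.
Qed.

Lemma alvD X Y i : alv i (X + Y) = alv i X + alv i Y.
Proof. by rewrite /alv !linearD. Qed.
Lemma alvZ a X i : alv i (a *: X) = a * alv i X.
Proof. by rewrite /alv !linearZ. Qed.

(** The element of [hC] dual to [al i] under the Killing form, see [B_hvect]. *)
Definition hvect i := - br (E i) (sg (E i)).

Lemma hvect_hC i : hvect i \in hC.
Proof.
apply: hC_self_centralizing => X Xh; rewrite /hvect brNr.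
by rewrite (br_derivation (rootE i Xh) (root_sg i Xh)) subrr scale0r oppr0.
Qed.

Lemma B_hvect X i : X \in hC -> B X (hvect i) = alv i X.
Proof.
move=> Xh; rewrite /hvect BNr -B_inv rootE // BZl (B_herm D) sgK oE eqxx.
by rewrite mulrN1 opprK.
Qed.

(** By the Jacobi identity ad(hvect i) is, up to sign, the commutator of ad E_i and ad(sg E_i),
    which are adjoint up to sign. This turns values of roots into differences of squared norms. *)
Lemma alv_hvect i j : alv j (hvect i) =
  herm (br (sg (E i)) (E j)) (br (sg (E i)) (E j)) -
  herm (br (E i) (E j)) (br (E i) (E j)).
Proof.
rewrite alvE ?hvect_hC // /hvect brNl br_ad opprB (HDl hl) (HNl hl).
by rewrite (herm_adj D (E i)) (herm_adj D (sg (E i))) sgK opprK addrC.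
Qed.

Lemma sg_hvect i : sg (hvect i) = - hvect i.
Proof. by rewrite /hvect sgN sg_br sgK br_anti. Qed.

(* Two basis vectors with the same root: [[sg (E i)], E j] is an element of the
   Cartan subalgebra that is orthogonal to it, so it vanishes; then
   [alv_hvect] forces [al] to be nonpositive on the positive coroot. *)
Lemma root_inj i j : al i != 0 -> al i = al j -> i = j.
Proof.
move=> ai0 aij; apply/eqP; apply: contraT => nij.
have avij X : alv j X = alv i X by rewrite /alv aij.
have Z0 : br (sg (E i)) (E j) = 0.
  apply: (hC_nondegenerate (D := D)) => [|X Xh].
    apply: hC_self_centralizing => X Xh.
    by rewrite (br_derivation (root_sg i Xh) (rootE j Xh)) avij addNr scale0r.
  by rewrite -B_inv root_sg // BZl killingCC (B_herm D) sgK oE eq_sym (negPf nij) oppr0 mulr0.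
have pos X : 0 <= herm X X.
  have [->|X0] := eqVneq X 0; first by rewrite (H0l hl).
  exact: ltW (herm_pos D X0).
have := alv_hvect i j; rewrite Z0 (H0l hl) sub0r avij -B_hvect ?hvect_hC //.
rewrite (B_herm D) sg_hvect (HNr hl hc) opprK => Eh.
have h0 : herm (hvect i) (hvect i) = 0.
  by apply/eqP; rewrite eq_le pos andbT Eh oppr_le0 pos.
have {}h0 := H_eq0 (herm_pos D) h0.
case/eqP: ai0; apply/lfunP => X.
have := B_hvect i (subvsP X); rewrite h0 -[0](scale0r 0) BZr mul0r /alv vsvalK => <-.
by rewrite lfunE.
Qed.

(** Only basis vectors with root [al i] can occur in [X], and by [root_inj] there is just one. *)
Lemma root_vector i X : al i != 0 -> root_space (al i) X -> X = herm X (E i) *: E i.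
Proof.
move=> ai0 rX; rewrite {1}(orthonormal_expand hl oE X) (bigD1 i) //= big1 ?addr0 //.
move=> j ji; apply/eqP; rewrite scaler_eq0; apply/orP; left.
apply: contraNT ji => nz; apply/eqP/esym/root_inj => //.
apply/lfunP => H.
have : herm (br (vsval H) X) (E j) = alv j (vsval H) * herm X (E j).
  rewrite {1}(orthonormal_expand hl oE X) (lin_sum (br_linr g _)) (Hsuml hl).
  rewrite (bigD1 j) //= big1 ?addr0 => [|k kj].
    by rewrite brZr rootE ?subvsP // !(HZl hl) oE eqxx mulr1 mulrC.
  by rewrite brZr rootE ?subvsP // !(HZl hl) oE (negPf kj) !mulr0.
have := rX H; rewrite brE => ->; rewrite (HZl hl) /alv vsvalK.
by move/(mulIf nz).
Qed.

Lemma rootsP (a : hdual) : Defs.roots a <-> a != 0 /\ exists i, a = al i.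
Proof.
split=> [[a0 [X [X0 rX]]]|[a0 [i ai]]]; split=> //; last first.
  exists (E i); split; first exact: basis_neq0.
  by rewrite ai; exact: bE.2.
have [i nz] : exists i, herm X (E i) != 0.
  apply/existsP; apply: contraNT X0 => /existsPn all0; apply/eqP.
  rewrite (orthonormal_expand hl oE X) big1 // => i _.
  by have /negPn/eqP -> := all0 i; rewrite scale0r.
exists i; apply/lfunP => H.
have : herm (br (vsval H) X) (E i) = alv i (vsval H) * herm X (E i).
  rewrite {1}(orthonormal_expand hl oE X) (lin_sum (br_linr g _)) (Hsuml hl).
  rewrite (bigD1 i) //= big1 ?addr0 => [|k kj].
    by rewrite brZr rootE ?subvsP // !(HZl hl) oE eqxx mulr1 mulrC.
  by rewrite brZr rootE ?subvsP // !(HZl hl) oE (negPf kj) !mulr0.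
have := rX H; rewrite brE => ->; rewrite (HZl hl) /alv vsvalK.
by move/(mulIf nz).
Qed.

Lemma resa0 : resa (0 : hdual) = 0.
Proof. by apply/lfunP => h; rewrite resaE !lfunE. Qed.

Lemma root_neq0 i : lam i != 0 -> al i != 0.
Proof. by apply: contraNneq => a0; rewrite /lam a0 resa0. Qed.

Lemma roots_overP (mu : rdual) (a : hdual) : mu != 0 ->
  roots_over mu a <-> exists2 i, a = al i & lam i = mu.
Proof.
move=> mu0; split=> [[/rootsP[a0 [i ai]] amu]|[i ai lmu]].
  exists i => //; apply/lfunP => h; apply: complexI.
  have := amu _ (subvsP h); rewrite ai -/(alv i (cplx (vsval h))) alv_aR ?subvsP //.
  by rewrite !vsvalK.
split; first by apply/rootsP; split; [rewrite ai root_neq0 ?lmu|exists i].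
by move=> x xa; rewrite ai -/(alv i (cplx x)) alv_aR // lmu.
Qed.

(** Over a nonzero restricted weight all roots are nonzero, so by [root_inj] each of them belongs to
    a single index: counting indices is counting roots. *)
Lemma sum_roots_over (Z : nmodType) (F : hdual -> Z) (mu : rdual) : mu != 0 ->
  \sum_(a \in roots_over mu) F a = \sum_(i | lam i == mu) F (al i).
Proof.
move=> mu0; pose r := [seq al i | i <- enum 'I_N & lam i == mu].
have ur : uniq r.
  rewrite map_inj_in_uniq; first exact/filter_uniq/enum_uniq.
  move=> i j.
  rewrite mem_filter => /andP[/eqP li _] _; apply: root_inj.
  by rewrite root_neq0 // li.
have rP a : a \in r -> exists2 i, a = al i & lam i = mu.
  move=> /mapP[j]; rewrite mem_filter => /andP[/eqP li _] ->.
  by exists j.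
have -> : roots_over mu = [set` r].
  apply/seteqP; split=> a /=; rewrite roots_overP //.
    by move=> [i -> li]; rewrite map_f // mem_filter li eqxx mem_enum.
  exact: rP.
by rewrite -(fsbig_seq _ _ ur) big_map big_filter big_enum_cond.
Qed.

Lemma finite_roots_over (mu : rdual) : mu != 0 -> finite_set (roots_over mu).
Proof.
move=> mu0; apply: (sub_finite_set (B := [set` map al (enum 'I_N)])) => // a.
by rewrite roots_overP // => -[i -> _] /=; rewrite map_f ?mem_enum.
Qed.

Lemma mtpE (mu : rdual) : mu != 0 -> mtp mu = #|[pred i | lam i == mu]|.
Proof.
move=> mu0; rewrite /mtp card_fset_sum1 -fsbig_finite; last exact: finite_roots_over.
by rewrite (sum_roots_over (fun=> 1%N)) // sum1_card.
Qed.

(** A restricted root needs a real eigenvector. Since [aR] acts by real operators with real weights,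
    the real or the imaginary part of [E i] is one. *)
Lemma SigmaP (mu : rdual) : Sigma D mu <-> mu != 0 /\ exists i, mu = lam i.
Proof.
split=> [[mu0 [x [x0 rx]]]|[mu0 [i mui]]]; split=> //; last first.
  have re h : h \in aR -> lbr g h (reV (E i)) = mu (vsproj aR h) *: reV (E i).
    by move=> ha; rewrite -br_reV lamE // reVZ /= scale0r subr0 mui.
  have im h : h \in aR -> lbr g h (imV (E i)) = mu (vsproj aR h) *: imV (E i).
    by move=> ha; rewrite -br_imV lamE // imVZ /= scale0r addr0 mui.
  have [r0|r0] := eqVneq (reV (E i)) 0.
    exists (imV (E i)); split; last by move=> h; rewrite im ?subvsP // vsvalK.
    apply: contraNneq (basis_neq0 i) => i0.
    by rewrite (cplx_split (E i)) r0 i0 cplx0 scaler0 addr0.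
  by exists (reV (E i)); split=> // h; rewrite re ?subvsP // vsvalK.
have X0 : cplx x != 0 by apply: contraNneq x0 => /(congr1 (@reV R N)); rewrite reV_cplx => ->; apply/eqP/rowP => j; rewrite !mxE.
have [i nz] : exists i, herm (cplx x) (E i) != 0.
  apply/existsP; apply: contraNT X0 => /existsPn all0; apply/eqP.
  rewrite (orthonormal_expand hl oE (cplx x)) big1 // => i _.
  by have /negPn/eqP -> := all0 i; rewrite scale0r.
exists i; apply/lfunP => h.
have := aR_herm (cplx x) (E i) (subvsP h).
rewrite br_cplx rx cplxZ eE.2 (HZl hl) (HZr hl hc) conjc_real => /(mulIf nz).
exact: complexI.
Qed.

Lemma finite_Sigma : finite_set (Sigma D).
Proof.
apply: (sub_finite_set (B := [set` map lam (enum 'I_N)])) => // a.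
by rewrite SigmaP => -[_ [i ->]] /=; rewrite map_f ?mem_enum.
Qed.

(** Multiplicities disappear when roots are replaced by indices of the basis; root sums are
    evaluated in that form. *)
Lemma sum_Sigma (Z : nmodType) (F : rdual -> Z) :
  \sum_(mu \in Sigma D) (F mu *+ mtp mu) = \sum_(i | lam i != 0) F (lam i).
Proof.
pose r := undup [seq lam i | i <- enum 'I_N & lam i != 0].
have rP a : a \in [seq lam i | i <- enum 'I_N & lam i != 0] ->
    a != 0 /\ exists i, a = lam i.
  move=> /mapP[j]; rewrite mem_filter => /andP[l0 _] ->.
  by split=> //; exists j.
have rE : Sigma D = [set` r].
  apply/seteqP; split=> a /=; rewrite SigmaP mem_undup.
    by move=> [a0 [i ai]]; rewrite ai map_f // mem_filter -ai a0 mem_enum.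
  exact: rP.
rewrite rE -(fsbig_seq _ _ (undup_uniq _)).
rewrite (eq_big_seq (fun mu => \sum_(i | lam i == mu) F (lam i))); last first.
  move=> mu; rewrite mem_undup => /mapP[j]; rewrite mem_filter => /andP[l0 _] muj.
  rewrite mtpE ?muj // -sumr_const; apply: eq_big => k //=.
  by rewrite inE => /eqP ->.
rewrite (exchange_big_dep xpredT) //= [RHS]big_mkcond; apply: eq_bigr => i _.
rewrite big_const_seq iter_addr_0 (eq_count (a2 := pred1 (lam i))); last first.
  by move=> mu; rewrite /= eq_sym.
rewrite count_uniq_mem ?undup_uniq // mem_undup.
have -> : (lam i \in [seq lam i | i <- enum 'I_N & lam i != 0]) = (lam i != 0).
  apply/mapP/idP => [[j]|li0]; first by rewrite mem_filter => /andP[lj _] ->.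
  by exists i => //; rewrite mem_filter li0 mem_enum.
by case: ifP => _; rewrite ?mulr1n ?mulr0n.
Qed.

End Basis.
End Roots.

(** The two sides differ modulo 3. Their difference is a factor of the ladder coefficient in
    [no_triple], which thus never vanishes. *)
Lemma mod3_neq (m n : nat) : (2 + 3 * m)%N != (6 * n)%N.
Proof. by lia. Qed.

(** * Combinatorics of the cubic form *)

Section CubicForm.
Variables (F : numFieldType) (W : zmodType) (n : nat) (lam : 'I_n -> W).
Variables (Sc Tc : 'I_n -> 'I_n -> 'I_n -> F) (ip : W -> W -> F).
Hypothesis Sc_swap : forall i j k, Sc i j k = Sc j i k.
Hypothesis Sc_cycle : forall i j k, Sc i j k = Sc j k i.
Hypothesis Sc_vanish : forall i j k, lam i + lam j + lam k != 0 -> Sc i j k = 0.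
Hypothesis sum_Tc : forall (c : W -> F) j k,
  \sum_i c (lam i) * Tc i j k = \sum_i c (- lam i) * Sc i j k.
Hypothesis trace_coroots : forall (c : W -> F) j,
  \sum_i c (lam i) * (\sum_k (Tc i j k - Sc i j k)) =
  \sum_i c (lam i) * ip (lam i) (lam j).
Hypothesis ip_double : forall mu, ip mu (mu *+ 2) = 2 * ip mu mu.
Hypothesis no_triple : forall i k, lam i != 0 -> lam k = - (lam i *+ 3) -> False.

(** [trace_coroots] replaces the inner product by T - S, and [sum_Tc] turns T into S at the price of
    negating the first weight. [c] is any function of the two weights, so that indicators are
    allowed. *)
Lemma pair_sum (c : W -> W -> F) :
  \sum_i \sum_j c (lam i) (lam j) * (ip (lam i) (lam j)) =
  \sum_i \sum_j \sum_k (c (- lam i) (lam j) - c (lam i) (lam j)) * Sc i j k.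
Proof.
rewrite exchange_big [RHS]exchange_big /=; apply: eq_bigr => j _.
rewrite -(trace_coroots (c^~ (lam j))).
under [LHS]eq_bigr do rewrite mulr_sumr.
rewrite exchange_big [RHS]exchange_big /=; apply: eq_bigr => k _.
under [LHS]eq_bigr do rewrite mulrBr.
under [RHS]eq_bigr do rewrite mulrBl.
by rewrite !sumrB (sum_Tc (c^~ (lam j))).
Qed.

Definition mult_sum (f1 : 'I_n -> 'I_n -> 'I_n -> F) := \sum_i \sum_j \sum_k f1 i j k.

Lemma mult_sum_swap12 f1 : mult_sum f1 = mult_sum (fun i j k => f1 j i k).
Proof. by rewrite /mult_sum exchange_big. Qed.

Lemma mult_sum_swap23 f1 : mult_sum f1 = mult_sum (fun i j k => f1 i k j).
Proof. by apply: eq_bigr => i _; rewrite exchange_big. Qed.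

Lemma mult_sum_cycle f1 : mult_sum f1 = mult_sum (fun i j k => f1 j k i).
Proof. by rewrite [RHS]mult_sum_swap12 [RHS]mult_sum_swap23. Qed.

Lemma eq_mult_sum f1 f2 : (forall i j k, f1 i j k = f2 i j k) -> mult_sum f1 = mult_sum f2.
Proof. by move=> H; do 3 (apply: eq_bigr => ? _). Qed.

Lemma mult_sumD f1 f2 : mult_sum (fun i j k => f1 i j k + f2 i j k) = mult_sum f1 + mult_sum f2.
Proof.
rewrite /mult_sum -big_split; apply: eq_bigr => i _ /=.
by rewrite -big_split; apply: eq_bigr => j _ /=; rewrite -big_split.
Qed.

Lemma mult_sumZ a f1 : mult_sum (fun i j k => a * f1 i j k) = a * mult_sum f1.
Proof.
rewrite /mult_sum mulr_sumr; apply: eq_bigr => i _.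
by rewrite mulr_sumr; apply: eq_bigr => j _; rewrite mulr_sumr.
Qed.

Lemma mult_sumN f1 : mult_sum (fun i j k => - f1 i j k) = - mult_sum f1.
Proof.
rewrite -mulN1r -mult_sumZ; apply: eq_mult_sum => i j k.
by rewrite mulN1r.
Qed.

(* The cubic form [Sc] is symmetric and supported on zero-sum triples, so an odd
   function only enters through the cyclic sum [c_i c_j + c_j c_k + c_k c_i];
   degenerate triples (one weight zero) give the [c_i ^+ 2]. *)
Lemma cubic_trace_identity (c e : W -> F) :
  (forall mu, c (- mu) = - c mu) -> (forall mu, e (- mu) = - e mu) ->
  (forall i j k, lam i != 0 -> lam j != 0 -> lam k != 0 ->
     lam i + lam j + lam k = 0 ->
     c (lam i) * c (lam j) + c (lam j) * c (lam k) + c (lam k) * c (lam i) =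
     e (lam i) * e (lam j) + e (lam j) * e (lam k) + e (lam k) * e (lam i)) ->
  \sum_i \sum_j c (lam i) * c (lam j) * (ip (lam i) (lam j)) -
  \sum_i \sum_j e (lam i) * e (lam j) * (ip (lam i) (lam j)) =
  2 * \sum_i (c (lam i) ^+ 2 - e (lam i) ^+ 2) *
    (#|[pred j | lam j == lam i]| + 2 * #|[pred j | lam j == lam i *+ 2]|)%:R *
    (ip (lam i) (lam i)).
Proof.
move=> co eo cyc.
have odd0 (f : W -> F) : (forall mu, f (- mu) = - f mu) -> f 0 = 0.
  move=> fo; have /eqP := fo 0; rewrite oppr0 -addr_eq0 -mulr2n mulrn_eq0 /=.
  by move=> /eqP.
have c0 := odd0 c co; have e0 := odd0 e eo.
pose f mu := c mu ^+ 2 - e mu ^+ 2.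
have fe mu : f (- mu) = f mu by rewrite /f co eo !sqrrN.
have f0 : f 0 = 0 by rewrite /f c0 e0 subrr.
(* On the support of [Sc], [A] collects the triples (mu, -mu, 0) and [Q] the triples (mu, mu, -2
   mu). *)
pose A := mult_sum (fun i j k => (lam k == 0)%:R * f (lam i) * Sc i j k).
pose Q := mult_sum (fun i j k => (lam j == lam i)%:R * f (lam i) * Sc i j k).
have suppS (a b : F) i j k : (lam i + lam j + lam k = 0 -> a = b) ->
    a * Sc i j k = b * Sc i j k.
  have [s0|snz] := eqVneq (lam i + lam j + lam k) 0; first by move=> ->.
  by rewrite (Sc_vanish snz) !mulr0.
have S1 i j k : Sc j i k = Sc i j k by rewrite Sc_swap.
have S2 i j k : Sc i k j = Sc i j k by rewrite Sc_cycle Sc_swap [RHS]Sc_cycle.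
have step1 : \sum_i \sum_j c (lam i) * c (lam j) * (ip (lam i) (lam j)) -
    \sum_i \sum_j e (lam i) * e (lam j) * (ip (lam i) (lam j)) = 2 * A.
  rewrite (pair_sum (fun mu nu => c mu * c nu)) (pair_sum (fun mu nu => e mu * e nu)).
  pose Q0 := mult_sum (fun i j k =>
     (c (lam i) * c (lam j) - e (lam i) * e (lam j)) * Sc i j k).
  transitivity (- 2 * Q0).
    rewrite /Q0 -mult_sumZ -[X in X - _ = _]/(mult_sum _) -[X in _ - X = _]/(mult_sum _).
    rewrite -mult_sumN -mult_sumD; apply: eq_mult_sum => i j k.
    by rewrite co eo; ring.
  (* Adding the three cyclic images of [Q0] makes the cyclic sums of [cyc] appear, equal for [c] and
     [e] on nonzero weights; a triple with a zero weight leaves -f. *)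
  suff E3 : 3 * Q0 = - (3 * A).
    have n3 : (3 : F) != 0 by rewrite pnatr_eq0.
    by apply: (mulfI n3); rewrite mulrCA E3; ring.
  have G1 : Q0 = mult_sum (fun i j k =>
     (c (lam j) * c (lam k) - e (lam j) * e (lam k)) * Sc i j k).
    by rewrite /Q0 mult_sum_cycle; apply: eq_mult_sum => i j k; rewrite -Sc_cycle.
  have G2 : Q0 = mult_sum (fun i j k =>
     (c (lam k) * c (lam i) - e (lam k) * e (lam i)) * Sc i j k).
    by rewrite G1 mult_sum_cycle; apply: eq_mult_sum => i j k; rewrite -Sc_cycle.
  have A1 : A = mult_sum (fun i j k => (lam i == 0)%:R * f (lam j) * Sc i j k).
    by rewrite /A mult_sum_cycle; apply: eq_mult_sum => i j k; rewrite -Sc_cycle.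
  have A2 : A = mult_sum (fun i j k => (lam j == 0)%:R * f (lam k) * Sc i j k).
    by rewrite A1 mult_sum_cycle; apply: eq_mult_sum => i j k; rewrite -Sc_cycle.
  have -> : 3 * Q0 = Q0 + Q0 + Q0 by ring.
  have -> : - (3 * A) = - (A + A + A) by ring.
  rewrite {2}G1 {2}G2 {2}A1 {2}A2 /Q0 /A -!mult_sumD -mult_sumN.
  apply: eq_mult_sum => i j k; rewrite -!mulrDl -[RHS]mulNr; apply: suppS => sum0.
  have [k0|knz] := eqVneq (lam k) 0.
    have ji : lam j = - lam i.
      by move/eqP: sum0; rewrite k0 addr0 addrC addr_eq0 => /eqP.
    rewrite ji k0 co eo fe f0 c0 e0 oppr_eq0.
    have [->|_] := eqVneq (lam i) 0; first by rewrite c0 e0 f0; ring.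
    by rewrite /f /= !mulr1n ?mulr0n; ring.
  have [i0|inz] := eqVneq (lam i) 0.
    have kj : lam k = - lam j.
      by move/eqP: sum0; rewrite i0 add0r addrC addr_eq0 => /eqP.
    have jnz : lam j == 0 = false.
      by apply/negbTE; move: knz; rewrite kj oppr_eq0.
    by rewrite i0 kj jnz co eo fe c0 e0 /f /= ?mulr1n ?mulr0n; ring.
  have [j0|jnz] := eqVneq (lam j) 0.
    have ki : lam k = - lam i.
      by move/eqP: sum0; rewrite j0 addr0 addrC addr_eq0 => /eqP.
    by rewrite j0 ki co eo fe c0 e0 /f /= ?mulr1n ?mulr0n; ring.
  have cy := cyc i j k inz jnz knz sum0.
  rewrite /= !mulr0n !mul0r !addr0 oppr0.
  by move/eqP: cy; rewrite -subr_eq0 => /eqP <-; ring.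
(* Indicator of nu = mu in [pair_sum]: the negated term forces the third weight to be 0 and gives
   [A], the other one is [Q]. *)
have AQ : \sum_i f (lam i) * #|[pred j | lam j == lam i]|%:R *
    (ip (lam i) (lam i)) = A - Q.
  transitivity (\sum_i \sum_j (lam j == lam i)%:R * f (lam i) *
      (ip (lam i) (lam j))).
    apply: eq_bigr => i _; rewrite -sum1_card natr_sum mulr_sumr mulr_suml big_mkcond.
    apply: eq_bigr => j _; rewrite inE; have [->|_] := eqVneq (lam j) (lam i).
      by rewrite mulr1 mul1r.
    by rewrite !mul0r.
  rewrite (pair_sum (fun mu nu => (nu == mu)%:R * f mu)).
  rewrite -mult_sumN -mult_sumD -[LHS]/(mult_sum _).
  apply: eq_mult_sum => i j k; rewrite -[RHS]mulrBl; apply: suppS => sum0.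
  rewrite fe; congr (_ %:R * _ - _).
  have -> : lam k = - (lam i + lam j).
    by apply/eqP; rewrite -addr_eq0 addrC sum0.
  by rewrite oppr_eq0 addrC addr_eq0.
(* Indicator of nu = 2 mu: the negated term selects (mu, -2 mu, mu), which is [Q] after a swap; the
   other would need the weight -3 mu. *)
have Q2 : \sum_i f (lam i) * #|[pred j | lam j == lam i *+ 2]|%:R *
    (2 * (ip (lam i) (lam i))) = Q.
  transitivity (\sum_i \sum_j (lam j == lam i *+ 2)%:R * f (lam i) *
      (ip (lam i) (lam j))).
    apply: eq_bigr => i _; rewrite -sum1_card natr_sum mulr_sumr mulr_suml big_mkcond.
    apply: eq_bigr => j _; rewrite inE; have [->|_] := eqVneq (lam j) (lam i *+ 2).
      rewrite ip_double.
      by rewrite mulr1 mul1r.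
    by rewrite !mul0r.
  rewrite (pair_sum (fun mu nu => (nu == mu *+ 2)%:R * f mu)).
  rewrite /Q mult_sum_swap23 -[LHS]/(mult_sum _).
  apply: eq_mult_sum => i j k; rewrite S2; apply: suppS => sum0.
  rewrite fe; have [->|li0] := eqVneq (lam i) 0; first by rewrite f0 !mulr0 subrr.
  have [lj|_] := eqVneq (lam j) (lam i *+ 2).
    case: (no_triple (i := i) (k := k) li0); apply/eqP.
    by rewrite -addr_eq0 mulrS -lj addrCA addrA sum0.
  rewrite mul0r subr0; congr (_ %:R * _).
  have -> : lam k = - (lam i + lam j).
    by apply/eqP; rewrite -addr_eq0 addrCA addrA sum0.
  by rewrite mulNrn mulr2n opprD -subr_eq opprK eqr_oppLR addrC.
rewrite step1; congr (2 * _).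
rewrite -[A](subrK Q) -AQ -[in LHS]Q2 -big_split; apply: eq_bigr => i _ /=.
rewrite natrD natrM /f; ring.
Qed.

End CubicForm.

(** * The trace identity for restricted weights *)

Section TraceIdentity.
Variables (R : realType) (N : nat) (G : lieGroup R N) (g : lieAlgebra G).
Variable D : cartanData g.
Local Notation C := R[i].
Local Notation VC := 'rV[C]_N.
Local Notation cplx := (@cplx R N).
Local Notation conjV := (@conjV R N).
Local Notation br := (br g).
Local Notation B := (killingC g).
Local Notation sg := (sg D).
Local Notation herm := (herm D).
Local Notation aR := (aR D).
Local Notation hC := (hC D).
Local Notation rdual := 'Hom(subvs_of aR, R^o).
Local Notation hdual := 'Hom(subvs_of hC, C^o).
Local Notation hl := (herm_lin D).
Local Notation hc := (herm_conj D).

Definition weight_vector (nu : rdual) (X : VC) : Prop :=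
  forall h : subvs_of aR, br (cplx (vsval h)) X = (nu h)%:C%C *: X.

Lemma weight_vector_br nu nu' X Y : weight_vector nu X -> weight_vector nu' Y ->
  weight_vector (nu + nu') (br X Y).
Proof.
move=> wX wY h; rewrite (br_derivation (wX h) (wY h)) -rmorphD.
by rewrite add_lfunE.
Qed.

Lemma weight_vector_sg nu X : weight_vector nu X -> weight_vector (- nu) (sg X).
Proof.
move=> wX h; have := wX h => /(congr1 sg); rewrite sg_br sg_cplx aR_theta ?subvsP //.
rewrite cplxN brNl sgZ conjc_real opp_lfunE rmorphN scaleNr => <-.
by rewrite opprK.
Qed.

Lemma weight_vector_conj nu X : weight_vector nu X -> weight_vector nu (conjV X).
Proof.
move=> wX h; have := wX h => /(congr1 conjV).
by rewrite conjV_br conjV_cplx conjVZ conjc_real.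
Qed.

Lemma weight_vector_cplx nu X : weight_vector nu X -> X != 0 ->
  exists2 x, x != 0 & weight_vector nu (cplx x).
Proof.
move=> wX X0.
have re : weight_vector nu (cplx (reV X)).
  by move=> h; rewrite br_cplx -br_reV wX reVZ /= scale0r subr0 cplxZ.
have im : weight_vector nu (cplx (imV X)).
  by move=> h; rewrite br_cplx -br_imV wX imVZ /= scale0r addr0 cplxZ.
have [r0|r0] := eqVneq (reV X) 0; last by exists (reV X).
exists (imV X) => //; apply: contraNneq X0 => i0.
by rewrite (cplx_split X) r0 i0 cplx0 scaler0 addr0.
Qed.

Lemma eigenbasis_sg E (lam : 'I_N -> rdual) : eigenbasis E lam ->
  eigenbasis (fun i => sg (E i)) (fun i => - lam i).
Proof.
move=> [oE wE]; split=> [i j|i]; last exact: weight_vector_sg (wE i).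
by rewrite herm_sg oE conjc_nat.
Qed.

Lemma eigenbasis_conj E (lam : 'I_N -> rdual) : eigenbasis E lam ->
  eigenbasis (fun i => conjV (E i)) lam.
Proof.
move=> [oE wE]; split=> [i j|i]; last exact: weight_vector_conj (wE i).
by rewrite herm_conjV oE conjc_nat.
Qed.

Section Basis.
Variables (E : 'I_N -> VC) (al : 'I_N -> hdual).
Hypothesis bE : cartan_basis E al.
Local Notation lam i := (resa (al i)).
Local Notation alv := (alv al).
Local Notation hvect := (hvect D E).
Let oE := bE.1.
Let eE : eigenbasis E (fun i => lam i) := cartan_eigenbasis bE.

Lemma weight_vector_weight nu X : weight_vector nu X -> X != 0 ->
  exists i, lam i = nu.
Proof.
move=> wX X0; have [i nz] : exists i, herm X (E i) != 0.
  apply/existsP; apply: contraNT X0 => /existsPn all0; apply/eqP.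
  rewrite (orthonormal_expand hl oE X) big1 // => i _.
  by have /negPn/eqP -> := all0 i; rewrite scale0r.
exists i; apply/lfunP => h.
have := aR_herm X (E i) (subvsP h).
rewrite wX eE.2 (HZl hl) (HZr hl hc) conjc_real => /(mulIf nz).
by move=> /complexI.
Qed.

(** The weights nu + n mu are pairwise distinct, and a nonzero vector requires a basis vector of its
    weight; there are only [N] of those. *)
Lemma weight_string_finite nu mu (v : nat -> VC) : mu != 0 ->
  (forall n, weight_vector (nu + mu *+ n) (v n)) -> exists n, v n = 0.
Proof.
move=> mu0 wv; apply: contrapT => /forallNP nz.
have /choice[f fE] : forall n, exists i, lam i = nu + mu *+ n.
  by move=> n; apply: weight_vector_weight (wv n) _; apply/eqP/nz.
have finj : injective (fun n : 'I_N.+1 => f n).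
  move=> m n fmn; apply: val_inj; have := fE m; rewrite fmn fE => /addrI /eqP.
  rewrite -(scaler_nat m) -(scaler_nat n) -subr_eq0 -scalerBl scaler_eq0 (negPf mu0) orbF subr_eq0.
  by rewrite eqr_nat => /eqP.
by have := leq_card _ finj; rewrite !card_ord ltnn.
Qed.

(** The coefficient is the sum of the eigenvalues w, w + q, ..., w + m q of [U] met on the way down.
    Leaving [q] free avoids rescaling the triple. *)
Lemma sl2_string (X Y U : VC) (v : nat -> VC) (w q : C) :
  br X Y = U -> (forall m, v m.+1 = br Y (v m)) ->
  br X (v 0%N) = 0 -> (forall m, br U (v m) = (w + q *+ m) *: v m) ->
  forall m, br X (v m.+1) = (w *+ m.+1 + q *+ 'C(m.+1, 2)) *: v m.
Proof.
move=> XY vS v0 Uv; elim=> [|m IH].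
  rewrite vS; have /eqP := br_ad g X Y (v 0%N).
  by rewrite XY v0 br0r subr0 Uv mulr0n addr0 eq_sym => /eqP ->.
have /eqP := br_ad g X Y (v m.+1).
rewrite -vS XY IH brZr -vS eq_sym subr_eq Uv -scalerDl => /eqP ->.
have E2 : 'C(m.+2, 2) = ('C(m.+1, 2) + m.+1)%N by rewrite binS bin1.
rewrite E2 (mulrnDr q 'C(m.+1, 2) m.+1) (mulrS w m.+1) addrACA.
by rewrite [q *+ m.+1 + _]addrC.
Qed.

(* The restricted root [lam i] would be a weight of value -2/3 for the sl2-triple
   of a root vector of weight [-3 lam i]. *)
Lemma no_triple i k : lam i != 0 -> lam k = - (lam i *+ 3) -> False.
Proof.
move=> li0 lk.
have k0 : lam k != 0 by rewrite lk oppr_eq0 -scaler_nat scaler_eq0 negb_or pnatr_eq0.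
(* For a real root vector, u = [x, theta x] lies in [aR], and [killu] shows that it is proportional
   to the dual vector of [mu]. *)
have [x x0 wx] := weight_vector_cplx (eE.2 k) (basis_neq0 bE k).
pose X := cplx x; pose u := lbr g x (theta D x).
have wsX := weight_vector_sg wx.
have XsX : br X (sg X) = cplx u by rewrite /X sg_cplx br_cplx.
have ua : u \in aR.
  apply: aR_mem => [|h ha].
    by rewrite theta_br thetaK lbrC0.
  have := weight_vector_br wx wsX (vsproj aR h).
  by rewrite subrr vsprojK // zero_lfunE scale0r XsX br_cplx -[0 in RHS](cplx0 R N) => /cplx_inj.
pose mu := lam k; pose un := vsproj aR u.
have un_E : vsval un = u by rewrite vsprojK.
have killu (h : subvs_of aR) : killing g (vsval h) u = mu h * killing g x (theta D x).
  apply: complexI; rewrite rmorphM /= -!killingC_cplx -br_cplx.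
  by rewrite -B_inv (wx h) BZl.
have kx : killing g x (theta D x) != 0.
  by rewrite -oppr_eq0 gt_eqF // theta_pos.
have k_lin : scalar (killing g u) := kform_linear (lbr_linearl g) (lbr_linearr g) u.
have u0 : u != 0.
  apply: contraNneq k0 => u0; apply/eqP/lfunP => h; apply: (mulIf kx).
  rewrite -killu u0 zero_lfunE mul0r.
  exact: (lin0 (V := R^o) (kform_linear (lbr_linearl g) (lbr_linearr g) (vsval h))).
have muu : mu un != 0.
  apply: contraTneq (theta_pos D u0) => mu0.
  rewrite aR_theta // (linN (V := R^o) k_lin) opprK.
  by have := killu un; rewrite un_E mu0 mul0r => ->; rewrite ltxx.
pose s := lam i un.
have mus : mu un = - (s *+ 3).
  by rewrite /mu lk opp_lfunE; congr (- _); rewrite !mulrSr !add_lfunE zero_lfunE.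
have s0 : s != 0 by apply: contraNneq muu => s0; rewrite mus s0 mul0rn oppr0.
pose vup n := iter n (br X) (E i).
have wup n : weight_vector (lam i + mu *+ n) (vup n).
  elim: n => [|n IH]; first by rewrite mulr0n addr0; exact: eE.2.
  by rewrite mulrS addrCA; apply: weight_vector_br.
have [n0 n00] := weight_string_finite k0 wup.
(* Raising [E i] by [X] stops; [vup n], the last nonzero vector, is the highest one from which
   [sg X] descends. *)
have exn : exists n, vup n == 0 by exists n0; apply/eqP.
case: (ex_minnP exn) => -[|n] vn minn; first by rewrite (negPf (basis_neq0 bE i)) in vn.
have vn0 : vup n != 0 by apply/negP => /minn; rewrite ltnn.
pose vd m := iter m (br (sg X)) (vup n).
have wd m : weight_vector (lam i + mu *+ n + (- mu) *+ m) (vd m).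
  elim: m => [|m IH]; first by rewrite mulr0n addr0; exact: wup.
  by rewrite mulrS addrCA; apply: weight_vector_br.
have Uv m : br (cplx u) (vd m) =
    ((s * (1 - 3 * n%:R))%:C%C + (3 * s)%:C%C *+ m) *: vd m.
  have := wd m un; rewrite un_E => ->; congr (_ *: _).
  have mn k' (ph : rdual) : (ph *+ k') un = ph un *+ k'.
    by elim: k' => [|k' IH]; rewrite ?mulr0n ?zero_lfunE // !mulrS add_lfunE IH.
  rewrite !add_lfunE !mn opp_lfunE mus -/s -rmorphMn -rmorphD; congr (_%:C%C).
  by ring.
have vdS m : vd m.+1 = br (sg X) (vd m) by [].
have Xv0 : br X (vd 0%N) = 0 by apply/eqP.
have str := sl2_string XsX vdS Xv0 Uv.
have vd0 m : vd m != 0.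
  elim: m => [//|m IH]; apply/eqP => vm; have := str m; rewrite vm br0r => /esym/eqP.
  rewrite scaler_eq0 (negPf IH) orbF -!rmorphMn -rmorphD -(rmorph0 (real_complex R)).
  rewrite (inj_eq (@complexI R)) => /eqP/(congr1 (fun z => z * 2)).
  have Ebin : ('C(m.+1, 2) * 2 = m.+1 * m)%N.
    by have := bin_ffact m.+1 2; rewrite ffactnS ffactn1.
  have H2 : ('C(m.+1, 2)%:R : R) * 2 = m.+1%:R * m%:R by rewrite -!natrM Ebin.
  rewrite mul0r -(mulr_natr _ m.+1) -(mulr_natr _ 'C(m.+1, 2)) mulrDl.
  rewrite -[X in _ + X]mulrA H2 => /eqP.
  (* Twice the ladder coefficient for w = s (1 - 3n) and q = 3s. It is nonzero, so the descending
     string would be infinite. *)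
  have -> : s * (1 - 3 * n%:R) * m.+1%:R * 2 + 3 * s * (m.+1%:R * m%:R) =
    s * m.+1%:R * ((2 + 3 * m)%:R - (6 * n)%:R) :> R by rewrite (natrD _ 2) (natrM _ 3) (natrM _ 6); ring.
  rewrite !mulf_eq0 (negPf s0) pnatr_eq0 /= subr_eq0 eqr_nat.
  exact/negP/mod3_neq.
have mun : - mu != 0 by rewrite oppr_eq0.
have [m vm] := weight_string_finite mun wd.
by have := vd0 m; rewrite vm eqxx.
Qed.

Variable RD : rootData D.

Definition ip (mu nu : rdual) : R := nu (vsproj aR (tvec RD mu)).

Lemma killingRC x y : killing g x y = killing g y x.
Proof. exact: kformC. Qed.

Lemma killing_linr y : scalar (killing g y).
Proof. exact: kform_linear (lbr_linearl g) (lbr_linearr g) y. Qed.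

Lemma killing_linl y : scalar ((killing g)^~ y).
Proof. by move=> a x x'; rewrite ![killing g _ y]killingRC killing_linr. Qed.

Lemma killing_aR_nondegenerate y : y \in aR ->
  (forall h : subvs_of aR, killing g y (vsval h) = 0) -> y = 0.
Proof.
move=> ya yh; apply/eqP; apply: contraT => /(theta_pos D).
rewrite aR_theta // (linN (V := R^o) (killing_linr y)) opprK.
by have := yh (vsproj aR y); rewrite vsprojK // => ->; rewrite ltxx.
Qed.

Lemma tvec_unique y (nu : rdual) : y \in aR ->
  (forall h : subvs_of aR, killing g y (vsval h) = nu h) -> y = tvec RD nu.
Proof.
move=> ya yh; apply/eqP; rewrite -subr_eq0; apply/eqP.
apply: killing_aR_nondegenerate => [|h]; first by rewrite memvB ?tvec_in.
by rewrite (linB (V := R^o) (killing_linl _)) yh tvecP subrr.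
Qed.

Lemma tvec_linear : linear (tvec RD).
Proof.
move=> c mu nu; apply/esym/tvec_unique => [|h].
  by rewrite memvD ?memvZ ?tvec_in.
rewrite (linD (V := R^o) (killing_linl _)) (linZ (V := R^o) (killing_linl _)).
by rewrite !tvecP add_lfunE scale_lfunE.
Qed.

Lemma ip_linear mu : scalar (ip mu).
Proof. by move=> c x y; rewrite /ip add_lfunE scale_lfunE. Qed.

(** Each [hvect i] has a component along t besides [tvec RD (lam i)]. In the weighted sum these
    components cancel: the conjugate of [E i] has the same restricted weight and the opposite
    eigenvalue under t. *)
Lemma trace_coroots (c : rdual -> C) j :
  \sum_i c (lam i) * alv j (hvect i) = \sum_i c (lam i) * (ip (lam i) (lam j))%:C%C.
Proof.
pose Z := \sum_i c (lam i) *: (hvect i - cplx (tvec RD (lam i))).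
have tC i : cplx (tvec RD (lam i)) \in hC by apply/aR_hC/tvec_in.
have Zh : Z \in hC.
  by apply: memv_suml => i _; rewrite memvZ // memvB // (hvect_hC bE).
have BZ X : B X Z = \sum_i c (lam i) * (B X (hvect i) - B X (cplx (tvec RD (lam i)))).
  rewrite /Z (lin_sum (V := C^o) (@killingC_lin _ _ _ g X)).
  by apply: eq_bigr => i _; rewrite BZr BDr BNr.
have Z0 : Z = 0.
  apply: (hC_nondegenerate (D := D)) => // H; move: H.
  apply: (hC_ind (P := fun H => B H Z = 0)) => [X Y|a X|h ha|t tt].
  - by rewrite BDl => -> ->; rewrite addr0.
  - by rewrite BZl => ->; rewrite mulr0.
  - rewrite BZ big1 // => i _; rewrite (B_hvect bE) ?aR_hC // (alv_aR bE) //.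
    rewrite killingC_cplx; have := tvecP RD (lam i) (vsproj aR h).
    rewrite vsprojK // killingRC => ->.
    by rewrite subrr mulr0.
  have th := tR_hC tt.
  rewrite BZ; under eq_bigr do rewrite (B_hvect bE) // mulrBr.
  rewrite sumrB [X in _ - X]big1 ?subr0 => [|i _]; last first.
    have : B (cplx t) (cplx (tvec RD (lam i))) = - B (cplx t) (cplx (tvec RD (lam i))).
      rewrite -{1}(thC_B D) !thC_cplx tR_theta // aR_theta ?tvec_in //.
      by rewrite cplxN BNr.
    move=> /eqP; rewrite -addr_eq0 -mulr2n mulrn_eq0 /= => /eqP ->.
    by rewrite mulr0.
  pose s (X Y : VC) : C := herm (br (cplx t) Y) X.
  have H : \sum_i c (lam i) * s (E i) (E i) =
      \sum_i c (lam i) * s (conjV (E i)) (conjV (E i)).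
    apply: (change_eigenbasis_scalar c _ _ _ eE (eigenbasis_conj eE)).
    - by move=> X X' Y; rewrite /s (HDr hl hc).
    - by move=> a X Y; rewrite /s (HZr hl hc).
    - by move=> X a Y Y'; rewrite /s brDr brZr (HDl hl) (HZl hl).
  have E1 : \sum_i c (lam i) * alv i (cplx t) = \sum_i c (lam i) * s (E i) (E i).
    by apply: eq_bigr => i _; rewrite (alvE bE).
  have E2 : \sum_i c (lam i) * s (conjV (E i)) (conjV (E i)) =
      - \sum_i c (lam i) * alv i (cplx t).
    rewrite -sumrN; apply: eq_bigr => i _.
    rewrite /s -[cplx t](conjV_cplx t) -conjV_br herm_conjV -(alvE bE) //.
    by rewrite conjV_cplx -[in RHS](tR_theta tt) -sg_cplx (alv_sg bE) // mulrN opprK.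
  move: E1; rewrite H E2 => /eqP.
  by rewrite -addr_eq0 -mulr2n mulrn_eq0 /= => /eqP.
have alvsum I (r : seq I) (F : I -> VC) : alv j (\sum_(i <- r) F i) = \sum_(i <- r) alv j (F i).
  have alv0 : alv j 0 = 0 by rewrite -[0](scale0r 0) alvZ mul0r.
  by rewrite (big_morph (alv j) (fun X Y => alvD al X Y j) alv0).
have : alv j Z = 0 by rewrite Z0 -[0](scale0r 0) alvZ mul0r.
rewrite /Z alvsum => H; apply/eqP; rewrite -subr_eq0 -sumrB -[X in _ == X]H.
have alvN X : alv j (- X) = - alv j X by rewrite -scaleN1r alvZ mulN1r.
apply/eqP/eq_bigr => i _; rewrite alvZ alvD alvN (alv_aR bE) ?tvec_in //.
by rewrite mulrBr.
Qed.

(** A squared modulus, written as a product with the conjugate: it is then sesquilinear in each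
    basis vector, as [change_eigenbasis_scalar] requires. *)
Definition Sc i j k : C :=
  locked (B (br (E i) (E j)) (E k) * conjc (B (br (E i) (E j)) (E k))).
Definition Tc i j k : C :=
  locked (B (br (sg (E i)) (E j)) (E k) * conjc (B (br (sg (E i)) (E j)) (E k))).

Lemma ScE i j k :
  Sc i j k = B (br (E i) (E j)) (E k) * conjc (B (br (E i) (E j)) (E k)).
Proof. by rewrite /Sc -lock. Qed.

Lemma TcE i j k :
  Tc i j k = B (br (sg (E i)) (E j)) (E k) * conjc (B (br (sg (E i)) (E j)) (E k)).
Proof. by rewrite /Tc -lock. Qed.

(** Parseval in the basis [sg (E k)], against which [herm] is -B with [E k]. *)
Lemma herm_norm_B X : herm X X = \sum_k B X (E k) * conjc (B X (E k)).
Proof.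
rewrite {1}(parseval hl hc (eigenbasis_sg eE).1).
by apply: eq_bigr => k _; rewrite !hermE sgK rmorphN mulrNN.
Qed.

Lemma alv_hvectE i j : alv j (hvect i) = \sum_k (Tc i j k - Sc i j k).
Proof. rewrite (alv_hvect bE) !herm_norm_B -sumrB.
by apply: eq_bigr => k _; rewrite TcE ScE. Qed.

Lemma Sc_swap i j k : Sc i j k = Sc j i k.
Proof. by rewrite !ScE (br_anti g (E i)) BNl rmorphN mulrNN. Qed.

Lemma Sc_cycle i j k : Sc i j k = Sc j k i.
Proof. by rewrite !ScE B_inv killingCC. Qed.

(** Moving ad h across the invariant form, for h in [aR], shows that the sum of the three weights
    annihilates B([E_i, E_j], E_k). *)
Lemma Sc_vanish i j k : lam i + lam j + lam k != 0 -> Sc i j k = 0.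
Proof.
move=> nz; rewrite ScE; suff -> : B (br (E i) (E j)) (E k) = 0 by rewrite mul0r.
apply/eqP; apply: contraNT nz => Bnz; apply/eqP/lfunP => h; apply: complexI.
have := B_inv g (br (E i) (E j)) (cplx (vsval h)) (E k).
rewrite br_anti (weight_vector_br (eE.2 i) (eE.2 j) h) eE.2 BNl BZl BZr => /eqP.
rewrite -subr_eq0 -mulNr -mulrBl mulf_eq0 (negPf Bnz) orbF -opprD oppr_eq0 => /eqP.
rewrite -rmorphD -add_lfunE => ->.
by rewrite zero_lfunE.
Qed.

(** For fixed [j] and [k] both sides are the same trace over the first slot, taken in the eigenbasis
    [E] and in [sg E], where weights are negated. *)
Lemma sum_Tc (c : rdual -> C) j k :
  \sum_i c (lam i) * Tc i j k = \sum_i c (- lam i) * Sc i j k.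
Proof.
pose s (X Y : VC) : C := B (br Y (E j)) (E k) * conjc (B (br X (E j)) (E k)).
have H : \sum_i c (- lam i) * s (E i) (E i) =
    \sum_i c (- - lam i) * s (sg (E i)) (sg (E i)).
  apply: (change_eigenbasis_scalar (fun mu => c (- mu)) _ _ _ eE (eigenbasis_sg eE)).
  - by move=> X X' Y; rewrite /s brDl BDl rmorphD mulrDr.
  - by move=> a X Y; rewrite /s brZl BZl rmorphM mulrCA.
  - by move=> X a Y Y'; rewrite /s brDl brZl BDl BZl mulrDl -mulrA.
transitivity (\sum_i c (- - lam i) * s (sg (E i)) (sg (E i))); last first.
  by rewrite -H; apply: eq_bigr => i _; rewrite ScE.
by apply: eq_bigr => i _; rewrite (opprK (lam i)) TcE.
Qed.

Lemma trace_identity (c e : rdual -> C) :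
  (forall mu, c (- mu) = - c mu) -> (forall mu, e (- mu) = - e mu) ->
  (forall i j k, lam i != 0 -> lam j != 0 -> lam k != 0 ->
     lam i + lam j + lam k = 0 ->
     c (lam i) * c (lam j) + c (lam j) * c (lam k) + c (lam k) * c (lam i) =
     e (lam i) * e (lam j) + e (lam j) * e (lam k) + e (lam k) * e (lam i)) ->
  \sum_i \sum_j c (lam i) * c (lam j) * (ip (lam i) (lam j))%:C%C -
  \sum_i \sum_j e (lam i) * e (lam j) * (ip (lam i) (lam j))%:C%C =
  2 * \sum_i (c (lam i) ^+ 2 - e (lam i) ^+ 2) *
    (#|[pred j | lam j == lam i]| + 2 * #|[pred j | lam j == lam i *+ 2]|)%:R *
    (ip (lam i) (lam i))%:C%C.
Proof.
apply: (cubic_trace_identity (ip := fun mu nu => (ip mu nu)%:C%C) Sc_swap Sc_cycle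
  Sc_vanish sum_Tc).
- move=> f j; rewrite -trace_coroots; apply: eq_bigr => i _.
  by rewrite -alv_hvectE.
- by move=> mu; rewrite mulr2n (linD (V := R^o) (ip_linear _)) rmorphD mulr_natl mulr2n.
- exact: no_triple.
Qed.

End Basis.
End TraceIdentity.

(** * Action of K and of the normalizer of A *)

Definition AdC (R : realType) (N : nat) (G : lieGroup R N) (g : lieAlgebra G)
    (k : G) : 'rV[R[i]]_N -> 'rV[R[i]]_N :=
  locked (linC (linfun (Ad g k))).

Section WeylAction.
Variables (R : realType) (N : nat) (G : lieGroup R N) (g : lieAlgebra G).
Variable D : cartanData g.
Local Notation C := R[i].
Local Notation VC := 'rV[C]_N.
Local Notation cplx := (@cplx R N).
Local Notation conjV := (@conjV R N).
Local Notation br := (br g).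
Local Notation B := (killingC g).
Local Notation th := (theta D).
Local Notation sg := (sg D).
Local Notation herm := (herm D).
Local Notation aR := (aR D).
Local Notation rdual := 'Hom(subvs_of aR, R^o).
Local Notation e := (expg g).

Lemma K1 : K D 1%g.
Proof. by move=> H H1 _ _ _. Qed.

Lemma K_mul a b : K D a -> K D b -> K D (a * b)%g.
Proof. by move=> Ka Kb H H1 HM HV He; apply: (HM) => //; [exact: Ka|exact: Kb]. Qed.

Lemma K_inv a : K D a -> K D a^-1%g.
Proof. by move=> Ka H H1 HM HV He; apply: (HV); exact: Ka. Qed.

Lemma K_exp x : x \in kR D -> K D (e x).
Proof. by move=> xk H H1 HM HV He; exact: He. Qed.

(** K is generated by the exponentials of [kR], and for x fixed by theta the operator ad x commutes
    with theta. *)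
Lemma Ad_theta k : K D k -> forall Y, th (Ad g k Y) = Ad g k (th Y).
Proof.
move=> Kk; apply: (Kk [set a | forall Y, th (Ad g a Y) = Ad g a (th Y)]) => /=.
- by move=> Y; rewrite !Ad1.
- by move=> a b Ha Hb Y; rewrite !Ad_mul Ha Hb.
- by move=> a Ha Y; apply: (can_inj (AdK g a)); rewrite -Ha !AdVK.
- move=> x /kRP tx; apply: Ad_exp_comm => Y.
  by rewrite /= theta_br tx.
Qed.

Lemma logA_e x : x \in aR -> logA D (e x) = x.
Proof. exact: logA_exp. Qed.

Lemma A_exp x : x \in aR -> A D (e x).
Proof. by move=> xa; exists x. Qed.

(** The curve exp(t Ad_k h) stays in A, hence fixes every h' in [aR]. Differentiating at 0 gives
    [Ad_k h, h'] = 0, and maximality of [aR] applies. *)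
Lemma NKA_aR k h : NKA D k -> h \in aR -> Ad g k h \in aR.
Proof.
move=> [Kk NA] ha; apply: aR_mem => [|h' ha'].
  by rewrite Ad_theta // aR_theta // linearN.
rewrite lbrC0 -[RHS]oppr0; congr (- _).
have fix_h (t : R) : Ad g (e (t *: Ad g k h)) h' = h'.
  have [y ya Ey] : A D (e (t *: Ad g k h)).
    by rewrite -conj_exp; have [H _] := NA (e (t *: h)); apply: H; exact/A_exp/memvZ.
  by rewrite -Ey; apply: Ad_exp_fix; exact: aR_abelian ya ha'.
have := Ad_exp_derive0 g (Ad g k h) h'.
have -> : (fun t : R => Ad g (e (t *: Ad g k h)) h') = cst h'.
  by apply/funext.
by move/is_derive_unique; apply; exact: is_derive_cst.
Qed.

Lemma NKA_inv k : NKA D k -> NKA D k^-1%g.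
Proof.
move=> [Kk NA]; split=> [|a]; first exact: K_inv.
by rewrite invgK (NA (k^-1 * a * k)%g) !mulgA mulgV mul1g mulgK.
Qed.

Lemma M_NKA k : M D k -> NKA D k.
Proof.
move=> [Kk kA]; split=> // a; split=> [Aa|].
  by rewrite kA // mulgK.
move=> Aa; have := kA _ Aa; rewrite mulgVK => E.
by rewrite -(mulKg k a) -[(k * a)%g in X in A D X]/(k * a)%g -E mulgA mulVg mul1g.
Qed.

Lemma M_Ad k h : M D k -> h \in aR -> Ad g k h = h.
Proof.
move=> [_ kA] ha; apply: (@exp_line_inj _ _ _ g) => t.
by rewrite -conj_exp kA ?mulgK //; apply/A_exp/memvZ.
Qed.

Lemma M_inv k : M D k -> M D k^-1%g.
Proof.
move=> [Kk kA]; split=> [|a Aa]; first exact: K_inv.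
by apply: (@mulgI _ k); rewrite mulgA mulgV mul1g mulgA kA // mulgK.
Qed.

Lemma M_exp x : x \in mR D -> M D (e x).
Proof.
move=> xm; split; first by apply: K_exp; apply/kRP; exact: mR_theta xm.
by move=> _ [y ya <-]; apply: exp_comm; rewrite lbrC0 (mR_comm xm ya) oppr0.
Qed.

Lemma Ad_mR k x : NKA D k -> x \in mR D -> Ad g k x \in mR D.
Proof.
move=> Nk xm; apply/centralizer_inP; split.
  by apply/kRP; rewrite Ad_theta ?mR_theta //; case: Nk.
move=> h ha; rewrite -[h](AdVK g k) -Ad_lbr (mR_comm xm) ?linear0 //.
by apply: NKA_aR => //; exact: NKA_inv.
Qed.

Lemma AdCE k : linC (linfun (Ad g k)) = AdC g k. Proof. by rewrite /AdC -lock. Qed.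
Lemma AdC_linear k : linear (AdC g k).
Proof. by rewrite -AdCE; exact: linC_linear. Qed.
Lemma AdCD k X Y : AdC g k (X + Y) = AdC g k X + AdC g k Y.
Proof. exact: (linD (AdC_linear k)). Qed.
Lemma AdCZ k a X : AdC g k (a *: X) = a *: AdC g k X.
Proof. exact: (linZ (AdC_linear k)). Qed.
Lemma AdC_cplx k x : AdC g k (cplx x) = cplx (Ad g k x).
Proof. by rewrite -AdCE linC_cplx lfunE. Qed.
Lemma AdC_split k X : AdC g k X = cplx (Ad g k (reV X)) + 'i%C *: cplx (Ad g k (imV X)).
Proof. by rewrite {1}(cplx_split X) AdCD AdCZ !AdC_cplx. Qed.
Lemma reV_split x y : reV (cplx x + 'i%C *: cplx y) = x.
Proof. by apply/rowP => j; rewrite !mxE /= !mul0r mul1r subr0 addr0. Qed.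
Lemma imV_split x y : imV (cplx x + 'i%C *: cplx y) = y.
Proof. by apply/rowP => j; rewrite !mxE /= !mul0r mul1r !add0r. Qed.
Lemma reV_AdC k X : reV (AdC g k X) = Ad g k (reV X).
Proof. by rewrite AdC_split; exact: reV_split. Qed.
Lemma imV_AdC k X : imV (AdC g k X) = Ad g k (imV X).
Proof. by rewrite AdC_split; exact: imV_split. Qed.

Lemma AdCK k X : AdC g k^-1%g (AdC g k X) = X.
Proof. by rewrite (AdC_split k^-1%g) reV_AdC imV_AdC !AdK -cplx_split. Qed.
Lemma AdCVK k X : AdC g k (AdC g k^-1%g X) = X.
Proof. by rewrite (AdC_split k) reV_AdC imV_AdC !AdVK -cplx_split. Qed.

Lemma AdC_br k X Y : AdC g k (br X Y) = br (AdC g k X) (AdC g k Y).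
Proof.
move: X; apply: (clin_ext (f := fun X => AdC g k (br X Y))
    (h := fun X => br (AdC g k X) (AdC g k Y))) => [a x y|a x y|x] /=.
- by rewrite brDl brZl AdCD AdCZ.
- by rewrite AdCD AdCZ brDl brZl.
move: Y; apply: (clin_ext (f := fun Y => AdC g k (br (cplx x) Y))
    (h := fun Y => br (AdC g k (cplx x)) (AdC g k Y))) => [a y z|a y z|y] /=.
- by rewrite brDr brZr AdCD AdCZ.
- by rewrite AdCD AdCZ brDr brZr.
by rewrite br_cplx (AdC_cplx k (lbr g x y)) (AdC_cplx k x) (AdC_cplx k y) br_cplx Ad_lbr.
Qed.

Lemma AdC_B k X Y : B (AdC g k X) (AdC g k Y) = B X Y.
Proof.
have := AdC_br k; rewrite -(brE g) => Adbr.
exact: (kform_aut (lbrC_linr g) (AdC_linear k) (AdC_linear k^-1%g) (AdCK k) (AdCVK k) Adbr).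
Qed.

Lemma AdC_conj k X : conjV (AdC g k X) = AdC g k (conjV X).
Proof.
rewrite (AdC_split k (conjV X)) (reV_conj X) (imV_conj X) (AdC_split k X) conjVD conjVZ !conjV_cplx.
rewrite linearN cplxN scalerN -scaleNr; congr (_ + _ *: _).
by apply/eqP; rewrite eq_complex /= !eqxx oppr0 eqxx.
Qed.

Lemma AdC_thC k X : K D k -> thC D (AdC g k X) = AdC g k (thC D X).
Proof.
move=> Kk; rewrite [in RHS](cplx_split X) (AdC_split k X) !thCD !thCZ AdCD AdCZ.
by rewrite !thC_cplx !(Ad_theta Kk) !AdC_cplx.
Qed.

Lemma AdC_sg k X : K D k -> sg (AdC g k X) = AdC g k (sg X).
Proof. by move=> Kk; rewrite !sgE AdC_conj AdC_thC. Qed.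

Lemma AdC_herm k X Y : K D k -> herm (AdC g k X) (AdC g k Y) = herm X Y.
Proof. by move=> Kk; rewrite !hermE (AdC_sg _ Kk) AdC_B. Qed.

Definition wact (k : G) (mu : rdual) : rdual :=
  linfun (fun h : subvs_of aR => mu (vsproj aR (Ad g k^-1%g (vsval h)))).

Lemma wactE k mu h : wact k mu h = mu (vsproj aR (Ad g k^-1%g (vsval h))).
Proof.
pose f (h : subvs_of aR) : R^o := mu (vsproj aR (Ad g k^-1%g (vsval h))).
have lf : linear f by move=> a x y; rewrite /f !linearP.
pose L : {linear subvs_of aR -> R^o} := HB.pack f (GRing.isLinear.Build _ _ _ _ _ lf).
by rewrite -[LHS]/((linfun L) h) lfunE.
Qed.

Lemma wactK k mu : NKA D k -> wact k^-1%g (wact k mu) = mu.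
Proof.
move=> Nk; apply/lfunP => h; rewrite !wactE invgK vsprojK.
  by rewrite AdK vsvalK.
by apply: NKA_aR => //; exact: subvsP.
Qed.

Lemma wactVK k mu : NKA D k -> wact k (wact k^-1%g mu) = mu.
Proof. by move=> /NKA_inv/(wactK mu); rewrite invgK. Qed.

Lemma wact_M k mu : M D k -> wact k mu = mu.
Proof.
move=> Mk; apply/lfunP => h; rewrite wactE M_Ad ?subvsP ?vsvalK //.
exact: M_inv.
Qed.

Lemma wact_eq0 k mu : NKA D k -> (wact k mu == 0) = (mu == 0).
Proof.
have w0 j : wact j 0 = 0 by apply/lfunP => h; rewrite wactE !zero_lfunE.
move=> Nk; apply/eqP/eqP => [E|->]; last exact: w0.
by rewrite -(wactK mu Nk) E w0.
Qed.

Lemma eigenbasis_Ad k E (lam : 'I_N -> rdual) : NKA D k -> eigenbasis E lam ->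
  eigenbasis (fun i => AdC g k (E i)) (fun i => wact k (lam i)).
Proof.
move=> Nk [oE wE]; have [Kk _] := Nk; split=> [i j|i h].
  by rewrite (AdC_herm _ _ Kk) oE.
have ha : Ad g k^-1%g (vsval h) \in aR by apply: NKA_aR (NKA_inv Nk) (subvsP h).
rewrite wactE -[vsval h in LHS](AdVK g k) -AdC_cplx -AdC_br.
by rewrite -[Ad g k^-1%g (vsval h) in LHS](vsprojK ha) wE AdCZ.
Qed.

Lemma wact_Sigma k mu : NKA D k -> Sigma D mu -> Sigma D (wact k mu).
Proof.
move=> Nk [mu0 [x [x0 xE]]]; split; first by rewrite wact_eq0.
exists (Ad g k x); split=> [|h].
  by apply: contraNneq x0 => /(congr1 (Ad g k^-1%g)); rewrite AdK linear0 => ->.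
have ha : Ad g k^-1%g (vsval h) \in aR by apply: NKA_aR (NKA_inv Nk) (subvsP h).
rewrite wactE -[vsval h in LHS](AdVK g k) -Ad_lbr.
by rewrite -[Ad g k^-1%g (vsval h) in LHS](vsprojK ha) xE linearZ.
Qed.

(** Ad k carries an eigenbasis to one with weights [wact k], and how often a weight occurs does not
    depend on the eigenbasis. *)
Lemma mtp_wact k mu : NKA D k -> mu != 0 -> mtp (wact k mu) = mtp mu.
Proof.
move=> Nk mu0; have [E [al bE]] := cartan_basis_ex D.
have eE := cartan_eigenbasis bE; have eE' := eigenbasis_Ad Nk eE.
rewrite !(mtpE bE) ?wact_eq0 //.
have := change_eigenbasis_scalar (fun nu => (nu == wact k mu)%:R)
  (s := fun X Y => herm Y X) _ _ _ eE eE'.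
have cnt (F : 'I_N -> VC) (nu : 'I_N -> rdual) : eigenbasis F nu ->
    \sum_i (nu i == wact k mu)%:R * herm (F i) (F i) =
    (#|[pred i | nu i == wact k mu]|)%:R.
  move=> [oF _]; rewrite -sum1_card natr_sum [RHS]big_mkcond.
  apply: eq_bigr => i _; rewrite oF eqxx mulr1 inE.
  by case: (_ == _).
rewrite (cnt _ _ eE) (cnt _ _ eE') => H.
have {}H : (#|[pred i | resa (al i) == wact k mu]|)%:R =
  (#|[pred i | (wact k \o (fun i => resa (al i))) i == wact k mu]|)%:R :> C.
  apply: H => [X X' Y|a X Y|X a Y Y'].
  - by rewrite (HDr (herm_lin D) (herm_conj D)).
  - by rewrite (HZr (herm_lin D) (herm_conj D)).
  - by rewrite (HDl (herm_lin D)) (HZl (herm_lin D)).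
move/eqP: H; rewrite eqr_nat => /eqP ->.
apply: eq_card => i; rewrite !inE /=.
apply/eqP/eqP => [/(congr1 (wact k^-1%g))|-> //].
by rewrite !wactK.
Qed.

Lemma tvec_wact (RD : rootData D) k mu : NKA D k ->
  tvec RD (wact k mu) = Ad g k (tvec RD mu).
Proof.
move=> Nk; apply/esym/tvec_unique => [|h].
  exact: NKA_aR Nk (tvec_in RD mu).
have ha : Ad g k^-1%g (vsval h) \in aR by apply: NKA_aR (NKA_inv Nk) (subvsP h).
rewrite wactE -(tvecP RD) vsprojK //; apply: complexI.
rewrite -!killingC_cplx -(AdC_B k (cplx (tvec RD mu))) !AdC_cplx AdVK.
by [].
Qed.

Lemma xi_exp mu x : x \in aR -> xi (D := D) mu (e x) = expR (mu (vsproj aR x)).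
Proof. by move=> xa; rewrite /xi logA_e. Qed.

Lemma xi_wact k mu a : NKA D k -> A D a ->
  xi mu (k^-1 * a * k)%g = xi (wact k mu) a.
Proof.
move=> Nk [x xa <-]; have := conj_exp1 g k^-1%g x; rewrite invgK => ->.
rewrite !xi_exp //; last exact: NKA_aR (NKA_inv Nk) xa.
by rewrite wactE vsprojK.
Qed.

End WeylAction.

(** * Distributivity over dependent families *)

Section TensorProduct.
Variable F : comNzRingType.

Lemma sum_dffun_prod (I : finType) (T_ : I -> finType) (P : forall i, T_ i -> F) :
  \sum_(t : {dffun forall i, T_ i}) \prod_i P i (t i) =
  \prod_i \sum_(j : T_ i) P i j.
Proof.
under [RHS]eq_bigr do rewrite (big_tag (fun i j => P i j)).
rewrite bigA_distr_big_dep /=.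
rewrite (reindex (@dffun_of_fprod _ T_)); last exact/onW_bij/dffun_of_fprod_bij.
pose Q i : {ffun T_ i -> F} := [ffun j => P i j].
transitivity (\sum_(t : fprod T_) \prod_(i in I) Q i (t i)).
  by apply: eq_bigr => t _; apply: eq_bigr => i _; rewrite !ffunE.
rewrite big_fprod; apply: eq_bigr => f _; apply: eq_bigr => i _.
by rewrite /untag; case: eqP => // p; rewrite ffunE.
Qed.

End TensorProduct.

(** * Differentiation of complex and matrix valued functions *)

Section ComplexDerivative.
Variable R : realType.
Local Notation C := R[i].

Definition cdiff (V : normedModType R) (f : V -> C) (x : V) : Prop :=
  differentiable (fun y => complex.Re (f y) : R^o) x /\
  differentiable (fun y => complex.Im (f y) : R^o) x.

Lemma cdiff_cst (V : normedModType R) c (x : V) : cdiff (fun=> c) x.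
Proof. by split; exact: differentiable_cst. Qed.

Lemma cdiff_ext (V : normedModType R) (f h : V -> C) (x : V) :
  (\forall y \near x, f y = h y) -> cdiff f x -> cdiff h x.
Proof.
move=> fh [re im]; split.
  by apply: near_eq_differentiable re; apply: filterS fh => y ->.
by apply: near_eq_differentiable im; apply: filterS fh => y ->.
Qed.

Lemma cdiffD (V : normedModType R) (f h : V -> C) (x : V) :
  cdiff f x -> cdiff h x -> cdiff (fun y => f y + h y) x.
Proof.
move=> [fr fi] [hr hi]; split.
  have -> : (fun y => complex.Re (f y + h y) : R^o) =
      (fun y => complex.Re (f y) : R^o) + (fun y => complex.Re (h y) : R^o).
    by apply/funext => y /=; rewrite -[RHS]/(_ + _); case: (f y) (h y) => ? ? [].
  exact: differentiableD.
have -> : (fun y => complex.Im (f y + h y) : R^o) =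
    (fun y => complex.Im (f y) : R^o) + (fun y => complex.Im (h y) : R^o).
  by apply/funext => y /=; rewrite -[RHS]/(_ + _); case: (f y) (h y) => ? ? [].
exact: differentiableD.
Qed.

Lemma cdiffM (V : normedModType R) (f h : V -> C) (x : V) :
  cdiff f x -> cdiff h x -> cdiff (fun y => f y * h y) x.
Proof.
move=> [fr fi] [hr hi].
pose fR y : R := complex.Re (f y); pose fI y : R := complex.Im (f y).
pose hR y : R := complex.Re (h y); pose hI y : R := complex.Im (h y).
split.
  have -> : (fun y => complex.Re (f y * h y) : R^o) = fR * hR - fI * hI.
    by apply/funext => y /=; rewrite -[RHS]/(fR y * hR y - fI y * hI y) /fR /hR /fI /hI; case: (f y) (h y) => ? ? [].
  by apply: differentiableB; exact: differentiableM.
have -> : (fun y => complex.Im (f y * h y) : R^o) = fR * hI + fI * hR.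
  by apply/funext => y /=; rewrite -[RHS]/(fR y * hI y + fI y * hR y) /fR /hR /fI /hI; case: (f y) (h y) => ? ? [].
by apply: differentiableD; exact: differentiableM.
Qed.

Lemma cdiff_sum (V : normedModType R) I (r : seq I) (P : pred I) (f : I -> V -> C) x :
  (forall i, cdiff (f i) x) -> cdiff (fun y => \sum_(i <- r | P i) f i y) x.
Proof.
move=> df; elim: r => [|i r IH].
  by under [X in cdiff X]funext do rewrite big_nil; exact: cdiff_cst.
under [X in cdiff X]funext do rewrite big_cons.
by case: (P i) => //; apply: cdiffD.
Qed.

Lemma cdiff_prod (V : normedModType R) I (r : seq I) (P : pred I) (f : I -> V -> C) x :
  (forall i, cdiff (f i) x) -> cdiff (fun y => \prod_(i <- r | P i) f i y) x.
Proof.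
move=> df; elim: r => [|i r IH].
  by under [X in cdiff X]funext do rewrite big_nil; exact: cdiff_cst.
under [X in cdiff X]funext do rewrite big_cons.
by case: (P i) => //; apply: cdiffM.
Qed.

Lemma cdiff_comp (V W : normedModType R) (f : W -> C) (h : V -> W) x :
  differentiable h x -> cdiff f (h x) -> cdiff (f \o h) x.
Proof.
move=> dh [fr fi]; split.
  exact: (@differentiable_comp _ _ _ _ h (fun y => complex.Re (f y) : R^o)).
exact: (@differentiable_comp _ _ _ _ h (fun y => complex.Im (f y) : R^o)).
Qed.

Definition cd (V : normedModType R) (f : V -> C) (x X : V) : C :=
  Complex ('d (fun y => complex.Re (f y) : R^o) x X)
    ('d (fun y => complex.Im (f y) : R^o) x X).

Lemma cdD (V : normedModType R) (f : V -> C) (x X Y : V) :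
  cd f x (X + Y) = cd f x X + cd f x Y.
Proof. by rewrite /cd !linearD. Qed.

Lemma cdZ (V : normedModType R) (f : V -> C) (x X : V) (a : R) :
  cd f x (a *: X) = a%:C%C * cd f x X.
Proof.
rewrite /cd !linearZ; move: ('d _ x X) ('d _ x X) => u v.
by apply/eqP; rewrite eq_complex /= !mul0r subr0 addr0 !eqxx.
Qed.

Lemma cderive_line (V : normedModType R) (f : V -> C) (h : R -> V) X :
  is_derive (0 : R) (1 : R) h X -> cdiff f (h 0) ->
  cderive (f \o h) = cd f (h 0) X.
Proof.
move=> dh [fr fi]; rewrite /cderive !derive1E; congr Complex.
  by have [_] := is_derive_comp dh fr.
by have [_] := is_derive_comp dh fi.
Qed.

Lemma is_derive_scalel (V : normedModType R) (X : V) (t : R) :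
  is_derive t (1 : R) (fun t : R => t *: X) X.
Proof.
pose f (t : R^o) : V := t *: X.
have lf : linear f by move=> a u v; rewrite /f scalerDl scalerA.
pose L : {linear R^o -> V} := HB.pack f (GRing.isLinear.Build _ _ _ _ _ lf).
have := is_derive_linear L (findimR R) (is_derive_id t (1 : R)).
by rewrite /= /f scale1r.
Qed.

Lemma cderiveD (f h : R -> C) : cdiff f (0 : R) -> cdiff h (0 : R) ->
  cderive (fun t => f t + h t) = cderive f + cderive h.
Proof.
move=> [fr fi] [hr hi]; rewrite /cderive !derive1E.
have -> : (fun t => complex.Re (f t + h t) : R^o) =
    (fun t => complex.Re (f t) : R^o) + (fun t => complex.Re (h t) : R^o).
  by apply/funext => y /=; rewrite -[RHS]/(_ + _); case: (f y) (h y) => ? ? [].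
have -> : (fun t => complex.Im (f t + h t) : R^o) =
    (fun t => complex.Im (f t) : R^o) + (fun t => complex.Im (h t) : R^o).
  by apply/funext => y /=; rewrite -[RHS]/(_ + _); case: (f y) (h y) => ? ? [].
rewrite !deriveD //; exact: diff_derivable.
Qed.

(** Real and imaginary part of a product have the same shape up to a sign; [s] selects it. *)
Lemma derive_mul_sum (s : bool) (a b c d : R -> R) (da db dc dd : R) :
  is_derive (0 : R) (1 : R) a da -> is_derive (0 : R) (1 : R) b db ->
  is_derive (0 : R) (1 : R) c dc -> is_derive (0 : R) (1 : R) d dd ->
  'D_1 (a * b + (-1) ^+ s *: (c * d)) 0 =
  da * b 0 + a 0 * db + (-1) ^+ s * (dc * d 0 + c 0 * dd).
Proof.
move=> ha hb hc hd.
have [_ ->] := is_deriveD (is_deriveM ha hb) (is_deriveZ ((-1) ^+ s) (is_deriveM hc hd)).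
by rewrite /GRing.scale /=; ring.
Qed.

Lemma cderiveM (f h : R -> C) : cdiff f (0 : R) -> cdiff h (0 : R) ->
  cderive (fun t => f t * h t) = cderive f * h 0 + f 0 * cderive h.
Proof.
move=> [fr fi] [hr hi]; rewrite /cderive !derive1E.
set hR := (fun y => complex.Re (h y) : R^o); set hI := (fun y => complex.Im (h y) : R^o).
set fR := (fun y => complex.Re (f y) : R^o); set fI := (fun y => complex.Im (f y) : R^o).
have HR : is_derive (0 : R) (1 : R) hR ('D_1 hR 0) by apply/derivableP/diff_derivable.
have HI : is_derive (0 : R) (1 : R) hI ('D_1 hI 0) by apply/derivableP/diff_derivable.
have FR : is_derive (0 : R) (1 : R) fR ('D_1 fR 0) by apply/derivableP/diff_derivable.
have FI : is_derive (0 : R) (1 : R) fI ('D_1 fI 0) by apply/derivableP/diff_derivable.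
move: ('D_1 hR 0) ('D_1 hI 0) ('D_1 fR 0) ('D_1 fI 0) HR HI FR FI => dhR dhI dfR dfI HR HI FR FI.
have -> : (fun t => complex.Re (f t * h t) : R^o) = fR * hR + (-1) ^+ true *: (fI * hI).
  apply/funext => y /=; rewrite -[RHS]/(fR y * hR y + (-1) ^+ true * (fI y * hI y)).
  by rewrite expr1 mulN1r /fR /hR /fI /hI; case: (f y) (h y) => ? ? [].
have -> : (fun t => complex.Im (f t * h t) : R^o) = fR * hI + (-1) ^+ false *: (fI * hR).
  apply/funext => y /=; rewrite -[RHS]/(fR y * hI y + (-1) ^+ false * (fI y * hR y)).
  by rewrite expr0 mul1r /fR /hR /fI /hI; case: (f y) (h y) => ? ? [].
rewrite (derive_mul_sum true FR HR FI HI) (derive_mul_sum false FR HI FI HR).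
have -> : h 0 = Complex (hR 0) (hI 0) by rewrite /hR /hI; case: (h 0).
have -> : f 0 = Complex (fR 0) (fI 0) by rewrite /fR /fI; case: (f 0).
apply/eqP; rewrite eq_complex /=; apply/andP; split; apply/eqP;
  rewrite ?expr1 ?expr0; ring.
Qed.

Lemma cderive_cst (c : C) : cderive (fun _ : R => c) = 0.
Proof. by rewrite /cderive !derive1E !derive_cst. Qed.

Lemma cderive_sum I (r : seq I) (P : pred I) (f : I -> R -> C) :
  (forall i, cdiff (f i) (0 : R)) ->
  cderive (fun t => \sum_(i <- r | P i) f i t) = \sum_(i <- r | P i) cderive (f i).
Proof.
move=> df; elim: r => [|i r IH].
  by under [X in cderive X]funext do rewrite big_nil; rewrite cderive_cst big_nil.
under [X in cderive X]funext do rewrite big_cons.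
rewrite big_cons; case: (P i) => //.
by rewrite cderiveD ?IH //; exact: cdiff_sum.
Qed.

Lemma cderive_near (f h : R -> C) : (\forall t \near (0 : R), f t = h t) ->
  cderive f = cderive h.
Proof.
move=> fh; rewrite /cderive !derive1E; congr Complex; apply: near_eq_derive.
  by apply: filterS fh => y ->.
by apply: filterS fh => y ->.
Qed.

Definition mcdiff m n (F : R -> 'M[C]_(m, n)) := forall p q, cdiff (fun t => F t p q) (0 : R).
Definition mderive m n (F : R -> 'M[C]_(m, n)) : 'M[C]_(m, n) :=
  \matrix_(p, q) cderive (fun t => F t p q).

Lemma mcdiff_mul m n p (F : R -> 'M[C]_(m, n)) (H : R -> 'M[C]_(n, p)) :
  mcdiff F -> mcdiff H -> mcdiff (fun t => F t *m H t).
Proof.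
move=> dF dH i j; under [X in cdiff X]funext do rewrite mxE.
by apply: cdiff_sum => k; apply: cdiffM.
Qed.

Lemma mcdiff_cst m n (A : 'M[C]_(m, n)) : mcdiff (fun=> A).
Proof. by move=> i j; exact: cdiff_cst. Qed.

Lemma mderive_mul m n p (F : R -> 'M[C]_(m, n)) (H : R -> 'M[C]_(n, p)) :
  mcdiff F -> mcdiff H ->
  mderive (fun t => F t *m H t) = mderive F *m H 0 + F 0 *m mderive H.
Proof.
move=> dF dH; apply/matrixP => i j; rewrite !mxE -big_split /=.
under [X in cderive X]funext do rewrite mxE.
rewrite cderive_sum => [|k]; last exact: cdiffM.
by apply: eq_bigr => k _; rewrite cderiveM // !mxE.
Qed.

Lemma mderive_cst m n (A : 'M[C]_(m, n)) : mderive (fun _ : R => A) = 0.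
Proof. by apply/matrixP => i j; rewrite !mxE cderive_cst. Qed.

Lemma mderive_mull m n p (A : 'M[C]_(m, n)) (F : R -> 'M[C]_(n, p)) :
  mcdiff F -> mderive (fun t => A *m F t) = A *m mderive F.
Proof.
by move=> dF; rewrite (mderive_mul (mcdiff_cst A)) // mderive_cst mul0mx add0r.
Qed.

Lemma mderive_mulr m n p (A : 'M[C]_(n, p)) (F : R -> 'M[C]_(m, n)) :
  mcdiff F -> mderive (fun t => F t *m A) = mderive F *m A.
Proof.
by move=> dF; rewrite (mderive_mul _ (mcdiff_cst A)) // mderive_cst mulmx0 addr0.
Qed.

Lemma mderive_near m n (F H : R -> 'M[C]_(m, n)) : (\forall t \near (0 : R), F t = H t) ->
  mderive F = mderive H.
Proof.
move=> FH; apply/matrixP => i j; rewrite !mxE; apply: cderive_near.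
by apply: filterS FH => t ->.
Qed.

End ComplexDerivative.

(** * Tensor representations of K *)

Section Representations.
Variables (R : realType) (N : nat) (G : lieGroup R N) (g : lieAlgebra G).
Variables (D : cartanData g) (S : repData D).
Local Notation C := R[i].
Local Notation e := (expg g).
Local Notation rho_l := (rho_l S).
Local Notation rho_r := (rho_r S).
Local Notation rho := (rho_diag S).

Lemma tens_mul Ml MU Mr Ml' MU' Mr' :
  tens (S := S) Ml MU Mr *m tens Ml' MU' Mr' =
  tens (Ml *m Ml') (fun i => MU i *m MU' i) (Mr *m Mr').
Proof.
apply/matrixP => p q; rewrite !mxE.
rewrite (reindex (@enum_rank (tidx S))) /=; last exact/onW_bij/enum_rank_bij.
set I := enum_val p; set J := enum_val q.
under eq_bigr do rewrite !mxE enum_rankK -/I -/J.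
rewrite -(pair_bigA _ (fun (a : 'I_(dl S) * {dffun forall i : 'I_(nU S), 'I_(dU i)})
   (b : 'I_(dr S)) =>
   Ml I.1.1 a.1 * (\prod_(i < nU S) MU i (I.1.2 i) (a.2 i)) * Mr I.2 b *
   (Ml' a.1 J.1.1 * (\prod_(i < nU S) MU' i (a.2 i) (J.1.2 i)) * Mr' b J.2))) /=.
rewrite -(pair_bigA _ (fun (a : 'I_(dl S)) (t : {dffun forall i : 'I_(nU S), 'I_(dU i)}) =>
   \sum_(b < dr S)
   Ml I.1.1 a * (\prod_(i < nU S) MU i (I.1.2 i) (t i)) * Mr I.2 b *
   (Ml' a J.1.1 * (\prod_(i < nU S) MU' i (t i) (J.1.2 i)) * Mr' b J.2))) /=.
have -> : \prod_(i < nU S) (MU i *m MU' i) (I.1.2 i) (J.1.2 i) =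
    \sum_(t : {dffun forall i : 'I_(nU S), 'I_(dU i)})
      \prod_i (MU i (I.1.2 i) (t i) * MU' i (t i) (J.1.2 i)).
  rewrite (sum_dffun_prod (fun i j => MU i (I.1.2 i) j * MU' i j (J.1.2 i))).
  by apply: eq_bigr => i _; rewrite mxE.
rewrite [(Ml *m Ml') _ _]mxE [(Mr *m Mr') _ _]mxE !mulr_suml; apply: eq_bigr => a _.
rewrite [X in _ = X * _]mulr_sumr mulr_suml; apply: eq_bigr => t _.
rewrite mulr_sumr; apply: eq_bigr => b _.
rewrite big_split /=; ring.
Qed.

Lemma tens1 : tens (S := S) 1%:M (fun i => 1%:M) 1%:M = 1%:M.
Proof.
apply/matrixP => p q; rewrite !mxE -(inj_eq enum_val_inj).
case: (enum_val p) => -[a t] b; case: (enum_val q) => -[a' t'] b' /=.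
rewrite !xpair_eqE.
have -> : \prod_(i < nU S) (1%:M : 'M[C]_(dU i)) (t i) (t' i) = (t == t')%:R.
  have [<-|tt'] := eqVneq t t'; first by rewrite big1 // => i _; rewrite mxE eqxx.
  have [i ti] : exists i, t i != t' i.
    apply/existsP; apply: contraNT tt' => /existsPn H; apply/eqP/ffunP => i.
    by have /negPn/eqP := H i.
  by rewrite (bigD1 i) //= mxE (negPf ti) mul0r.
by rewrite !mxE -!natrM !mulnb.
Qed.

Lemma tens_cdiff (V : normedModType R) (Ml : V -> 'M[C]_(dl S))
    (MU : V -> forall i : 'I_(nU S), 'M[C]_(dU i)) (Mr : V -> 'M[C]_(dr S)) x :
  (forall i j, cdiff (fun y => Ml y i j) x) ->
  (forall k i j, cdiff (fun y => MU y k i j) x) ->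
  (forall i j, cdiff (fun y => Mr y i j) x) ->
  forall p q, cdiff (fun y => tens (Ml y) (MU y) (Mr y) p q) x.
Proof.
move=> dl dU dr p q; under [X in cdiff X]funext do rewrite mxE.
by apply: cdiffM => //; apply: cdiffM => //; apply: cdiff_prod.
Qed.

Lemma krep_inv (d : nat) (r : krep D d) k : K D k -> r k *m r k^-1%g = 1%:M.
Proof. by move=> Kk; rewrite -krepM ?mulgV ?krep1 //; exact: K_inv. Qed.

Lemma invmx_krep (d : nat) (r : krep D d) k : K D k -> invmx (r k) = r k^-1%g.
Proof.
move=> Kk; have H := krep_inv r Kk; have [u _] := mulmx1_unit H.
by rewrite -[LHS]mulmx1 -H mulmxA mulVmx // mul1mx.
Qed.

Lemma dual_repE k : K D k -> dual_rep S k = (sigr S k^-1%g)^T.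
Proof. by move=> Kk; rewrite /dual_rep invmx_krep. Qed.

Lemma dual_repM a b : K D a -> K D b ->
  dual_rep S (a * b)%g = dual_rep S a *m dual_rep S b.
Proof.
move=> Ka Kb; rewrite !dual_repE ?invgM //; last exact: K_mul.
by rewrite krepM ?trmx_mul //; exact: K_inv.
Qed.

Lemma dual_rep1 : dual_rep S 1%g = 1%:M.
Proof. by rewrite dual_repE ?invg1 ?krep1 ?trmx1 //; exact: K1. Qed.

Lemma rho_lM a b : K D a -> K D b -> rho_l (a * b)%g = rho_l a *m rho_l b.
Proof.
move=> Ka Kb; rewrite /Defs.rho_l tens_mul krepM // mul1mx; congr tens.
by apply: functional_extensionality_dep => i; rewrite grepM.
Qed.

Lemma rho_rM a b : K D a -> K D b -> rho_r (a * b)%g = rho_r a *m rho_r b.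
Proof.
move=> Ka Kb; rewrite /Defs.rho_r tens_mul dual_repM // mul1mx; congr tens.
by apply: functional_extensionality_dep => i; rewrite mul1mx.
Qed.

Lemma rho_l1 : rho_l 1%g = 1%:M.
Proof.
rewrite /Defs.rho_l krep1 -tens1; congr tens.
by apply: functional_extensionality_dep => i; rewrite grep1.
Qed.

Lemma rho_r1 : rho_r 1%g = 1%:M.
Proof. by rewrite /Defs.rho_r dual_rep1 -tens1. Qed.

Lemma rho_lr a : rho a = rho_l a *m rho_r a.
Proof.
rewrite /Defs.rho_l /Defs.rho_r tens_mul mulmx1 mul1mx; congr tens.
by apply: functional_extensionality_dep => i; rewrite mulmx1.
Qed.

Lemma rho_rl a : rho a = rho_r a *m rho_l a.
Proof.
rewrite /Defs.rho_l /Defs.rho_r tens_mul mulmx1 mul1mx; congr tens.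
by apply: functional_extensionality_dep => i; rewrite mul1mx.
Qed.

Lemma rho_l_r a b : rho_l a *m rho_r b = rho_r b *m rho_l a.
Proof.
rewrite /Defs.rho_l /Defs.rho_r !tens_mul !mulmx1 !mul1mx; congr tens.
by apply: functional_extensionality_dep => i; rewrite mulmx1 mul1mx.
Qed.

Lemma rhoM a b : K D a -> K D b -> rho (a * b)%g = rho a *m rho b.
Proof.
move=> Ka Kb; rewrite !rho_lr rho_lM // rho_rM // -!mulmxA; congr (_ *m _).
by rewrite !mulmxA rho_l_r.
Qed.

Lemma rho1 : rho 1%g = 1%:M.
Proof. by rewrite rho_lr rho_l1 rho_r1 mulmx1. Qed.

Lemma rhoV a : K D a -> rho a *m rho a^-1%g = 1%:M.
Proof. by move=> Ka; rewrite -rhoM ?mulgV ?rho1 //; exact: K_inv. Qed.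

Lemma rhoVl a : K D a -> rho a^-1%g *m rho a = 1%:M.
Proof. by move=> Ka; rewrite -rhoM ?mulVg ?rho1 //; exact: K_inv. Qed.

(* What the equivariance of the tensors needs of [rho_l], [rho_r], [rho_diag]. *)
Record kdiff (r : G -> 'M[C]_(dimV S)) : Prop := KDiff {
  kdiff_conj : forall k a, K D k -> K D a ->
    r (k * a * k^-1)%g = rho k *m r a *m rho k^-1%g;
  kdiff_diff : forall p q,
    cdiff (fun X : 'rV[R]_N => r (e (projv (kR D) X)) p q) (0 : 'rV[R]_N) }.

End Representations.

(** * Equivariance of the tensors under the normalizer of A *)

Section Equivariance.
Variables (R : realType) (N : nat) (G : lieGroup R N) (g : lieAlgebra G).
Variables (D : cartanData g) (S : repData D).
Local Notation C := R[i].
Local Notation VC := 'rV[C]_N.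
Local Notation e := (expg g).
Local Notation rho_l := (rho_l S).
Local Notation rho_r := (rho_r S).
Local Notation rho := (rho_diag S).
Local Notation kR := (kR D).
Local Notation MV := 'M[C]_(dimV S).

Lemma exp_projv_K X : K D (e (projv kR X)).
Proof. by apply: K_exp; exact: memv_proj. Qed.

Lemma krep_cdiff (d : nat) (r : krep D d) i j :
  cdiff (fun X : 'rV[R]_N => r (e (projv kR X)) i j) (0 : 'rV[R]_N).
Proof.
have := krep_smooth r (@K1 _ _ _ _ D) i j.
have -> : (fun X => r (1 * e (projv kR X))%g i j) = (fun X => r (e (projv kR X)) i j).
  by apply/funext => X; rewrite mul1g.
by move=> [/(_ 1%N)[re _] /(_ 1%N)[im _]]; split; [exact: re|exact: im].
Qed.

(** [grep_smooth] speaks of charts of G, so near 0 the map is factored through the chart at the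
    identity. *)
Lemma grep_cdiff (d : nat) (r : grep G d) i j :
  cdiff (fun X : 'rV[R]_N => r (e (projv kR X)) i j) (0 : 'rV[R]_N).
Proof.
pose c := la_chart g; have Ac := la_chart_atlas g.
pose L : {linear 'rV[R]_N -> 'rV[R]_N} := projv kR.
have cL : continuous L by apply: findim_continuous; exact: findim_rV.
have [ce Se] := expg_smooth g.
have dL : differentiable (cmap c \o (e \o L)) (0 : 'rV[R]_N).
  apply: (@differentiable_comp _ _ _ _ L (cmap c \o e)); first exact: linear_differentiable.
  have [df _] := Se c Ac 1%N; apply: df; split=> //.
  by rewrite /preimage /= linear0 exp0; exact: la_chart_1.
have [/(_ 1%N)[re _] /(_ 1%N)[im _]] := grep_smooth r Ac i j.
have c0 : (cmap c \o (e \o L)) 0 = cmap c 1%g by rewrite /= linear0 exp0.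
have cu : cimg c (cmap c 1%g) by exists 1%g => //; exact: la_chart_1.
apply: (@cdiff_ext _ _ ((fun u => r (cinv c u) i j) \o (cmap c \o (e \o L)))).
  have cc : {for 0, continuous (e \o L)}.
    by apply: continuous_comp; [exact: cL|exact: ce].
  have : \forall X \near (0 : 'rV[R]_N), cdom c ((e \o L) X).
    apply: cc; rewrite /= linear0 exp0; apply: open_nbhs_nbhs.
    by split; [exact: cdom_open|exact: la_chart_1].
  by apply: filterS => X cX; rewrite /= cmapK.
apply: cdiff_comp => //; rewrite c0.
by split; [exact: re|exact: im].
Qed.

Lemma dual_rep_cdiff i j :
  cdiff (fun X : 'rV[R]_N => dual_rep S (e (projv kR X)) i j) (0 : 'rV[R]_N).
Proof.
have H := krep_cdiff (sigr S) j i.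
pose L : {linear 'rV[R]_N -> 'rV[R]_N} := [the {linear _ -> _} of -%R].
have -> : (fun X : 'rV[R]_N => dual_rep S (e (projv kR X)) i j) =
    (fun X => sigr S (e (projv kR X)) j i) \o L.
  apply/funext => X /=; rewrite dual_repE; last exact: exp_projv_K.
  by rewrite mxE -expN linearN.
apply: cdiff_comp; last by rewrite linear0.
by apply: linear_differentiable; apply: findim_continuous; exact: findim_rV.
Qed.

(** [rho_diag k] is the product of [rho_l k] and [rho_r k]; the latter commutes with [rho_l a] and
    cancels, so conjugation by either representation agrees. Likewise for [kdiff_r]. *)
Lemma kdiff_l : kdiff rho_l.
Proof.
split=> [k a Kk Ka|p q].
  have Kk' := K_inv Kk.
  rewrite (rho_lM S (K_mul Kk Ka) Kk') (rho_lM S Kk Ka) (rho_lr S k) (rho_rl S k^-1%g).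
  rewrite -!mulmxA; congr (_ *m _); rewrite !mulmxA -(rho_l_r S a k) -!mulmxA; congr (_ *m _).
  by rewrite mulmxA -(rho_rM S Kk Kk') mulgV rho_r1 mul1mx.
apply: tens_cdiff => [i j|k i j|i j]; first exact: krep_cdiff.
  exact: grep_cdiff.
exact: cdiff_cst.
Qed.

Lemma kdiff_r : kdiff rho_r.
Proof.
split=> [k a Kk Ka|p q].
  have Kk' := K_inv Kk.
  rewrite (rho_rM S (K_mul Kk Ka) Kk') (rho_rM S Kk Ka) (rho_rl S k) (rho_lr S k^-1%g).
  rewrite -!mulmxA; congr (_ *m _); rewrite !mulmxA (rho_l_r S k a) -!mulmxA; congr (_ *m _).
  by rewrite mulmxA -(rho_lM S Kk Kk') mulgV rho_l1 mul1mx.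
apply: tens_cdiff => [i j|k i j|i j]; try exact: cdiff_cst.
exact: dual_rep_cdiff.
Qed.

Lemma kdiff_diag : kdiff rho.
Proof.
split=> [k a Kk Ka|p q].
  by rewrite (rhoM S (K_mul Kk Ka) (K_inv Kk)) (rhoM S Kk Ka).
apply: tens_cdiff => [i j|k i j|i j]; first exact: krep_cdiff.
  exact: grep_cdiff.
exact: dual_rep_cdiff.
Qed.

Section OneRep.
Variable r : G -> MV.
Hypothesis kr : kdiff r.

(** A total differential, hence additive and real homogeneous in [X], which is not evident for the
    curve derivative [drepR]. The projection makes it defined on all vectors; the two agree on
    [kR]. *)
Definition drm (X : 'rV[R]_N) : MV := \matrix_(p, q)
  cd (fun X : 'rV[R]_N => r (e (projv kR X)) p q) 0 X.

Lemma drmD X Y : drm (X + Y) = drm X + drm Y.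
Proof. by apply/matrixP => p q; rewrite !mxE cdD. Qed.

Lemma drmZ (a : R) X : drm (a *: X) = a%:C%C *: drm X.
Proof. by apply/matrixP => p q; rewrite !mxE cdZ. Qed.

Lemma rep_line p q X : X \in kR -> (fun t : R => r (e (t *: X)) p q) =
  (fun X : 'rV[R]_N => r (e (projv kR X)) p q) \o (fun t : R => t *: X).
Proof. by move=> Xk; apply/funext => t /=; rewrite projv_id // memvZ. Qed.

Lemma rep_line_cdiff X : X \in kR -> mcdiff (fun t : R => r (e (t *: X))).
Proof.
move=> Xk p q; rewrite rep_line //.
apply: cdiff_comp; last by rewrite scale0r; exact: (kdiff_diff kr).
by apply/derivable1_diffP; have [] := is_derive_scalel X 0.
Qed.

Lemma drepR_drm X : X \in kR -> drepR r X = drm X.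
Proof.
move=> Xk; apply/matrixP => p q; rewrite !mxE rep_line //.
have := cderive_line (is_derive_scalel X 0); rewrite scale0r => -> //.
exact: (kdiff_diff kr).
Qed.

Lemma drepR_mderive X : drepR r X = mderive (fun t : R => r (e (t *: X))).
Proof. by []. Qed.

Definition drC (X : VC) : MV := drm (reV X) + 'i%C *: drm (imV X).

Lemma drC_linear : linear drC.
Proof.
move=> a X Y; rewrite /drC reVD imVD reVZ imVZ -!scaleNr !(drmD, drmZ).
move: (drm (reV X)) (drm (imV X)) (drm (reV Y)) (drm (imV Y)) => x x' y y'.
apply/matrixP => i j; rewrite !mxE; case: a => p q.
by apply/eqP; rewrite eq_complex /=; apply/andP; split; apply/eqP;
  case: (x i j) (x' i j) (y i j) (y' i j) => ? ? [? ?] [? ?] [? ?] /=; ring.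
Qed.

Definition inkC (X : VC) : Prop := reV X \in kR /\ imV X \in kR.

Lemma drep_drC X : inkC X -> drep r X = drC X.
Proof. by move=> [re im]; rewrite /drep !drepR_drm. Qed.

Lemma Ad_kR k x : K D k -> x \in kR -> Ad g k x \in kR.
Proof. by move=> Kk /kRP tx; apply/kRP; rewrite (Ad_theta Kk) tx. Qed.

Lemma drepR_Ad k X : K D k -> X \in kR ->
  drepR r (Ad g k X) = rho k *m drepR r X *m rho k^-1%g.
Proof.
move=> Kk Xk; rewrite !drepR_mderive.
have -> : (fun t : R => r (e (t *: Ad g k X))) =
    (fun t => rho k *m r (e (t *: X)) *m rho k^-1%g).
  apply/funext => t; rewrite -conj_exp (kdiff_conj kr) //.
  by apply: K_exp; rewrite memvZ.
have dX := rep_line_cdiff Xk.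
rewrite mderive_mulr ?mderive_mull //.
exact: mcdiff_mul (mcdiff_cst _) dX.
Qed.

Lemma drC_Ad k X : K D k -> inkC X ->
  drC (AdC g k X) = rho k *m drC X *m rho k^-1%g.
Proof.
move=> Kk [re im]; rewrite /drC reV_AdC imV_AdC.
rewrite -(drepR_drm re) -(drepR_drm im) -!drepR_drm; [|exact: Ad_kR|exact: Ad_kR].
rewrite (drepR_Ad Kk re) (drepR_Ad Kk im).
by rewrite mulmxDr mulmxDl -scalemxAr -scalemxAl.
Qed.

Lemma inkC_y X : inkC (X + thC D X).
Proof.
rewrite (cplx_split X) thCD thCZ !thC_cplx addrACA -cplxD -scalerDr -cplxD.
rewrite /inkC reV_split imV_split.
by split; apply/kRP; rewrite linearD /= thetaK addrC.
Qed.

Definition dY (X : VC) : MV := drC (X + thC D X).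

Lemma dY_linear : linear dY.
Proof.
move=> a X Y; rewrite /dY thCD thCZ addrACA -scalerDr.
exact: drC_linear.
Qed.

Lemma dY_Ad k X : K D k -> dY (AdC g k X) = rho k *m dY X *m rho k^-1%g.
Proof.
move=> Kk; rewrite /dY (AdC_thC _ Kk) -AdCD drC_Ad //; exact: inkC_y.
Qed.

End OneRep.

Section Casimirs.
Variables (E : rootData D) (r r' : G -> MV).
Hypotheses (kr : kdiff r) (kr' : kdiff r').

Lemma yvecE al : yvec E al = evec E al + thC D (evec E al).
Proof. by rewrite /yvec thCE. Qed.

Lemma cartan_basis_sg (F : 'I_N -> VC) (al : 'I_N -> 'Hom(subvs_of (hC D), C^o)) : cartan_basis F al ->
  cartan_basis (fun i => sg D (F i)) (fun i => - al i).
Proof.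
move=> bF; split=> [i j|i H].
  by rewrite herm_sg bF.1 conjc_nat.
rewrite brE (root_sg bF i (subvsP H)) opp_lfunE; congr (- _ *: _).
by rewrite /alv vsvalK.
Qed.

(* Root spaces are lines, so [evec al] and [evec (- al)] are multiples of [F i]
   and [sg D (F i)]; their normalization makes the product of the factors -1. *)
Lemma upsilonE (F : 'I_N -> VC) (al : 'I_N -> 'Hom(subvs_of (hC D), C^o)) (lam : 'Hom(subvs_of (aR D), R^o)) :
  cartan_basis F al -> lam != 0 ->
  upsilon E r r' lam =
  - \sum_i (resa (al i) == lam)%:R *: (dY r (sg D (F i)) *m dY r' (F i)).
Proof.
move=> bF l0; rewrite /upsilon (sum_roots_over bF _ l0) big_mkcond -sumrN.
apply: eq_bigr => i _; case: eqP => [li|_]; last by rewrite scale0r oppr0.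
have ai0 : al i != 0 by apply: (root_neq0 (D := D)); rewrite li.
have bF' := cartan_basis_sg bF.
have Ri : Defs.roots (al i) by apply/(rootsP bF); split=> //; exists i.
have Rni : Defs.roots (- al i).
  by apply/(rootsP bF'); split; [rewrite oppr_eq0|exists i].
have e1 := root_vector bF ai0 (evec_root E Ri).
have nai0 : - al i != 0 by rewrite oppr_eq0.
have e2 := root_vector bF' nai0 (evec_root E Rni).
set c1 := herm _ _ _ in e1; set c2 := herm _ _ _ in e2.
have cc : c1 * c2 = -1.
  have [H nz] : exists H : subvs_of (hC D), al i H != 0.
    apply: contrapT => /forallNP H; case/eqP: ai0; apply/lfunP => x.
    by rewrite zero_lfunE; apply/eqP/negPn/negP/H.
  have := hvecP E Ri H; rewrite -(evec_br E Ri) e1 e2 brE brZl brZr BZr BZr mulrA.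
  have -> : br g (F i) (sg D (F i)) = - hvect D F i by rewrite /hvect opprK.
  rewrite BNr (B_hvect bF i (subvsP H)) /alv vsvalK mulrN => /eqP.
  rewrite -subr_eq0 -[X in - _ - X]mul1r -opprD oppr_eq0 -mulrDl mulf_eq0 (negPf nz) orbF.
  by rewrite addr_eq0 => /eqP.
have dYr (q : G -> MV) (kq : kdiff q) a : drep q (yvec E a) = dY q (evec E a).
  by rewrite yvecE drep_drC //; exact: inkC_y.
rewrite !dYr // e1 e2 !(linZ (dY_linear _)) -scalemxAl -scalemxAr scalerA mulrC cc.
by rewrite scaleN1r scale1r.
Qed.

(** By [upsilonE] the tensor is the part of one weight in a sum of a sesquilinear expression over an
    eigenbasis. Ad k moves the basis and the weight, and [change_eigenbasis] brings the basis
    back. *)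
Lemma upsilon_conj (lam : 'Hom(subvs_of (aR D), R^o)) k : NKA D k -> lam != 0 ->
  rho k *m upsilon E r r' lam *m rho k^-1%g = upsilon E r r' (wact k lam).
Proof.
move=> Nk l0; have [Kk _] := Nk; have [F [al bF]] := cartan_basis_ex D.
have eF := cartan_eigenbasis bF; have eF' := eigenbasis_Ad Nk eF.
rewrite (upsilonE bF l0) (upsilonE bF); last by rewrite wact_eq0.
rewrite mulmxN mulNmx mulmx_sumr mulmx_suml; congr (- _).
have H := change_eigenbasis (fun mu => (mu == wact k lam)%:R)
   (s := fun X Y => dY r (sg D X) *m dY r' Y) _ _ _ eF eF'.
apply: (etrans _ (esym (H _ _ _))) => [|X X' Y|a X Y|X a Y Y'].
- apply: eq_bigr => i _ /=; rewrite (AdC_sg _ Kk) (dY_Ad kr _ Kk) (dY_Ad kr' _ Kk).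
  have -> : (wact k (resa (al i)) == wact k lam) = (resa (al i) == lam).
    by apply/eqP/eqP => [/(congr1 (wact k^-1%g))|-> //]; rewrite !wactK.
  rewrite -scalemxAr -scalemxAl; congr (_ *: _).
  rewrite -!mulmxA; congr (_ *m (_ *m _)).
  by rewrite mulmxA (rhoVl S Kk) mul1mx.
- by rewrite sgD (linD (dY_linear _)) mulmxDl.
- by rewrite sgZ (linZ (dY_linear _)) -scalemxAl.
- by rewrite (linD (dY_linear _)) (linZ (dY_linear _)) mulmxDr scalemxAr.
Qed.

Lemma mC_inkC X : X \in mC D -> inkC X.
Proof.
by rewrite mem_cvspace => /andP[re im]; split; apply/kRP; exact: mR_theta.
Qed.

Lemma mC_AdC k X : NKA D k -> X \in mC D -> AdC g k X \in mC D.
Proof.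
move=> Nk; rewrite !mem_cvspace reV_AdC imV_AdC => /andP[re im].
by rewrite (Ad_mR Nk re) (Ad_mR Nk im).
Qed.

Lemma mC_expandl X : X \in mC D ->
  X = \sum_u killingC g X (tnth (cb' E) u) *: tnth (cb E) u.
Proof.
move=> mX; have bE := cb_basis E; rewrite [LHS](coord_basis bE mX).
apply: eq_bigr => u _; rewrite -tnth_nth; congr (_ *: _).
rewrite [in RHS](coord_basis bE mX) killingCC (lin_sum (V := C^o) (@killingC_lin _ _ _ g _)).
rewrite (bigD1 u) //= big1 ?addr0 => [|v vu].
  by rewrite -tnth_nth BZr killingCC cb_dual eqxx mulr1.
by rewrite -tnth_nth BZr killingCC cb_dual (negPf vu) mulr0.
Qed.

Lemma mC_expandr X : X \in mC D ->
  X = \sum_u killingC g (tnth (cb E) u) X *: tnth (cb' E) u.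
Proof.
move=> mX; have bE := cb'_basis E; rewrite [LHS](coord_basis bE mX).
apply: eq_bigr => u _; rewrite -tnth_nth; congr (_ *: _).
rewrite [in RHS](coord_basis bE mX) (lin_sum (V := C^o) (@killingC_lin _ _ _ g _)).
rewrite (bigD1 u) //= big1 ?addr0 => [|v vu].
  by rewrite -tnth_nth BZr cb_dual eqxx mulr1.
by rewrite -tnth_nth BZr cb_dual eq_sym (negPf vu) mulr0.
Qed.

Lemma cb_mC s : tnth (cb E) s \in mC D.
Proof. by apply: (basis_mem (cb_basis E)); exact: mem_tnth. Qed.

Lemma cb'_mC s : tnth (cb' E) s \in mC D.
Proof. by apply: (basis_mem (cb'_basis E)); exact: mem_tnth. Qed.

(** Ad k preserves m and the Killing form, so it sends dual bases to dual bases. One factor is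
    expanded in the old basis, and the coefficients recombine in the other. *)
Lemma Omega_conj k : NKA D k ->
  rho k *m Omega_m E r *m rho k^-1%g = Omega_m E r.
Proof.
move=> Nk; have [Kk _] := Nk; have Nk' := NKA_inv Nk.
have kc s := mC_inkC (cb_mC s); have kc' s := mC_inkC (cb'_mC s).
have -> : Omega_m E r = \sum_s (drC r (tnth (cb E) s) *m drC r (tnth (cb' E) s)).
  by apply: eq_bigr => s _; rewrite (drep_drC kr (kc s)) (drep_drC kr (kc' s)).
rewrite mulmx_sumr mulmx_suml.
transitivity (\sum_s \sum_u drC r (tnth (cb E) u) *m
    (killingC g (AdC g k (tnth (cb E) s)) (tnth (cb' E) u) *:
     drC r (AdC g k (tnth (cb' E) s)))).
  apply: eq_bigr => s _.
  transitivity (drC r (AdC g k (tnth (cb E) s)) *m drC r (AdC g k (tnth (cb' E) s))).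
    rewrite (drC_Ad kr Kk (kc s)) (drC_Ad kr Kk (kc' s)) -!mulmxA; congr (_ *m (_ *m _)).
    by rewrite mulmxA (rhoVl S Kk) mul1mx.
  rewrite {1}(mC_expandl (mC_AdC Nk (cb_mC s))) (lin_sum (drC_linear r)) mulmx_suml.
  apply: eq_bigr => u _; rewrite (linZ (drC_linear r)).
  by rewrite -scalemxAl scalemxAr.
rewrite exchange_big /=; apply: eq_bigr => u _; rewrite -mulmx_sumr; congr (_ *m _).
rewrite -[in RHS](AdCVK g k (tnth (cb' E) u)).
rewrite (mC_expandr (mC_AdC Nk' (cb'_mC u))) (lin_sum (AdC_linear g k)).
rewrite (lin_sum (drC_linear r)); apply: eq_bigr => s _.
rewrite AdCZ (linZ (drC_linear r)) -(AdC_B g k (tnth (cb E) s)) AdCVK.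
by [].
Qed.

End Casimirs.

(** Commuting with the group M suffices: differentiation along exp(tx), for x in [mR], yields
    commutation with the action of m and so stability of its invariants. *)
Lemma EndM_conj (T : MV) :
  (forall k, M D k -> rho k *m T *m rho k^-1%g = T) -> EndM T.
Proof.
move=> HT.
have HC k : M D k -> T *m rho k = rho k *m T.
  move=> Mk; have [Kk _] := Mk; rewrite -[in LHS](HT k Mk) -!mulmxA; congr (_ *m _).
  by rewrite (rhoVl S Kk) mulmx1.
have HX x : x \in mR D -> T *m drepR rho x = drepR rho x *m T.
  move=> mx; have kx : x \in kR by apply/kRP; exact: mR_theta.
  rewrite drepR_mderive -mderive_mull; last exact: (rep_line_cdiff kdiff_diag kx).
  rewrite -mderive_mulr; last exact: (rep_line_cdiff kdiff_diag kx).
  apply: mderive_near; near=> t; apply: HC.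
  by apply: M_exp; rewrite memvZ.
have HXC X : X \in mC D -> T *m drep rho X = drep rho X *m T.
  rewrite mem_cvspace => /andP[re im].
  have H1 := HX _ re; have H2 := HX _ im; rewrite /drep.
  move: (drepR rho (reV X)) (drepR rho (imV X)) H1 H2 => P Q H1 H2.
  by rewrite mulmxDr mulmxDl -scalemxAr -scalemxAl H1 H2.
move=> v vm; split=> [X XM|k Mk]; last by rewrite !mulmxA HC.
by rewrite mulmxA -(HXC X XM) -mulmxA (vm X XM) mulmx0.
Unshelve. all: end_near. Qed.

Lemma EndM_upsilon (E : rootData D) (r r' : G -> MV) lam :
  kdiff r -> kdiff r' -> lam != 0 -> EndM (upsilon E r r' lam).
Proof.
move=> kr kr' l0; apply: EndM_conj => k Mk.
by rewrite (upsilon_conj E kr kr' (M_NKA Mk) l0) (wact_M _ Mk).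
Qed.

Lemma EndM_Omega (E : rootData D) (r : G -> MV) : kdiff r -> EndM (Omega_m E r).
Proof.
by move=> kr; apply: EndM_conj => k Mk; rewrite (Omega_conj E kr (M_NKA Mk)).
Qed.

Lemma EndM_scalar c : EndM (c%:M : MV).
Proof.
apply: EndM_conj => k [Kk _].
by rewrite scalar_mxC -mulmxA (rhoV S Kk) mulmx1.
Qed.

End Equivariance.

(** * The real hyperbolic cotangent *)

Section RealCoth.
Variable R : realType.

(* [cothf 0 = 0], so that [cothf] is odd on all of [R]. *)
Definition cothf (x : R) : R := (expR x + expR (- x)) / (expR x - expR (- x)).

Lemma sinh_neq0 (x : R) : x != 0 -> expR x - expR (- x) != 0.
Proof.
move=> x0; rewrite subr_eq0; apply: contraNneq x0 => /expR_inj /eqP.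
by rewrite -addr_eq0 -mulr2n mulrn_eq0.
Qed.

Lemma cothf_sqr (x : R) : x != 0 ->
  cothf x ^+ 2 - 1 = 4 / (expR x - expR (- x)) ^+ 2.
Proof.
move=> /sinh_neq0 s0; rewrite /cothf.
have E : expR x * expR (- x) = 1 by rewrite -expRD subrr expR0.
move: (expR x) (expR (- x)) E s0 => p q E s0.
rewrite expr_div_n -[X in _ - X](divff (expf_neq0 2 s0)) -mulrBl; congr (_ / _).
rewrite (_ : (p + q) ^+ 2 - (p - q) ^+ 2 = 4 * (p * q)); last by ring.
by rewrite E mulr1.
Qed.

Lemma cothfN (x : R) : cothf (- x) = - cothf x.
Proof. by rewrite /cothf opprK -mulrN -invrN opprB addrC. Qed.

Lemma is_derive_cothf (x : R) : x != 0 ->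
  is_derive x (1 : R) cothf (1 - cothf x ^+ 2).
Proof.
move=> x0; have s0 := sinh_neq0 x0.
have dN : is_derive x (1 : R) (fun y : R => expR (- y)) (- expR (- x)).
  have dx : is_derive x (1 : R) (fun y : R => - y) (-1).
    exact: is_deriveN.
  have := is_derive1_comp (f := expR) (is_derive_expR (- x)) dx.
  by rewrite mulrN1.
have dP := is_deriveD (is_derive_expR x) dN.
have dM := is_deriveB (is_derive_expR x) dN.
have dV := @is_deriveV _ (expR - (fun y : R => expR (- y))) _ _ _ s0 dM.
have dF := is_deriveM dP dV.
apply: (is_derive_eq dF); rewrite /cothf /GRing.scale /=.
change ((expR x + expR (- x)) * (- (expR x - expR (- x)) ^- 2 * (expR x - - expR (- x))) +
  (expR x - expR (- x))^-1 * (expR x - expR (- x)) =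
  1 - ((expR x + expR (- x)) / (expR x - expR (- x))) ^+ 2).
by move: (expR x) (expR (- x)) s0 => p q s0; field.
Qed.

End RealCoth.

(** * Coordinates on the regular part of A *)

Section Coordinates.
Variables (R : realType) (N : nat) (G : lieGroup R N) (g : lieAlgebra G).
Variable D : cartanData g.
Local Notation aR := (aR D).
Local Notation rdual := 'Hom(subvs_of aR, R^o).
Local Notation coords := 'rV[R]_(rk D).
Local Notation x_ := (tnth (xb D)).

Definition acomb (u : coords) : 'rV[R]_N := \sum_j u 0 j *: x_ j.

Lemma acomb_linear : linear acomb.
Proof.
move=> a u v; rewrite /acomb scaler_sumr -big_split; apply: eq_bigr => j _ /=.
by rewrite !mxE scalerDl scalerA.
Qed.

HB.instance Definition _ :=
  GRing.isLinear.Build R coords 'rV[R]_N _ acomb acomb_linear.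

Lemma xb_aR j : x_ j \in aR.
Proof. by apply: (basis_mem (xb_basis D)); exact: mem_tnth. Qed.

Lemma acomb_aR u : acomb u \in aR.
Proof. by apply: memv_suml => j _; rewrite memvZ // xb_aR. Qed.

Definition acoord (h : 'rV[R]_N) : coords := \row_j inner D h (x_ j).

Lemma inner_linear y : scalar ((inner D)^~ y).
Proof. by move=> a x x'; rewrite /inner (killing_linl _) opprD mulrN. Qed.

Lemma acombK : cancel acomb acoord.
Proof.
move=> u; apply/rowP => j; rewrite mxE /acomb.
rewrite (lin_sum (V := R^o) (inner_linear (x_ j))).
rewrite (bigD1 j) //= big1 ?addr0 => [|i ij].
  by rewrite (linZ (V := R^o) (inner_linear (x_ j))) /inner xb_orthonormal eqxx /GRing.scale /= mulr1.
by rewrite (linZ (V := R^o) (inner_linear (x_ j))) /inner xb_orthonormal (negPf ij) /GRing.scale /= mulr0.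
Qed.

Lemma acomb_surj h : h \in aR -> exists u, h = acomb u.
Proof.
move=> ha; have bE := xb_basis D.
have eqr := size_basis bE.
pose X : (rk D).-tuple 'rV[R]_N := xb D.
exists (\row_j coord X j h); rewrite [LHS](coord_basis bE ha).
by apply: eq_bigr => j _; rewrite mxE -tnth_nth.
Qed.

Lemma acoordK h : h \in aR -> acomb (acoord h) = h.
Proof. by move=> /acomb_surj[u ->]; rewrite acombK. Qed.

Definition aexp (u : coords) : G := expg g (acomb u).

Lemma aexp_line u v (t : R) : (aexp u * expg g (t *: acomb v))%g = aexp (u + t *: v).
Proof.
rewrite /aexp linearD linearZ exp_addv //=.
apply: (aR_abelian (D := D)); first exact: acomb_aR.
by rewrite memvZ // acomb_aR.
Qed.

Definition ell (mu : rdual) (u : coords) : R^o := mu (vsproj aR (acomb u)).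

Lemma ell_linear mu : linear (ell mu).
Proof. by move=> a u v; rewrite /ell !linearP. Qed.

HB.instance Definition _ mu :=
  GRing.isLinear.Build R coords R^o _ (ell mu) (ell_linear mu).

Lemma ell_continuous mu : continuous (ell mu).
Proof. by apply: findim_continuous; exact: findim_rV. Qed.

Lemma xi_aexp mu u : xi (D := D) mu (aexp u) = expR (ell mu u).
Proof. by rewrite /aexp xi_exp //; exact: acomb_aR. Qed.

Lemma Areg_aexp u : Areg D (aexp u) <-> forall mu, Sigma D mu -> ell mu u != 0.
Proof.
have xi1 mu : (xi (D := D) mu (aexp u) != 1) = (ell mu u != 0).
  by rewrite xi_aexp -{1}[1](@expR0 R) (inj_eq (@expR_inj R)).
split=> [[_ H] mu /H|H]; first by rewrite xi1.
split; first by apply: A_exp; exact: acomb_aR.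
by move=> mu /H; rewrite xi1.
Qed.

Lemma Areg_surj a : Areg D a -> exists u, a = aexp u.
Proof. by move=> [[h /acomb_surj[u ->] <-] _]; exists u. Qed.

Lemma finite_Sigma' : finite_set (Sigma D).
Proof. by have [F [al bF]] := cartan_basis_ex D; exact: finite_Sigma bF. Qed.

Definition Sgs : seq rdual := finmap.enum_fset (fset_set (Sigma D)).

Lemma mem_Sgs mu : reflect (Sigma D mu) (mu \in Sgs).
Proof.
apply: (iffP idP); first by rewrite in_fset_set ?inE //; exact: finite_Sigma'.
by move=> H; rewrite in_fset_set ?inE //; exact: finite_Sigma'.
Qed.

Definition areg : set coords := aexp @^-1` Areg D.

(** The complement of finitely many hyperplanes, one for each restricted root. *)
Lemma open_areg : open areg.
Proof.
have -> : areg = [set u | all (fun mu => ell mu u != 0) Sgs].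
  apply/seteqP; split=> u; rewrite /areg /= Areg_aexp => H.
    by apply/allP => mu /mem_Sgs /H.
  by move=> mu /mem_Sgs; exact: (allP H).
elim: Sgs => [|mu s IH] /=; first by rewrite set_true; exact: openT.
have -> : [set u | (ell mu u != 0) && all (fun mu => ell mu u != 0) s] =
    (ell mu @^-1` [set x | x != 0]) `&` [set u | all (fun mu => ell mu u != 0) s].
  by apply/seteqP; split=> u /=; [move/andP|move=> [-> ->]].
apply: openI => //; apply: open_comp; last exact: open_neq.
by move=> u _; exact: ell_continuous.
Qed.

Definition acoth (mu : rdual) (u : coords) : R^o := cothf (ell mu u).

Lemma acoth_diff mu u : Sigma D mu -> areg u ->
  differentiable (acoth mu) u /\
  forall v, 'd (acoth mu) u v = ell mu v * (1 - acoth mu u ^+ 2).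
Proof.
move=> Smu /Areg_aexp/(_ _ Smu) u0.
have [dc Dc] := is_derive_cothf u0.
have dc' : differentiable (cothf (R:=R) : R^o -> R^o) (ell mu u) by apply/derivable1_diffP; exact: dc.
have dl : differentiable (ell mu) u by apply: linear_differentiable; exact: ell_continuous.
split; first exact: (differentiable_comp dl dc').
move=> v; rewrite /acoth (diff_comp dl dc') /=.
have L (y : R^o) : 'd (cothf (R:=R) : R^o -> R^o) (ell mu u) y = y * (1 - cothf (ell mu u) ^+ 2).
  rewrite -[y in LHS](mulr1 (y : R)).
  transitivity (y *: 'd (cothf (R:=R) : R^o -> R^o) (ell mu u) (1 : R^o)).
    by rewrite -linearZ.
  by congr (_ * _); rewrite -deriveE.
by rewrite L diff_lin //; exact: ell_continuous.
Qed.

(* By [coth' = 1 - coth ^+ 2] all derivatives are polynomials in [acoth mu]. *)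
Lemma acoth_smooth mu : Sigma D mu -> smooth areg (acoth mu).
Proof.
move=> Smu; elim=> [|k IH].
  by move=> u Uu; have [/differentiable_continuous] := acoth_diff Smu Uu.
split=> [u Uu|v]; first by have [] := acoth_diff Smu Uu.
apply: (@Ck_ext _ _ _ _ _ (fun u => (fun=> ell mu v : R^o) u *: (1 + (-1 : R^o) *: (acoth mu u *: acoth mu u)))).
- exact: open_areg.
- move=> u Uu; have [du Du] := acoth_diff Smu Uu.
  by rewrite deriveE // Du expr2 /GRing.scale /= mulN1r.
have oU := open_areg.
apply: (Ck_scale oU); first exact: Ck_cst.
apply: (Ck_add oU); first exact: Ck_cst.
by apply: (Ck_scale oU); [exact: Ck_cst|exact: (Ck_scale oU)].
Qed.

End Coordinates.

(** * Smooth sections and their partial derivatives *)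

Section Sections.
Variables (R : realType) (N : nat) (G : lieGroup R N) (g : lieAlgebra G).
Variables (D : cartanData g) (S : repData D).
Local Notation C := R[i].
Local Notation aR := (aR D).
Local Notation coords := 'rV[R]_(rk D).
Local Notation x_ := (tnth (xb D)).
Local Notation U := (@areg _ _ _ _ D).
Local Notation aexp := (@aexp _ _ _ _ D).
Local Notation acomb := (@acomb _ _ _ _ D).
Implicit Type f : sect S.

Lemma smooth_sectP f : smooth_sect f <->
  (forall a, Areg D a -> inVm (f a)) /\
  forall i, csmooth U (fun u => f (aexp u) i 0).
Proof. by []. Qed.

Lemma smooth_sect_cdiff f i u : smooth_sect f -> U u ->
  cdiff (fun w => f (aexp w) i 0) u.
Proof. by move=> [_ /(_ i)[/(_ 1%N)[re _] /(_ 1%N)[im _]]] Uu; split; [exact: re|exact: im]. Qed.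

Lemma is_derive_line (V : normedModType R) (u v : V) :
  is_derive (0 : R) (1 : R) (fun t : R => u + t *: v) v.
Proof.
have := is_deriveD (is_derive_cst u (0 : R) (1 : R)) (is_derive_scalel v 0).
by rewrite add0r.
Qed.

Lemma near_aexp_line u v : U u -> \forall t \near (0 : R), Areg D (aexp (u + t *: v)).
Proof.
move=> Uu; have cc : {for (0 : R), continuous (fun t : R => u + t *: v)}.
  apply: differentiable_continuous.
  by have [/derivable1_diffP] := is_derive_line u v.
apply: (cc U); rewrite scale0r addr0; apply: open_nbhs_nbhs; split=> //; exact: open_areg.
Qed.

Lemma partial_line f u v :
  partial (acomb v) f (aexp u) = \col_i cderive (fun t => f (aexp (u + t *: v)) i 0).
Proof.
by apply/colP => i; rewrite !mxE; congr cderive; apply/funext => t; rewrite aexp_line.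
Qed.

Lemma partial_cd f u v : smooth_sect f -> U u ->
  partial (acomb v) f (aexp u) = \col_i cd (fun w => f (aexp w) i 0) u v.
Proof.
move=> sf Uu; rewrite partial_line; apply/colP => i; rewrite !mxE.
have := @cderive_line _ _ (fun w => f (aexp w) i 0) _ v (is_derive_line u v).
by rewrite scale0r addr0 => -> //; exact: smooth_sect_cdiff.
Qed.

(** For h in [aR] the curve a exp(th) stays in the regular set for small t. *)
Lemma partial_ext f f' h a : (forall a, Areg D a -> f a = f' a) -> h \in aR ->
  Areg D a -> partial h f a = partial h f' a.
Proof.
move=> ff /acomb_surj[v ->] Aa; have [u eu] := Areg_surj Aa; rewrite eu in Aa *.
rewrite !partial_line; apply/colP => i; rewrite !mxE; apply: cderive_near.
by have := near_aexp_line v Aa; apply: filterS => t /ff ->.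
Qed.

Lemma acomb_delta j : acomb (delta_mx 0 j) = x_ j.
Proof.
rewrite -[LHS]/(\sum_i (delta_mx 0 j : coords) 0 i *: x_ i) (bigD1 j) //= big1 ?addr0 => [|i ij].
  by rewrite mxE !eqxx scale1r.
by rewrite mxE eqxx (negPf ij) scale0r.
Qed.

(** [partial h] looks at a single line; its linearity in [h] comes from total differentiability of
    the section. *)
Lemma partial_comb f h a : smooth_sect f -> h \in aR -> Areg D a ->
  partial h f a = \sum_j (inner D h (x_ j))%:C%C *: partial (x_ j) f a.
Proof.
move=> sf ha Aa; have [u eu] := Areg_surj Aa; rewrite eu in Aa *.
rewrite -{1}(acoordK ha) partial_cd //.
transitivity (\sum_j (acoord D h 0 j)%:C%C *: partial (acomb (delta_mx 0 j)) f (aexp u)).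
  apply/colP => i; rewrite mxE summxE [X in cd _ _ X]row_sum_delta.
  rewrite (@big_morph _ _ (cd (fun w => f (aexp w) i 0) u) 0 +%R) => [|X Y|].
  - by apply: eq_bigr => j _; rewrite cdZ partial_cd // !mxE.
  - exact: cdD.
  - by rewrite -(scale0r (0 : coords)) cdZ mul0r.
by apply: eq_bigr => j _; rewrite acomb_delta mxE.
Qed.

Lemma smooth_sect_ext f f' : (forall a, Areg D a -> f a = f' a) ->
  smooth_sect f -> smooth_sect f'.
Proof.
move=> ff /smooth_sectP[Vf sf]; apply/smooth_sectP; split=> [a Aa|i]; first by rewrite -ff //; exact: Vf.
have [re im] := sf i.
split=> k; [apply: Ck_ext (re k)|apply: Ck_ext (im k)]; try exact: open_areg.
  by move=> u Uu; rewrite ff.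
by move=> u Uu; rewrite ff.
Qed.

Lemma inVm_lin (c c' : C) (v w : 'cV[C]_(dimV S)) :
  inVm v -> inVm w -> inVm (c *: v + c' *: w).
Proof. by move=> Vv Vw X XM; rewrite mulmxDr -!scalemxAr Vv // Vw // !scaler0 addr0. Qed.

(** Differentiating the linear equations that define V^m keeps the values in it. *)
Lemma smooth_sect_partial f h : smooth_sect f -> h \in aR -> smooth_sect (partial h f).
Proof.
move=> sf /acomb_surj[v ->]; have /smooth_sectP[Vf Cf] := sf; apply/smooth_sectP; split=> [a Aa|i].
  have [u eu] := Areg_surj Aa; rewrite eu in Aa *.
  move=> X XM; rewrite partial_line.
  have -> : \col_i cderive (fun t => f (aexp (u + t *: v)) i 0) =
      mderive (fun t : R => f (aexp (u + t *: v))).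
    by apply/matrixP => i j; rewrite !mxE (ord1 j).
  rewrite -mderive_mull => [|i j]; last first.
    rewrite (ord1 j); apply: (@cdiff_comp _ _ _ (fun w => f (aexp w) i 0)).
      by have [/derivable1_diffP] := is_derive_line u v.
    by rewrite scale0r addr0; exact: smooth_sect_cdiff.
  transitivity (mderive (fun _ : R => 0 : 'cV[C]_(dimV S))); last exact: mderive_cst.
  by apply: mderive_near; have := near_aexp_line v Aa; apply: filterS => t /Vf; apply.
have oU := @open_areg _ _ _ _ D; have [re im] := Cf i.
split=> k.
  have [dre Dre] := re k.+1; apply: (Ck_ext oU _ (Dre v)) => u Uu.
  by rewrite partial_cd // mxE /= deriveE //; exact: dre.
have [dim Dim] := im k.+1; apply: (Ck_ext oU _ (Dim v)) => u Uu.
by rewrite partial_cd // mxE /= deriveE //; exact: dim.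
Qed.

Lemma smooth_sectD f f' : smooth_sect f -> smooth_sect f' ->
  smooth_sect (fun a => f a + f' a).
Proof.
move=> /smooth_sectP[Vf sf] /smooth_sectP[Vf' sf']; apply/smooth_sectP; split=> [a Aa|i].
  by have := inVm_lin 1 1 (Vf a Aa) (Vf' a Aa); rewrite !scale1r.
have [re im] := sf i; have [re' im'] := sf' i; have oU := @open_areg _ _ _ _ D.
split=> k.
  by apply: (Ck_ext oU _ (Ck_add oU (re k) (re' k))) => u Uu; rewrite mxE; case: (f _ i 0) (f' _ i 0) => ? ? [].
by apply: (Ck_ext oU _ (Ck_add oU (im k) (im' k))) => u Uu; rewrite mxE; case: (f _ i 0) (f' _ i 0) => ? ? [].
Qed.

Lemma smooth_sectZ (q : G -> R) f : smooth U (fun u => q (aexp u) : R^o) ->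
  smooth_sect f -> smooth_sect (fun a => (q a)%:C%C *: f a).
Proof.
move=> sq /smooth_sectP[Vf sf]; apply/smooth_sectP; split=> [a Aa|i].
  by have := inVm_lin (q a)%:C%C 0 (Vf a Aa) (Vf a Aa); rewrite scale0r addr0.
have [re im] := sf i; have oU := @open_areg _ _ _ _ D.
split=> k.
  apply: (Ck_ext oU _ (Ck_scale oU (sq k) (re k))) => u Uu; rewrite mxE.
  by case: (f _ i 0) => x y /=; rewrite mul0r subr0.
apply: (Ck_ext oU _ (Ck_scale oU (sq k) (im k))) => u Uu; rewrite mxE.
by case: (f _ i 0) => x y /=; rewrite mul0r addr0.
Qed.

Lemma partialD f f' h a : smooth_sect f -> smooth_sect f' -> h \in aR -> Areg D a ->
  partial h (fun a => f a + f' a) a = partial h f a + partial h f' a.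
Proof.
move=> sf sf' /acomb_surj[v ->] Aa; have [u eu] := Areg_surj Aa; rewrite eu in Aa *.
have ll (F : sect S) i : smooth_sect F -> cdiff (fun t : R => F (aexp (u + t *: v)) i 0) 0.
  move=> sF; apply: (@cdiff_comp _ _ _ (fun w => F (aexp w) i 0)).
    by have [/derivable1_diffP] := is_derive_line u v.
  by rewrite scale0r addr0; exact: smooth_sect_cdiff.
rewrite !partial_line; apply/colP => i; rewrite !mxE -cderiveD; try exact: ll.
by congr cderive; apply/funext => t; rewrite mxE.
Qed.

Lemma partialZ (q : G -> R) f v u : smooth_sect f -> U u ->
  differentiable (fun u => q (aexp u) : R^o) u ->
  partial (acomb v) (fun a => (q a)%:C%C *: f a) (aexp u) =
  ('d (fun u => q (aexp u) : R^o) u v)%:C%C *: f (aexp u) +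
  (q (aexp u))%:C%C *: partial (acomb v) f (aexp u).
Proof.
move=> sf Uu dq.
have dl : differentiable (fun t : R => u + t *: v) (0 : R).
  by have [/derivable1_diffP] := is_derive_line u v.
have cq : cdiff (fun w => (q (aexp w))%:C%C) u by split => //=; exact: differentiable_cst.
rewrite !partial_line; apply/colP => i; rewrite !mxE.
under [X in cderive X]funext do rewrite mxE.
rewrite cderiveM; first last.
- apply: (@cdiff_comp _ _ _ (fun w => f (aexp w) i 0)) => //.
  by rewrite scale0r addr0; exact: smooth_sect_cdiff.
- by apply: (@cdiff_comp _ _ _ (fun w => (q (aexp w))%:C%C)) => //; rewrite scale0r addr0.
rewrite scale0r addr0; congr (_ * _ + _).
have := @cderive_line _ _ (fun w => (q (aexp w))%:C%C) _ v (is_derive_line u v).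
rewrite scale0r addr0 => -> //; rewrite /cd /=; congr Complex.
by rewrite diff_cst.
Qed.

End Sections.

(** * Membership of the coefficients in the ring R *)

Section CoefficientRing.
Variables (R : realType) (N : nat) (G : lieGroup R N) (g : lieAlgebra G).
Variable D : cartanData g.
Local Notation C := R[i].
Local Notation rdual := 'Hom(subvs_of (aR D), R^o).
Local Notation xi := (xi (D := D)).
Implicit Type mu : rdual.

Lemma xi_gt0 mu a : 0 < xi mu a. Proof. exact: expR_gt0. Qed.

Lemma xiN mu a : xi (- mu) a = (xi mu a)^-1.
Proof. by rewrite /Defs.xi opp_lfunE expRN. Qed.

Lemma xi2 mu a : xi (mu *+ 2) a = xi mu a ^+ 2.
Proof. by rewrite /Defs.xi mulr2n add_lfunE expRD expr2. Qed.

Definition cothG mu a : R := (xi mu a + xi (- mu) a) / (xi mu a - xi (- mu) a).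

Lemma cothGE mu a : cothG mu a = (xi mu a + xi (- mu) a) / (xi mu a - xi (- mu) a).
Proof. by []. Qed.

Lemma cothG_aexp mu u : cothG mu (aexp u) = acoth mu u.
Proof.
rewrite /cothG !xi_aexp /acoth /cothf.
have -> : ell (- mu) u = - ell mu u by rewrite /ell opp_lfunE.
by [].
Qed.

Lemma xi_neq1 mu a : Areg D a -> Sigma D mu -> xi mu a != 1.
Proof. by move=> [_ H] /H. Qed.

Lemma xi_units mu a : Areg D a -> Sigma D mu ->
  [/\ xi mu a != 0, 1 + xi mu a != 0, 1 - xi mu a != 0 & xi mu a ^+ 2 - 1 != 0].
Proof.
move=> Aa Smu; have p0 := xi_gt0 mu a.
have q0 : 1 + xi mu a != 0 by rewrite gt_eqF // addr_gt0.
have q1 : 1 - xi mu a != 0 by rewrite subr_eq0 eq_sym xi_neq1.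
split=> //; first by rewrite gt_eqF.
rewrite (_ : _ - 1 = - ((1 + xi mu a) * (1 - xi mu a))); last by ring.
by rewrite oppr_eq0 mulf_neq0.
Qed.

Definition calRr (q : G -> R) : Prop := calR D (fun a => (q a)%:C%C).

Lemma calRr_cst c : calRr (fun=> c).
Proof. exact: calR_cst. Qed.

Lemma calRr_add q q' : calRr q -> calRr q' -> calRr (fun a => q a + q' a).
Proof.
move=> cq cq'; apply: calR_ext (calR_add cq cq') _ => a _.
by rewrite rmorphD.
Qed.

Lemma calRr_mul q q' : calRr q -> calRr q' -> calRr (fun a => q a * q' a).
Proof.
move=> cq cq'; apply: calR_ext (calR_mul cq cq') _ => a _.
by rewrite rmorphM.
Qed.

Lemma calRr_ext q q' : calRr q -> (forall a, Areg D a -> q a = q' a) -> calRr q'.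
Proof. by move=> cq qq; apply: calR_ext cq _ => a /qq ->. Qed.

Lemma calRr_coth mu : Sigma D mu -> calRr (cothG mu).
Proof.
move=> Smu; have cD := calR_genD Smu; have cB := calR_genB Smu.
(* With P = 1 / (1 - xi^2), a product of two generators, coth is 1 - 2 P. *)
apply: (@calRr_ext (fun a => 1 + (-2) * ((1 + xi mu a)^-1 * (1 - xi mu a)^-1))).
  by apply: calRr_add (calRr_cst _) (calRr_mul (calRr_cst _) (calRr_mul cD cB)).
move=> a Aa; rewrite /cothG; rewrite xiN.
have [p0 q0 q1 s1] := xi_units Aa Smu; move: (xi mu a) p0 q0 q1 s1 => p p0 q0 q1 s1.
by field; rewrite p0 q0 q1 ?s1.
Qed.

Lemma calRr_sinh2 mu : Sigma D mu ->
  calRr (fun a => (xi mu a - xi (- mu) a) ^- 2).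
Proof.
move=> Smu; have cD := calR_genD Smu; have cB := calR_genB Smu.
have cP := calRr_mul cD cB.
(* For the same P the function is xi^2 P^2, and xi^2 = 1 - 1 / P makes this P^2 - P. *)
apply: (@calRr_ext (fun a => ((1 + xi mu a)^-1 * (1 - xi mu a)^-1) *
   ((1 + xi mu a)^-1 * (1 - xi mu a)^-1) + (-1) * ((1 + xi mu a)^-1 * (1 - xi mu a)^-1))).
  exact: calRr_add (calRr_mul cP cP) (calRr_mul (calRr_cst _) cP).
move=> a Aa; rewrite xiN.
have [p0 q0 q1 s1] := xi_units Aa Smu; move: (xi mu a) p0 q0 q1 s1 => p p0 q0 q1 s1.
by field; rewrite p0 q0 q1 ?s1.
Qed.

Lemma calRr_cosh_sinh2 mu : Sigma D mu ->
  calRr (fun a => (xi mu a - xi (- mu) a) ^- 2 * (xi mu a + xi (- mu) a)).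
Proof.
move=> Smu; have cD := calR_genD Smu; have cB := calR_genB Smu.
have cP := calRr_mul cD cB.
(* The first factor is xi P, half the difference of the two generators; the second is 2 P - 1 =
   -coth. *)
apply: (@calRr_ext (fun a => (2^-1 * ((1 - xi mu a)^-1 + (-1) * (1 + xi mu a)^-1)) *
   (2 * ((1 + xi mu a)^-1 * (1 - xi mu a)^-1) + (-1)))).
  apply: calRr_mul; last exact: calRr_add (calRr_mul (calRr_cst _) cP) (calRr_cst _).
  exact: calRr_mul (calRr_cst _) (calRr_add cB (calRr_mul (calRr_cst _) cD)).
move=> a Aa; rewrite xiN.
have [p0 q0 q1 s1] := xi_units Aa Smu; move: (xi mu a) p0 q0 q1 s1 => p p0 q0 q1 s1.
by field; rewrite p0 q0 q1 ?s1.
Qed.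

End CoefficientRing.

(** * Calculus of the Weyl group action on operators *)

Section WeylInvariance.
Variables (R : realType) (N : nat) (G : lieGroup R N) (g : lieAlgebra G).
Variables (D : cartanData g) (S : repData D).
Local Notation C := R[i].
Local Notation rdual := 'Hom(subvs_of (aR D), R^o).
Local Notation x_ := (tnth (xb D)).
Local Notation MV := 'M[C]_(dimV S).
Local Notation dop := (dop S).
Implicit Types (P Q : dop) (q : G -> MV) (k : G).

Lemma dop_eq_refl P : dop_eq P P. Proof. by []. Qed.

Lemma dop_eq_sym P Q : dop_eq P Q -> dop_eq Q P.
Proof. by move=> PQ f sf a Aa; rewrite PQ. Qed.

Lemma dop_eq_trans P Q P' : dop_eq P Q -> dop_eq Q P' -> dop_eq P P'.
Proof. by move=> PQ QP f sf a Aa; rewrite PQ // QP. Qed.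

Lemma dop_eqD P P' Q Q' : dop_eq P P' -> dop_eq Q Q' -> dop_eq (P + Q) (P' + Q').
Proof.
move=> PP QQ f sf a Aa; have := PP f sf a Aa; have := QQ f sf a Aa => qq pp.
by rewrite -[LHS]/(P f a + Q f a) pp qq.
Qed.

Lemma dop_sumE (I : Type) (r : seq I) (P : I -> dop) f a :
  (\sum_(i <- r) P i) f a = \sum_(i <- r) P i f a.
Proof. by rewrite fct_sumE fct_sumE. Qed.

Lemma sum_Sgs (Z : nmodType) (F : rdual -> Z) :
  \sum_(mu \in Sigma D) F mu = \sum_(mu <- Sgs D) F mu.
Proof. exact: fsbig_finite (finite_Sigma' D). Qed.

Lemma perm_Sgs k : NKA D k -> perm_eq (map (wact k) (Sgs D)) (Sgs D).
Proof.
move=> Nk; apply: uniq_perm; last first.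
- move=> mu; apply/mapP/mem_Sgs => [[nu /mem_Sgs Snu ->]|Smu].
    exact: wact_Sigma.
  exists (wact k^-1%g mu); last by rewrite wactVK.
  by apply/mem_Sgs; exact: wact_Sigma (NKA_inv Nk) Smu.
- exact: finmap.fset_uniq.
- rewrite map_inj_uniq; first exact: finmap.fset_uniq.
  by move=> mu nu /(congr1 (wact k^-1%g)); rewrite !wactK.
Qed.

Lemma REndM_ext q q' : (forall a, Areg D a -> q a = q' a) -> REndM q -> REndM q'.
Proof. by move=> qq [n [c [T [H1 H2 H3]]]]; exists n, c, T; split=> // a Aa; rewrite -qq // H3. Qed.

Lemma REndM_scale c T : calRr D c -> EndM T ->
  REndM (fun a => (c a)%:C%C *: T : MV).
Proof.
move=> cc eT; exists 1%N, (fun=> fun a => (c a)%:C%C), (fun=> T).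
by split=> // a _; rewrite big_ord1.
Qed.

Lemma REndM_cst T : EndM T -> REndM (fun=> T : MV).
Proof.
move=> eT; apply: REndM_ext (REndM_scale (calRr_cst D 1) eT) => a _.
by rewrite scale1r.
Qed.

Lemma REndM_smult c : calRr D c -> REndM (fun a => ((c a)%:C%C)%:M : MV).
Proof.
move=> cc; have := REndM_scale cc (@EndM_scalar _ _ _ _ _ S 1); apply: REndM_ext => a _.
by rewrite scale_scalar_mx mulr1.
Qed.

Lemma REndM_add q q' : REndM q -> REndM q' -> REndM (fun a => q a + q' a).
Proof.
move=> [n [c [T [H1 H2 H3]]]] [n' [c' [T' [H1' H2' H3']]]].
exists (n + n')%N, (fun i => match fintype.split i with inl j => c j | inr j => c' j end),
  (fun i => match fintype.split i with inl j => T j | inr j => T' j end).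
split=> [i|i|a Aa]; try by case: fintype.split.
rewrite big_split_ord H3 // H3' //; congr (_ + _); apply: eq_bigr => i _.
  by rewrite (unsplitK (inl i)).
by rewrite (unsplitK (inr i)).
Qed.

(** The closure properties of [W_act] yield membership in [DM] as a by-product; the choice k = 1 is
    always available for this. *)
Lemma W_act_DM k P P' : W_act k P P' -> DM P.
Proof. by move=> [s [H1 H2 _]]; exists s. Qed.

Lemma W_act_ext k P P' Q Q' : dop_eq P Q -> dop_eq P' Q' -> W_act k P P' -> W_act k Q Q'.
Proof.
move=> PQ PQ' [s [H1 H2 H3]]; exists s; split; first exact: H1.
  exact: (dop_eq_trans (dop_eq_sym PQ) H2).
exact: (dop_eq_trans (dop_eq_sym PQ') H3).
Qed.

Lemma W_act0 k : W_act k (0 : dop) (0 : dop).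
Proof. by exists [::]; split=> //; rewrite big_nil. Qed.

Lemma W_act_add k P P' Q Q' : W_act k P P' -> W_act k Q Q' -> W_act k (P + Q) (P' + Q').
Proof.
move=> [s [H1 H2 H3]] [s' [H1' H2' H3']]; exists (s ++ s'); split.
- move=> i; rewrite size_cat nth_cat => lt_i; case: ltnP => le_i; first exact: H1.
  by apply: H1'; rewrite ltn_subLR.
- by rewrite big_cat; exact: (dop_eqD H2 H2').
- by rewrite big_cat; exact: (dop_eqD H3 H3').
Qed.

Lemma W_act_sum k (I : eqType) (r : seq I) (P P' : I -> dop) :
  (forall i, i \in r -> W_act k (P i) (P' i)) ->
  W_act k (\sum_(i <- r) P i) (\sum_(i <- r) P' i).
Proof.
elim: r => [|i r IH] H; first by rewrite !big_nil; exact: W_act0.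
rewrite !big_cons; apply: W_act_add; first by apply: H; rewrite mem_head.
by apply: IH => j jr; apply: H; rewrite inE jr orbT.
Qed.

Lemma W_act_term k (p : term S) : REndM p.1 ->
  W_act k (term_op x_ p) (term_op (fun j => Ad g k (x_ j)) (act_coef k p.1, p.2)).
Proof.
move=> Rp; exists [:: p]; split=> [[|i] //|f _ a _|f _ a _].
  by rewrite big_seq1.
by rewrite big_seq1.
Qed.

Lemma big_comp_only (T : Type) (I : eqType) (r : seq I) (j : I) (F : I -> T -> T) :
  uniq r -> j \in r -> (forall i, i != j -> F i = id) ->
  \big[(fun P Q : T -> T => P \o Q)/id]_(i <- r) F i = F j.
Proof.
move=> ur jr Fid.
have H s : j \notin s -> \big[(fun P Q : T -> T => P \o Q)/id]_(i <- s) F i = id.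
  elim: s => [|i s IH]; first by rewrite big_nil.
  rewrite inE negb_or => /andP[ij js]; rewrite big_cons (IH js) Fid //.
  by rewrite eq_sym.
elim: r ur jr => [//|i r IH] /= /andP[ir ur].
rewrite inE big_cons => /orP[/eqP ji|jr]; first by rewrite H ji.
rewrite (IH ur jr) Fid //; apply: contraNneq ir => -> //.
Qed.

Lemma term_op0 y q : term_op y (q, [ffun=> 0%N]) = mult q :> dop.
Proof.
rewrite /term_op /=; have -> // : \big[(fun P Q : dop => P \o Q)/id]_j
  iter ([ffun=> 0%N] j) (partial (y j)) = id.
by elim/big_ind: _ => // [P Q -> ->|i _] //; rewrite ffunE.
Qed.

Lemma term_op1 y q n j :
  term_op y (q, [ffun i => if i == j then n else 0%N]) =
  mult q \o iter n (partial (y j)) :> dop.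
Proof.
have := @big_comp_only (sect S) _ (index_enum 'I_(rk D)) j
  (fun i => iter ([ffun i => if i == j then n else 0%N] i) (partial (y i)))
  (index_enum_uniq _) (mem_index_enum j).
rewrite ffunE eqxx => H; rewrite -H // => i ij.
by rewrite ffunE (negPf ij).
Qed.

Lemma W_act_mult k q : REndM q -> W_act k (mult q) (mult (act_coef k q)).
Proof.
move=> Rq; have := @W_act_term k (q, [ffun=> 0%N]) Rq.
by rewrite !term_op0.
Qed.

Lemma W_act_partial k q n j : REndM q ->
  W_act k (mult q \o iter n (partial (x_ j)))
    (mult (act_coef k q) \o iter n (partial (Ad g k (x_ j)))).
Proof.
move=> Rq; have := @W_act_term k (q, [ffun i => if i == j then n else 0%N]) Rq.
by rewrite !term_op1.
Qed.

Lemma act_coef_scalar k (c : G -> C) a : K D k ->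
  act_coef k (fun a => (c a)%:M : MV) a = (c (k^-1 * a * k)%g)%:M.
Proof.
by move=> Kk; rewrite /act_coef scalar_mxC -mulmxA (rhoV S Kk) mulmx1.
Qed.

Lemma NKA1 : NKA D 1%g.
Proof. by split=> [|a]; [exact: (@K1 _ _ _ _ D)|rewrite mul1g invg1 mulg1]. Qed.

End WeylInvariance.

(** * Weyl invariance of the operator H *)

Section HamiltonianInvariance.
Variables (R : realType) (N : nat) (G : lieGroup R N) (g : lieAlgebra G).
Variables (D : cartanData g) (S : repData D) (E : rootData D).
Local Notation C := R[i].
Local Notation rdual := 'Hom(subvs_of (aR D), R^o).
Local Notation x_ := (tnth (xb D)).
Local Notation MV := 'M[C]_(dimV S).
Local Notation dop := (dop S).
Local Notation rho := (rho_diag S).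
Local Notation rho_l := (rho_l S).
Local Notation rho_r := (rho_r S).
Local Notation xi := (xi (D := D)).
Local Notation cothG := (cothG (D := D)).
Local Notation inner := (inner D).
Implicit Types (P Q : dop) (q : G -> MV) (k : G).

Lemma inner_Ad k y z : K D k -> inner (Ad g k y) (Ad g k z) = inner y z.
Proof.
move=> Kk; rewrite /Defs.inner (Ad_theta Kk); congr (- _).
have := AdC_B g k (cplx y) (cplx (theta D z)).
by rewrite !AdC_cplx !killingC_cplx => -[].
Qed.

Lemma inner_xb i j : inner (x_ i) (x_ j) = (i == j)%:R.
Proof. exact: xb_orthonormal. Qed.

Lemma inner_parseval y z : z \in aR D -> inner y z = \sum_j inner y (x_ j) * inner z (x_ j).
Proof.
move=> za; rewrite -[in LHS](acoordK za) innerC /acomb.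
rewrite (lin_sum (V := R^o) (inner_linear D y)); apply: eq_bigr => j _.
rewrite (linZ (V := R^o) (inner_linear D y)) mxE innerC /GRing.scale /=.
by rewrite mulrC [inner (x_ j) y]innerC.
Qed.

Lemma smooth_sect0 : smooth_sect (S := S) (fun=> 0).
Proof.
apply/smooth_sectP; split=> [a _ X _|i]; first by rewrite mulmx0.
split=> k.
  by apply: (Ck_ext (@open_areg _ _ _ _ D) _ (Ck_cst k _ (0 : R^o))) => u _; rewrite mxE.
by apply: (Ck_ext (@open_areg _ _ _ _ D) _ (Ck_cst k _ (0 : R^o))) => u _; rewrite mxE.
Qed.

Lemma smooth_sect_lin (I : Type) (r : seq I) (c : I -> R) (F : I -> sect S) :
  (forall i, smooth_sect (F i)) ->
  smooth_sect (fun a => \sum_(i <- r) (c i)%:C%C *: F i a).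
Proof.
move=> sF; elim: r => [|i r IH].
  by apply: (smooth_sect_ext _ smooth_sect0) => a _; rewrite big_nil.
apply: (smooth_sect_ext _ (smooth_sectD (@smooth_sectZ _ _ _ _ _ _ (fun=> c i) _ _ (sF i)) IH)).
  by move=> a _; rewrite big_cons.
by move=> k; exact: Ck_cst.
Qed.

Lemma partial_lin (I : Type) (r : seq I) (c : I -> R) (F : I -> sect S) h a :
  (forall i, smooth_sect (F i)) -> h \in aR D -> Areg D a ->
  partial h (fun a => \sum_(i <- r) (c i)%:C%C *: F i a) a =
  \sum_(i <- r) (c i)%:C%C *: partial h (F i) a.
Proof.
move=> sF ha Aa; elim: r => [|i r IH].
  rewrite big_nil (@partial_ext _ _ _ _ _ _ _ (fun=> 0) _ _ _ ha Aa); last by move=> b _; rewrite big_nil.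
  by apply/colP => i; rewrite !mxE; exact: cderive_cst.
have scal : smooth (@areg _ _ _ _ D) (fun u => (fun=> c i) (aexp u) : R^o) by move=> k; exact: Ck_cst.
rewrite big_cons -IH (@partial_ext _ _ _ _ _ _ _
  (fun a => (fun a => (c i)%:C%C *: F i a) a + \sum_(i <- r) (c i)%:C%C *: F i a) _ _ _ ha Aa); last first.
  by move=> b _; rewrite big_cons.
rewrite (partialD (smooth_sectZ scal (sF i)) (smooth_sect_lin r c sF) ha Aa); congr (_ + _).
have [v hv] := acomb_surj ha; have [u eu] := Areg_surj Aa; rewrite eu in Aa *; rewrite hv.
rewrite (@partialZ _ _ _ _ _ _ (fun=> c i) _ _ _ (sF i) Aa); last exact: differentiable_cst.
by rewrite diff_cst scale0r add0r.
Qed.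

Lemma partial_sum_h (I : Type) (r : seq I) (c : I -> R) (h : I -> 'rV[R]_N) f a :
  smooth_sect (S := S) f -> (forall i, h i \in aR D) -> Areg D a ->
  partial (\sum_(i <- r) c i *: h i) f a = \sum_(i <- r) (c i)%:C%C *: partial (h i) f a.
Proof.
move=> sf ha Aa; rewrite (partial_comb sf _ Aa); last first.
  by apply: memv_suml => i _; rewrite memvZ.
transitivity (\sum_j \sum_(i <- r) ((c i)%:C%C * (inner (h i) (x_ j))%:C%C) *: partial (x_ j) f a).
  apply: eq_bigr => j _; rewrite (lin_sum (V := R^o) (inner_linear D _)) rmorph_sum scaler_suml.
  by apply: eq_bigr => i _; rewrite (linZ (V := R^o) (inner_linear D _)) rmorphM.
rewrite exchange_big; apply: eq_bigr => i _; rewrite (partial_comb sf (ha i) Aa) scaler_sumr.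
by apply: eq_bigr => j _; rewrite scalerA.
Qed.

Definition Lap : dop := \sum_(j < rk D) iter 2 (partial (x_ j)).

(** The vectors Ad_k x_j are again orthonormal in [aR]. Parseval, applied to the images of x_l and
    x_m under the inverse of Ad_k, collapses the double sum of second derivatives. *)
Lemma Lap_Ad k : NKA D k ->
  dop_eq (\sum_(j < rk D) iter 2 (partial (Ad g k (x_ j)))) Lap.
Proof.
move=> Nk f sf a Aa; have [Kk _] := Nk; rewrite /Lap.
apply: (etrans (dop_sumE _ (fun j => iter 2 (partial (Ad g k (x_ j)))) f a)).
apply/esym/(etrans (dop_sumE _ (fun j => iter 2 (partial (x_ j))) f a))/esym.
have ha j : Ad g k (x_ j) \in aR D by apply: NKA_aR Nk _; exact: xb_aR.
have E1 j : partial (Ad g k (x_ j)) (partial (Ad g k (x_ j)) f) a =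
    \sum_l \sum_m (inner (Ad g k (x_ j)) (x_ l) * inner (Ad g k (x_ j)) (x_ m))%:C%C *:
      partial (x_ l) (partial (x_ m) f) a.
  rewrite (partial_comb (smooth_sect_partial sf (ha j)) (ha j) Aa); apply: eq_bigr => l _.
  rewrite (@partial_ext _ _ _ _ _ _ _ (fun a => \sum_m (inner (Ad g k (x_ j)) (x_ m))%:C%C *:
     partial (x_ m) f a) _ _ _ (xb_aR l) Aa); last first.
    by move=> b Ab; rewrite (partial_comb sf (ha j) Ab).
  rewrite (partial_lin _ _ _ (xb_aR l) Aa); last first.
    by move=> m; exact: smooth_sect_partial sf (xb_aR m).
  by rewrite scaler_sumr; apply: eq_bigr => m _; rewrite scalerA -rmorphM.
transitivity (\sum_j \sum_l \sum_m
    (inner (Ad g k (x_ j)) (x_ l) * inner (Ad g k (x_ j)) (x_ m))%:C%C *: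
      partial (x_ l) (partial (x_ m) f) a); first by apply: eq_bigr => j _; exact: E1.
rewrite exchange_big; apply: eq_bigr => l _; rewrite exchange_big.
have E2 m : \sum_j inner (Ad g k (x_ j)) (x_ l) * inner (Ad g k (x_ j)) (x_ m) = (l == m)%:R.
  have AV y : y \in aR D -> Ad g k^-1%g y \in aR D by apply: NKA_aR; exact: NKA_inv.
  have EA j y : inner (Ad g k (x_ j)) y = inner (Ad g k^-1%g y) (x_ j).
    by rewrite -[y in LHS](AdVK g k) (inner_Ad _ _ Kk) innerC.
  transitivity (inner (Ad g k^-1%g (x_ l)) (Ad g k^-1%g (x_ m))); last first.
    by rewrite (inner_Ad _ _ (K_inv Kk)) inner_xb.
  apply: (etrans _ (esym (inner_parseval _ (AV _ (xb_aR m))))); apply: eq_bigr => j _.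
  exact: (congr2 *%R (EA j (x_ l)) (EA j (x_ m))).
transitivity (\sum_m (l == m)%:R *: partial (x_ l) (partial (x_ m) f) a).
  apply: eq_bigr => m _.
  have E3 : (l == m)%:R = \sum_j (inner (Ad g k (x_ j)) (x_ l) * inner (Ad g k (x_ j)) (x_ m))%:C%C.
    by rewrite -rmorph_sum E2 rmorph_nat.
  by rewrite E3 scaler_suml.
rewrite (bigD1 l) // big1.
  by apply: (etrans (addr0 _)); rewrite eqxx scale1r.
by move=> m ml; rewrite eq_sym (negPf ml) scale0r.
Qed.

Lemma W_act_Lap k : NKA D k -> W_act k Lap Lap.
Proof.
move=> Nk; have [Kk _] := Nk.
have H := W_act_sum (k := k) (r := index_enum 'I_(rk D)) (fun j _ =>
  W_act_partial k 2 j (REndM_cst (@EndM_scalar _ _ _ _ _ S 1))).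
apply: (W_act_ext _ _ H) => [f sf a Aa|]; first (
  apply: (etrans (dop_sumE _ _ f a)); apply/esym/(etrans (dop_sumE _ _ f a))/esym;
  by apply: eq_bigr => j _; exact: mul1mx).
apply: dop_eq_trans (Lap_Ad Nk) => f sf a Aa.
apply: (etrans (dop_sumE _ _ f a)); apply/esym/(etrans (dop_sumE _ _ f a))/esym.
apply: eq_bigr => j _; have E1 := @act_coef_scalar _ _ _ _ _ S k (fun=> 1) a Kk.
by rewrite -[LHS]/(act_coef k (fun=> 1%:M) a *m iter 2 (partial (Ad g k (x_ j))) f a) E1 mul1mx.
Qed.

Lemma xi_act mu a k : NKA D k -> Areg D a -> xi mu (k^-1 * a * k)%g = xi (wact k mu) a.
Proof. by move=> Nk [Aa _]; exact: xi_wact. Qed.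

Lemma wactN k (mu : rdual) : wact k (- mu) = - wact k mu.
Proof. by apply/lfunP => h; rewrite opp_lfunE !wactE opp_lfunE. Qed.

Lemma cothG_act mu a k : NKA D k -> Areg D a ->
  cothG mu (k^-1 * a * k)%g = cothG (wact k mu) a.
Proof. by move=> Nk Aa; rewrite !cothGE !(xi_act _ Nk Aa) wactN. Qed.

Lemma Sigma_neq0 (mu : rdual) : Sigma D mu -> mu != 0.
Proof. by case. Qed.

Definition drift (mu : rdual) : dop :=
  mult (fun a => ((2^-1 * ((mtp mu)%:R * cothG mu a))%:C%C)%:M) \o partial (tvec E mu).

(** [term_op] only knows derivatives along a given family, so other directions are spread over it.
    Taking for [h] the basis or its image under Ad k serves both sides of [W_act]. *)
Lemma mult_partial_comb (c : G -> R) (w : 'I_(rk D) -> R) (h : 'I_(rk D) -> 'rV[R]_N) :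
  (forall j, h j \in aR D) ->
  dop_eq (\sum_j (mult (fun a => ((c a * w j)%:C%C)%:M) \o iter 1 (partial (h j))) : dop)
    (mult (fun a => ((c a)%:C%C)%:M) \o partial (\sum_j w j *: h j)).
Proof.
move=> ha f sf a Aa; apply: (etrans (dop_sumE _ _ f a)).
rewrite -[RHS]/((((c a)%:C%C)%:M : MV) *m partial (\sum_j w j *: h j) f a).
rewrite (partial_sum_h _ _ sf ha Aa) mul_scalar_mx scaler_sumr; apply: eq_bigr => j _.
rewrite -[LHS]/((((c a * w j)%:C%C)%:M : MV) *m partial (h j) f a).
by rewrite mul_scalar_mx scalerA -rmorphM.
Qed.

(** Equivariance of [tvec] means that the same coordinates [w] describe the vector of [mu] in the
    basis x_j and that of [wact k mu] in the basis Ad_k x_j. *)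
Lemma W_act_drift k mu : NKA D k -> Sigma D mu ->
  W_act k (drift mu) (drift (wact k mu)).
Proof.
move=> Nk Smu; have [Kk _] := Nk.
pose c mu a := 2^-1 * ((mtp mu)%:R * cothG mu a).
pose w j := inner (tvec E mu) (x_ j).
have cr : calRr D (c mu).
  by apply: calRr_mul (calRr_cst _ _) _; apply: calRr_mul (calRr_cst _ _) _; exact: calRr_coth.
have cwr j : calRr D (fun a => c mu a * w j) by apply: calRr_mul cr (calRr_cst _ _).
have tE : tvec E mu = \sum_j w j *: x_ j.
  rewrite -[LHS](acoordK (tvec_in E mu)).
  by apply: eq_bigr => j _; rewrite mxE.
have AtE : tvec E (wact k mu) = \sum_j w j *: Ad g k (x_ j).
  rewrite (tvec_wact _ _ Nk) [in LHS]tE linear_sum.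
  by apply: eq_bigr => j _; rewrite linearZ.
have ha j : Ad g k (x_ j) \in aR D by apply: NKA_aR Nk _; exact: xb_aR.
have H := W_act_sum (k := k) (r := index_enum 'I_(rk D)) (fun j _ =>
  W_act_partial k 1 j (REndM_smult S (cwr j))).
apply: (W_act_ext _ _ H).
  by rewrite /drift tE; apply: mult_partial_comb => j; exact: xb_aR.
rewrite /drift AtE; apply: dop_eq_trans (mult_partial_comb (c (wact k mu)) w ha).
move=> f sf a Aa; apply: (etrans (dop_sumE _ _ f a)).
apply/esym/(etrans (dop_sumE _ _ f a))/esym; apply: eq_bigr => j _.
have E1 := @act_coef_scalar _ _ _ _ _ S k (fun a => (c mu a * w j)%:C%C) a Kk.
rewrite -[LHS]/(act_coef k (fun a => ((c mu a * w j)%:C%C)%:M) a *m iter 1 (partial (Ad g k (x_ j))) f a) E1.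
by rewrite /c (cothG_act _ Nk Aa) -(mtp_wact Nk (Sigma_neq0 Smu)).
Qed.

Lemma W_act_Omega k : NKA D k ->
  W_act k (mult (fun=> Omega_m E rho_r)) (mult (fun=> Omega_m E rho_r)).
Proof.
move=> Nk; have := W_act_mult k (REndM_cst (EndM_Omega E (kdiff_r S))).
apply: W_act_ext; first exact: dop_eq_refl.
by move=> f sf a Aa; rewrite /mult /act_coef (Omega_conj E (kdiff_r S) Nk).
Qed.

Definition spin_coef (mu : rdual) (a : G) : MV :=
  (((xi mu a - xi (- mu) a) ^- 2)%:C%C) *:
    (Upsilon E rho_l mu + Upsilon E rho_r mu +
     (xi mu a + xi (- mu) a)%:C%C *: upsilon E rho_l rho_r mu).

Lemma spin_lin (s t : R) (X Y Z : MV) :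
  (-1 * s)%:C%C *: X + (-1 * s)%:C%C *: Y + (-1 * (s * t))%:C%C *: Z =
  - (s%:C%C *: (X + Y + t%:C%C *: Z)).
Proof. by rewrite !mulN1r !rmorphN rmorphM /= !scaleNr !scalerDr scalerA -!opprD. Qed.

Lemma spin_conj (s t : C) (P Q X Y Z X' Y' Z' : MV) :
  P *m X *m Q = X' -> P *m Y *m Q = Y' -> P *m Z *m Q = Z' ->
  P *m (s *: (X + Y + t *: Z)) *m Q = s *: (X' + Y' + t *: Z').
Proof.
move=> <- <- <-.
by rewrite -scalemxAr -scalemxAl !mulmxDr !mulmxDl -scalemxAr -scalemxAl.
Qed.

Lemma REndM_spin mu : Sigma D mu -> REndM (fun a => - spin_coef mu a).
Proof.
move=> Smu; have mu0 := Sigma_neq0 Smu.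
have c1 := calRr_mul (calRr_cst D (-1)) (calRr_sinh2 Smu).
have c2 := calRr_mul (calRr_cst D (-1)) (calRr_cosh_sinh2 Smu).
have q1 := REndM_scale c1 (EndM_upsilon E (kdiff_l S) (kdiff_l S) mu0).
have q2 := REndM_scale c1 (EndM_upsilon E (kdiff_r S) (kdiff_r S) mu0).
have q3 := REndM_scale c2 (EndM_upsilon E (kdiff_l S) (kdiff_r S) mu0).
apply: REndM_ext (REndM_add (REndM_add q1 q2) q3) => a _.
exact: spin_lin.
Qed.

Definition spin (mu : rdual) : dop := mult (fun a => - spin_coef mu a).

Lemma W_act_spin k mu : NKA D k -> Sigma D mu ->
  W_act k (spin mu) (spin (wact k mu)).
Proof.
move=> Nk Smu; have mu0 := Sigma_neq0 Smu.
have := W_act_mult k (REndM_spin Smu).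
apply: W_act_ext; first exact: dop_eq_refl.
move=> f sf a Aa; rewrite /spin /mult /act_coef; congr (_ *m _).
rewrite mulmxN mulNmx; congr (- _).
rewrite /spin_coef !(xi_act _ Nk Aa) wactN.
have ll : rho k *m Upsilon E rho_l mu *m rho k^-1%g = Upsilon E rho_l (wact k mu).
  exact: (upsilon_conj E (kdiff_l S) (kdiff_l S) Nk mu0).
have rr : rho k *m Upsilon E rho_r mu *m rho k^-1%g = Upsilon E rho_r (wact k mu).
  exact: (upsilon_conj E (kdiff_r S) (kdiff_r S) Nk mu0).
exact: (spin_conj _ _ ll rr (upsilon_conj E (kdiff_l S) (kdiff_r S) Nk mu0)).
Qed.

Definition Ham : dop :=
  Lap + \sum_(mu <- Sgs D) drift mu + mult (fun=> Omega_m E rho_r) +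
  \sum_(mu <- Sgs D) spin mu.

Lemma W_act_Sgs k (P : rdual -> dop) : NKA D k ->
  (forall mu, Sigma D mu -> W_act k (P mu) (P (wact k mu))) ->
  W_act k (\sum_(mu <- Sgs D) P mu) (\sum_(mu <- Sgs D) P mu).
Proof.
move=> Nk HP.
have E1 : \sum_(mu <- Sgs D) P mu = \sum_(mu <- Sgs D) P (wact k mu).
  by rewrite -(big_map (wact k) xpredT P); apply/perm_big; rewrite perm_sym; exact: perm_Sgs.
by rewrite [X in W_act _ _ X]E1; apply: W_act_sum => mu /mem_Sgs; exact: HP.
Qed.

Lemma W_act_Ham k : NKA D k -> W_act k Ham Ham.
Proof.
move=> Nk; apply: W_act_add; last first.
  by apply: (W_act_Sgs Nk) => mu; exact: W_act_spin.
apply: W_act_add; last exact: W_act_Omega.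
apply: W_act_add; first exact: W_act_Lap.
by apply: (W_act_Sgs Nk) => mu; exact: W_act_drift.
Qed.

Lemma H_opE : dop_eq (H_op E) Ham.
Proof.
move=> f sf a Aa; rewrite /H_op /Ham !sum_Sgs.
rewrite -[LHS]/(Lap f a + 2^-1 *: (\sum_(mu <- Sgs D) _) f a + _ - (\sum_(mu <- Sgs D) _) f a).
rewrite -[RHS]/(Lap f a + (\sum_(mu <- Sgs D) drift mu) f a + _ + (\sum_(mu <- Sgs D) spin mu) f a).
congr (_ + _ + _ + _).
  apply: (etrans (congr1 _ (dop_sumE _ _ f a))).
  apply/esym/(etrans (dop_sumE _ _ f a))/esym; rewrite scaler_sumr; apply: eq_bigr => mu _.
  rewrite /drift /smult /mult /comp !mul_scalar_mx scalerA; congr (_ *: _).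
  by rewrite [in RHS]rmorphM /= rmorphV ?unitfE ?pnatr_eq0 //= rmorph_nat.
apply: (etrans (congr1 _ (dop_sumE _ _ f a))).
apply/esym/(etrans (dop_sumE _ _ f a))/esym; rewrite -sumrN; apply: eq_bigr => mu _.
by rewrite -[RHS]/(- spin_coef mu a *m f a) mulNmx.
Qed.

End HamiltonianInvariance.

(** * Root sums with hyperbolic cotangents *)

Section RootSums.
Variables (R : realType) (N : nat) (G : lieGroup R N) (g : lieAlgebra G).
Variables (D : cartanData g) (E : rootData D).
Local Notation C := R[i].
Local Notation aR := (aR D).
Local Notation rdual := 'Hom(subvs_of aR, R^o).
Local Notation VC := 'rV[C]_N.
Local Notation cothG := (cothG (D := D)).
Local Notation inner := (inner D).
Local Notation herm := (herm D).

(** The addition theorem of coth; with p = exp x and q = exp y it becomes an identity of rational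
    functions. *)
Lemma cothf_cyclic (x y z : R) : x != 0 -> y != 0 -> z != 0 -> x + y + z = 0 ->
  cothf x * cothf y + cothf y * cothf z + cothf z * cothf x = -1.
Proof.
move=> /sinh_neq0 x0 /sinh_neq0 y0 /sinh_neq0 z0 xyz.
have zE : z = - (x + y) by apply/eqP; rewrite -addr_eq0 addrC xyz.
rewrite /cothf.
have E1 : expR x * expR (- x) = 1 by rewrite -expRD subrr expR0.
have E2 : expR y * expR (- y) = 1 by rewrite -expRD subrr expR0.
have E3 : expR z = expR (- x) * expR (- y) by rewrite zE opprD expRD.
have E4 : expR (- z) = expR x * expR y by rewrite zE opprK expRD.
rewrite E3 E4 in z0 *.
have p0 : expR x != 0 by rewrite gt_eqF // expR_gt0.
have q0 : expR y != 0 by rewrite gt_eqF // expR_gt0.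
have {}E1 : expR (- x) = (expR x)^-1 by apply: (mulfI p0); rewrite E1 divff.
have {}E2 : expR (- y) = (expR y)^-1 by apply: (mulfI q0); rewrite E2 divff.
rewrite E1 E2 in x0 y0 z0 *; move: (expR x) (expR y) p0 q0 x0 y0 z0 {E1 E2 E3 E4}.
move=> p q p0 q0 x0 y0 z0.
have sq0 (r : R) : r != 0 -> r - r^-1 != 0 -> r ^+ 2 - 1 != 0.
  by move=> r0; rewrite -(mulfV r0) expr2 -mulrBr => s0; rewrite mulf_neq0.
have x1 := sq0 _ p0 x0; have y1 := sq0 _ q0 y0.
have z1 : (p * q) ^+ 2 - 1 != 0.
  apply: sq0; first by rewrite mulf_neq0.
  by rewrite -oppr_eq0 opprB invfM.
field; rewrite p0 q0 x1 y1 andbT.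
by rewrite -oppr_eq0 mulNr opprB -expr2.
Qed.

Variables (F : 'I_N -> VC) (al : 'I_N -> 'Hom(subvs_of (hC D), C^o)).
Hypothesis bF : cartan_basis F al.
Local Notation lam i := (resa (al i)).

Lemma sum_lam (c : rdual -> R) : c 0 = 0 ->
  \sum_i c (lam i) = \sum_(mu <- Sgs D) (mtp mu)%:R * c mu.
Proof.
move=> c0; rewrite -(sum_Sgs (fun mu => (mtp mu)%:R * c mu)).
transitivity (\sum_(mu \in Sigma D) (c mu *+ mtp mu)); last first.
  by apply: eq_fsbigr => mu _; rewrite mulr_natl.
rewrite (sum_Sigma bF) [RHS]big_mkcond; apply: eq_bigr => i _.
by case: eqP => // ->; rewrite c0.
Qed.

Lemma sum_lamN (c : rdual -> R) : \sum_i c (lam i) = \sum_i c (- lam i).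
Proof.
apply: complexI; have eF := cartan_eigenbasis bF.
have := change_eigenbasis_scalar (fun nu => (c nu)%:C%C)
  (s := fun X Y => herm Y X) _ _ _ eF (eigenbasis_sg eF).
have cnt (F' : 'I_N -> VC) (nu : 'I_N -> rdual) : eigenbasis F' nu ->
    \sum_i (c (nu i))%:C%C * herm (F' i) (F' i) = (\sum_i c (nu i))%:C%C.
  move=> [oF _]; rewrite rmorph_sum; apply: eq_bigr => i _.
  by rewrite oF eqxx mulr1.
rewrite (cnt _ _ eF) (cnt _ _ (eigenbasis_sg eF)); apply => [X X' Y|a X Y|X a Y Y'].
- by rewrite (HDr (herm_lin D) (herm_conj D)).
- by rewrite (HZr (herm_lin D) (herm_conj D)).
- by rewrite (HDl (herm_lin D)) (HZl (herm_lin D)).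
Qed.

Lemma ip_inner (mu nu : rdual) : ip E mu nu = inner (tvec E mu) (tvec E nu).
Proof.
rewrite /inner /Defs.inner (aR_theta (tvec_in E nu)).
rewrite (linN (V := R^o) (@killing_linr _ _ _ g (tvec E mu))) opprK killingRC.
by rewrite -[in RHS](vsprojK (tvec_in E mu)) tvecP.
Qed.

Lemma inner_tvec (mu : rdual) h : h \in aR -> inner (tvec E mu) h = mu (vsproj aR h).
Proof.
move=> ha; rewrite /inner /Defs.inner (aR_theta ha).
rewrite (linN (V := R^o) (@killing_linr _ _ _ g (tvec E mu))) opprK.
by rewrite -[in LHS](vsprojK ha) tvecP.
Qed.

(** A positive root contributes through itself and through its negative, and rho carries a factor
    1/2: hence 4. *)
Lemma sum_sign_roots (h0 : subvs_of aR) :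
  (forall mu, restricted_root g mu -> mu h0 != 0) ->
  posroots D = [set mu | restricted_root g mu /\ 0 < mu h0] ->
  \sum_i Num.sg (lam i h0) *: lam i = 4 *: Defs.rho D.
Proof.
move=> h0P pE; apply/lfunP => h; rewrite sum_lfunE scale_lfunE.
have rE : Defs.rho D h = 2^-1 * \sum_i (if 0 < lam i h0 then lam i h else 0).
  rewrite /Defs.rho scale_lfunE; congr (_ * _).
  have -> : posroots D = Sigma D `&` [set mu | 0 < mu h0] by rewrite pE.
  rewrite fsbig_mkcondr sum_Sgs sum_lfunE.
  rewrite (sum_lam (c := fun mu => if 0 < mu h0 then mu h else 0)); last first.
    by rewrite zero_lfunE ltxx.
  apply: eq_bigr => mu _.
  rewrite (_ : (mu \in _) = (0 < mu h0)); last by apply/idP/idP; rewrite in_setE.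
  by case: ifP => _; rewrite ?scale_lfunE ?zero_lfunE ?mulr0.
rewrite rE; transitivity (\sum_i (if 0 < lam i h0 then lam i h else 0) +
   \sum_i (if 0 < - lam i h0 then - lam i h else 0)).
  rewrite -big_split; apply: eq_bigr => i _; rewrite scale_lfunE /GRing.scale /= oppr_gt0.
  by case: (ltgtP (lam i h0) 0) => [l0|l0|->];
    rewrite ?(ltr0_sg l0) ?(gtr0_sg l0) ?sgr0 ?mulN1r ?mul1r ?mul0r ?addr0 ?add0r.
have <- : \sum_i (if 0 < lam i h0 then lam i h else 0) =
  \sum_i (if 0 < - lam i h0 then - lam i h else 0).
  rewrite (sum_lamN (fun mu => if 0 < mu h0 then mu h else 0)).
  by apply: eq_bigr => i _; rewrite !opp_lfunE.
by rewrite /GRing.scale /=; lra.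
Qed.

Lemma coth_root_sum a : Areg D a ->
  \sum_(mu <- Sgs D) \sum_(nu <- Sgs D)
    ((mtp mu)%:R * cothG mu a) * ((mtp nu)%:R * cothG nu a) * ip E mu nu =
  16 * inner (tvec E (Defs.rho D)) (tvec E (Defs.rho D)) +
  2 * \sum_(mu <- Sgs D) (mtp mu)%:R * (cothG mu a ^+ 2 - 1) *
    ((mtp mu)%:R + 2 * (mtp (mu *+ 2))%:R) * ip E mu mu.
Proof.
move=> Aa; have [u eu] := Areg_surj Aa; rewrite eu in Aa *.
have u0 : forall mu, Sigma D mu -> ell mu u != 0 by apply/Areg_aexp.
have [h0 [h0P pE]] := posrootsP D.
pose c mu := cothf (ell mu u); pose e (mu : rdual) := Num.sg (mu h0).
have c0 : c 0 = 0 by rewrite /c /ell zero_lfunE /cothf oppr0 subrr invr0 mulr0.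
have e0 : e 0 = 0 by rewrite /e zero_lfunE sgr0.
have cN mu : c (- mu) = - c mu by rewrite /c /ell opp_lfunE cothfN.
have eN mu : e (- mu) = - e mu by rewrite /e opp_lfunE sgrN.
have cE mu : cothG mu (aexp u) = c mu by rewrite cothG_aexp.
have lamS i : lam i != 0 -> Sigma D (lam i) by move=> li; apply/(SigmaP bF); split=> //; exists i.
have cyc i j k : lam i != 0 -> lam j != 0 -> lam k != 0 -> lam i + lam j + lam k = 0 ->
    c (lam i) * c (lam j) + c (lam j) * c (lam k) + c (lam k) * c (lam i) =
    e (lam i) * e (lam j) + e (lam j) * e (lam k) + e (lam k) * e (lam i).
  move=> li lj lk lijk.
  have sum0 x : lam i x + lam j x + lam k x = 0 by rewrite -!add_lfunE lijk zero_lfunE.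
  rewrite /c cothf_cyclic; try by apply: u0; exact: lamS.
    have := h0P _ (lamS _ li); have := h0P _ (lamS _ lj); have := h0P _ (lamS _ lk).
    have := sum0 h0; rewrite /e; move: (lam i h0) (lam j h0) (lam k h0) => x y z xyz.
    (* Three nonzero reals with sum 0 are not all of one sign, so the cyclic sum of their signs is
       -1 as well. *)
    by case: (sgrP x) => ?; case: (sgrP y) => ?; case: (sgrP z) => ? //; lra.
  exact: sum0.
have TI := trace_identity bF E (c := fun mu => (c mu)%:C%C) (e := fun mu => (e mu)%:C%C).
have {TI} TR : \sum_i \sum_j c (lam i) * c (lam j) * ip E (lam i) (lam j) -
    \sum_i \sum_j e (lam i) * e (lam j) * ip E (lam i) (lam j) =
    2 * \sum_i (c (lam i) ^+ 2 - e (lam i) ^+ 2) *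
    (#|[pred j | lam j == lam i]| + 2 * #|[pred j | lam j == lam i *+ 2]|)%:R *
    ip E (lam i) (lam i).
  apply: complexI; rewrite rmorphB rmorphM rmorph_nat !rmorph_sum.
  apply: (etrans _ (etrans (TI _ _ _) _)) => [|mu|mu|i j k li lj lk lijk|].
  - by congr (_ - _); apply: eq_bigr => i _; rewrite rmorph_sum; apply: eq_bigr => j _; rewrite !rmorphM.
  - by rewrite cN rmorphN.
  - by rewrite eN rmorphN.
  - by rewrite -!rmorphM -!rmorphD cyc.
  - congr (_ * _); apply: eq_bigr => i _; rewrite [in RHS]rmorphM [in RHS]rmorphM.
    by rewrite [in RHS]rmorphB [in RHS]rmorphXn [in RHS]rmorphXn rmorph_nat.
have sumsum : \sum_i \sum_j c (lam i) * c (lam j) * ip E (lam i) (lam j) =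
   \sum_(mu <- Sgs D) \sum_(nu <- Sgs D)
    ((mtp mu)%:R * c mu) * ((mtp nu)%:R * c nu) * ip E mu nu.
  rewrite (sum_lam (c := fun mu => \sum_j c mu * c (lam j) * ip E mu (lam j))); last first.
    by apply: big1 => j _; rewrite c0 !mul0r.
  apply: eq_bigr => mu _.
  rewrite (sum_lam (c := fun nu => c mu * c nu * ip E mu nu)); last first.
    by rewrite c0 mulr0 mul0r.
  by rewrite mulr_sumr; apply: eq_bigr => nu _; ring.
have ee : \sum_i \sum_j e (lam i) * e (lam j) * ip E (lam i) (lam j) =
   16 * inner (tvec E (Defs.rho D)) (tvec E (Defs.rho D)).
  have T4 : \sum_i e (lam i) *: tvec E (lam i) = 4 *: tvec E (Defs.rho D).
    rewrite -(linZ (tvec_linear E)) -(sum_sign_roots h0P pE) (lin_sum (tvec_linear E)).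
    by apply: eq_bigr => i _; rewrite (linZ (tvec_linear E)).
  transitivity (inner (\sum_i e (lam i) *: tvec E (lam i)) (\sum_i e (lam i) *: tvec E (lam i))).
    rewrite (lin_sum (V := R^o) (inner_linear D _)); apply: eq_bigr => i _.
    rewrite (linZ (V := R^o) (inner_linear D _)) innerC (lin_sum (V := R^o) (inner_linear D _)).
    rewrite scaler_sumr; apply: eq_bigr => j _.
    by rewrite (linZ (V := R^o) (inner_linear D _)) ip_inner innerC /GRing.scale /= mulrA.
  rewrite T4 (linZ (V := R^o) (inner_linear D _)) innerC (linZ (V := R^o) (inner_linear D _)).
  by rewrite /GRing.scale /=; lra.
rewrite -ee -{1}(eq_bigr _ (fun mu _ => eq_bigr _ (fun nu _ => erefl))).
under eq_bigr do under eq_bigr do rewrite !cE.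
rewrite -sumsum; apply/eqP; rewrite addrC -subr_eq; apply/eqP; rewrite TR; congr (_ * _).
rewrite (sum_lam (c := fun mu => (c mu ^+ 2 - e mu ^+ 2) *
    (#|[pred j | lam j == mu]| + 2 * #|[pred j | lam j == mu *+ 2]|)%:R * ip E mu mu)); last first.
  by rewrite c0 e0 subrr !mul0r.
rewrite !big_seq; apply: eq_bigr => mu /mem_Sgs Smu.
have mu0 := Sigma_neq0 Smu.
have mu20 : mu *+ 2 != 0.
  apply/eqP => H; case/eqP: mu0; apply/lfunP => h.
  have := congr1 (fun l : rdual => l h : R) H; rewrite mulr2n add_lfunE !zero_lfunE => /eqP.
  by rewrite -mulr2n mulrn_eq0 /= => /eqP.
rewrite cE -!(mtpE bF) // natrD natrM.
have -> : e mu ^+ 2 = 1 by rewrite sqr_sg h0P.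
by ring.
Qed.

End RootSums.

(** * Linear combinations of coth as coefficient functions *)

Section CothSums.
Variables (R : realType) (N : nat) (G : lieGroup R N) (g : lieAlgebra G).
Variable D : cartanData g.
Local Notation aR := (aR D).
Local Notation rdual := 'Hom(subvs_of aR, R^o).
Local Notation cothG := (cothG (D := D)).

Definition coth_sum (w : rdual -> R) (a : G) : R := \sum_(mu <- Sgs D) w mu * cothG mu a.

Lemma coth_sum_aexp w u : coth_sum w (aexp u) = \sum_(mu <- Sgs D) w mu * acoth mu u.
Proof. by apply: eq_bigr => mu _; rewrite cothG_aexp. Qed.

Lemma coth_sum_smooth w : smooth (@areg _ _ _ _ D) (fun u => coth_sum w (aexp u) : R^o).
Proof.
move=> k; have oU := @open_areg _ _ _ _ D.
have H (r : seq rdual) : (forall mu, mu \in r -> Sigma D mu) ->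
    Ck k (@areg _ _ _ _ D) (fun u => \sum_(mu <- r) w mu * acoth mu u : R^o).
  elim: r => [|mu r IH] Hr.
    by apply: (Ck_ext oU _ (Ck_cst k _ (0 : R^o))) => u _; rewrite big_nil.
  have Smu : Sigma D mu by apply: Hr; rewrite mem_head.
  have Hr' : forall nu, nu \in r -> Sigma D nu by move=> nu nur; apply: Hr; rewrite inE nur orbT.
  apply: (Ck_ext oU _ (Ck_add oU (Ck_scale oU (Ck_cst k _ (w mu : R^o)) (acoth_smooth Smu k)) (IH Hr'))).
  by move=> u _; rewrite big_cons.
apply: (Ck_ext oU _ (H (Sgs D) (fun mu => elimT (mem_Sgs mu)))) => u _.
by rewrite coth_sum_aexp.
Qed.

Lemma coth_sum_diff w u : areg u ->
  differentiable (fun u => coth_sum w (aexp u) : R^o) u /\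
  forall v, 'd (fun u => coth_sum w (aexp u) : R^o) u v =
    \sum_(mu <- Sgs D) w mu * (ell mu v * (1 - acoth mu u ^+ 2)).
Proof.
move=> Uu.
have -> : (fun u => coth_sum w (aexp u) : R^o) =
    (fun u => \sum_(mu <- Sgs D) w mu * acoth mu u : R^o).
  by apply/funext => z; exact: coth_sum_aexp.
have : forall mu, mu \in Sgs D -> Sigma D mu by move=> mu /mem_Sgs.
elim: (Sgs D) => [|mu r IH] Hr.
  have -> : (fun u => \sum_(mu <- [::]) w mu * acoth mu u : R^o) = (fun=> 0).
    by apply/funext => z; rewrite big_nil.
  split; first exact: differentiable_cst.
  by move=> v; rewrite big_nil diff_cst.
have Smu : Sigma D mu by apply: Hr; rewrite mem_head.
have Hr' : forall nu, nu \in r -> Sigma D nu by move=> nu nur; apply: Hr; rewrite inE nur orbT.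
have [dr Dr] := IH Hr'; have [dmu Dmu] := acoth_diff Smu Uu.
have E1 : (fun u => \sum_(mu <- mu :: r) w mu * acoth mu u : R^o) =
    w mu *: acoth mu + (fun u => \sum_(mu <- r) w mu * acoth mu u : R^o).
  by apply/funext => z; rewrite big_cons.
rewrite E1; split; first by apply: differentiableD => //; exact: differentiableZ.
move=> v; rewrite diffD //; last exact: differentiableZ.
rewrite -[LHS]/('d (w mu *: acoth mu) u v + 'd (fun u => \sum_(mu <- r) w mu * acoth mu u : R^o) u v).
by rewrite diffZ // Dr big_cons -[X in X + _]/(w mu * 'd (acoth mu) u v) Dmu.
Qed.

End CothSums.

(** * The gauge transform of H *)

Section GaugeComputation.
Variables (R : realType) (N : nat) (G : lieGroup R N) (g : lieAlgebra G).
Variables (D : cartanData g) (E : rootData D) (S : repData D).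
Local Notation C := R[i].
Local Notation aR := (aR D).
Local Notation rdual := 'Hom(subvs_of aR, R^o).
Local Notation x_ := (tnth (xb D)).
Local Notation MV := 'M[C]_(dimV S).
Local Notation dop := (dop S).
Local Notation xi := (xi (D := D)).
Local Notation cothG := (cothG (D := D)).
Local Notation inner := (inner D).
Local Notation Lap := (@Lap _ _ _ _ D S).
Variable Gam : dop -> dop.
Hypothesis GG : is_gauge Gam.

Lemma DM_add P Q : DM P -> DM Q -> DM (P + Q : dop).
Proof.
move=> [s [H1 H2]] [s' [H1' H2']]; exists (s ++ s'); split.
  move=> j; rewrite size_cat nth_cat => lt_j; case: ltnP => le_j; first exact: H1.
  by apply: H1'; rewrite ltn_subLR.
by rewrite big_cat; exact: (dop_eqD H2 H2').
Qed.

Lemma gauge0 : dop_eq (Gam 0) 0.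
Proof.
move=> f sf a Aa; have D0 := W_act_DM (W_act0 S 1%g).
have := gauge_add GG D0 D0 sf Aa; rewrite addr0 => H.
apply: (addrI (Gam 0 f a)); apply: (etrans (esym H)).
exact: (esym (addr0 _)).
Qed.

Lemma gauge_sum (I : eqType) (r : seq I) (P : I -> dop) : (forall i, i \in r -> DM (P i)) ->
  DM (\sum_(i <- r) P i) /\
  dop_eq (Gam (\sum_(i <- r) P i)) (\sum_(i <- r) Gam (P i)).
Proof.
elim: r => [|i r IH] Hr.
  by rewrite !big_nil; split; [exact: W_act_DM (W_act0 S 1%g)|exact: gauge0].
have [Dr Er] : DM (\sum_(i <- r) P i) /\
    dop_eq (Gam (\sum_(i <- r) P i)) (\sum_(i <- r) Gam (P i)).
  by apply: IH => j jr; apply: Hr; rewrite inE jr orbT.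
have Di : DM (P i) by apply: Hr; rewrite mem_head.
rewrite !big_cons; split.
  exact: DM_add.
apply: (dop_eq_trans (gauge_add GG Di Dr)).
by apply: (dop_eqD _ Er); exact: dop_eq_refl.
Qed.

Lemma DM_id : DM (id : dop).
Proof.
exists [:: ((fun=> 1%:M), [ffun=> 0%N])]; split=> [[|i] //= _|f sf a Aa].
  exact: REndM_cst (@EndM_scalar _ _ _ _ _ S 1).
by rewrite big_seq1 term_op0 /mult mul1mx.
Qed.

Lemma gauge_mult q : REndM q -> DM (mult q : dop) /\ dop_eq (Gam (mult q)) (mult q).
Proof.
move=> Rq; split; first exact: W_act_DM (W_act_mult 1%g Rq).
move=> f sf a Aa; have := gauge_lin GG Rq DM_id sf Aa.
rewrite -[LHS]/(Gam (mult q) f a) => ->.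
by rewrite -[RHS]/(q a *m f a) -[LHS]/(q a *m Gam id f a) (gauge_one GG sf Aa).
Qed.

Lemma DM_iter n j : DM (iter n (partial (x_ j)) : dop).
Proof.
have H := W_act_partial 1%g n j (REndM_cst (@EndM_scalar _ _ _ _ _ S 1)).
have [s [H1 H2]] := W_act_DM H; exists s; split=> // f sf a Aa.
by rewrite -(H2 f sf a Aa); exact/esym/mul1mx.
Qed.

Lemma DM_partial h : h \in aR -> DM (partial h : dop).
Proof.
move=> ha; pose w j := inner h (x_ j).
have hE : h = \sum_j w j *: x_ j.
  by rewrite -[LHS](acoordK ha); apply: eq_bigr => j _; rewrite mxE.
have cwr j : calRr D (fun a => (fun=> 1) a * w j) by apply: calRr_mul (calRr_cst _ _) (calRr_cst _ _).
have H := W_act_sum (k := 1%g) (r := index_enum 'I_(rk D)) (fun j _ =>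
  W_act_partial 1%g 1 j (REndM_smult S (cwr j))).
have [s [H1 H2]] := W_act_DM H; exists s; split=> // f sf a Aa.
rewrite -(H2 f sf a Aa).
apply/esym/(etrans (mult_partial_comb (fun=> 1) w (@xb_aR _ _ _ _ D) sf Aa)).
by rewrite -hE; exact: mul1mx.
Qed.

(** The coefficient of coth in the correction of [partial h]; its sign is due to (1 + xi^2) / (1 -
    xi^2) = -coth. *)
Definition gw (h : 'rV[R]_N) (mu : rdual) : R :=
  - 4^-1 * (mu (vsproj aR h) * (mtp mu)%:R).

Lemma gauge_partialE h (f : sect S) a : h \in aR -> smooth_sect f -> Areg D a ->
  Gam (partial h) f a = partial h f a + (coth_sum (gw h) a)%:C%C *: f a.
Proof.
move=> ha sf Aa; have := gauge_partial GG (vsproj aR h) sf Aa.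
rewrite (vsprojK ha) => ->; rewrite sum_Sgs.
rewrite -[LHS]/(partial h f a + 4^-1 *: (\sum_(mu <- Sgs D) _) f a); congr (_ + _).
apply: (etrans (congr1 _ (dop_sumE _ _ f a))).
rewrite /coth_sum rmorph_sum scaler_suml scaler_sumr !big_seq; apply: eq_bigr => mu /mem_Sgs Smu.
rewrite -[X in _ *: X]/(_%:M *m f a) mul_scalar_mx scalerA; congr (_ *: _).
have -> : (1 + xi (mu *+ 2) a) / (1 - xi (mu *+ 2) a) = - cothG mu a.
  rewrite cothGE xi2 xiN; have [p0 _ _ s1] := xi_units Aa Smu.
  have s2 : 1 - xi mu a ^+ 2 != 0 by rewrite -oppr_eq0 opprB.
  by move: (xi mu a) p0 s1 s2 => p p0 s1 s2; field; rewrite p0 s1.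
rewrite (_ : 4^-1 = (4^-1)%:C%C); last by rewrite rmorphV ?unitfE ?pnatr_eq0 // rmorph_nat.
by rewrite -rmorphM /gw; congr (_%:C)%C; ring.
Qed.

Lemma gauge_partial_smooth h (f : sect S) : h \in aR -> smooth_sect f -> smooth_sect (Gam (partial h) f).
Proof.
move=> ha sf.
apply: (smooth_sect_ext _ (smooth_sectD (smooth_sect_partial sf ha)
  (smooth_sectZ (coth_sum_smooth (gw h)) sf))).
by move=> a Aa; rewrite gauge_partialE.
Qed.

Lemma gauge_square (p q : R) (X Y Z : 'cV[C]_(dimV S)) :
  X + (q%:C%C *: Z + p%:C%C *: Y) + p%:C%C *: (Y + p%:C%C *: Z) =
  X + (2 * p)%:C%C *: Y + (q + p ^+ 2)%:C%C *: Z.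
Proof.
rewrite [(2 * _)%:C%C]rmorphM [(_ + _ ^+ 2)%:C%C]rmorphD rmorph_nat rmorphXn /=.
by apply/colP => i; rewrite !mxE; ring.
Qed.

(** With phi the correction term, (d + phi)^2 = d^2 + 2 phi d + (d phi + phi^2), and d phi is given
    by coth' = 1 - coth^2. *)
Lemma gauge_partial2 j (f : sect S) a : smooth_sect f -> Areg D a ->
  Gam (iter 2 (partial (x_ j))) f a =
  iter 2 (partial (x_ j)) f a +
  (2 * coth_sum (gw (x_ j)) a)%:C%C *: partial (x_ j) f a +
  (\sum_(mu <- Sgs D) gw (x_ j) mu * (mu (vsproj aR (x_ j)) * (1 - cothG mu a ^+ 2)) +
   coth_sum (gw (x_ j)) a ^+ 2)%:C%C *: f a.
Proof.
move=> sf Aa; have xa : x_ j \in aR := xb_aR j.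
have D1 := DM_partial xa.
have E1 := gauge_mul GG D1 D1 sf Aa.
apply: (etrans E1).
rewrite -[LHS]/(Gam (partial (x_ j)) (Gam (partial (x_ j)) f) a).
rewrite (gauge_partialE xa (gauge_partial_smooth xa sf) Aa) (gauge_partialE xa sf Aa).
have E2 : partial (x_ j) (Gam (partial (x_ j)) f) a =
  partial (x_ j) (partial (x_ j) f) a +
  ((\sum_(mu <- Sgs D) gw (x_ j) mu * (mu (vsproj aR (x_ j)) * (1 - cothG mu a ^+ 2)))%:C%C *: f a +
   (coth_sum (gw (x_ j)) a)%:C%C *: partial (x_ j) f a).
  have E3 : forall b, Areg D b -> Gam (partial (x_ j)) f b =
     (fun b => partial (x_ j) f b + (fun b => (coth_sum (gw (x_ j)) b)%:C%C *: f b) b) b.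
    by move=> b Ab; exact: gauge_partialE.
  rewrite (partial_ext E3 xa Aa).
  have sq := smooth_sectZ (coth_sum_smooth (gw (x_ j))) sf.
  rewrite (partialD (smooth_sect_partial sf xa) sq xa Aa); congr (_ + _).
  have [u eu] := Areg_surj Aa; rewrite eu in Aa *.
  have [v hv] := acomb_surj xa; have [dq Dq] := coth_sum_diff (gw (x_ j)) Aa.
  rewrite {1}hv (partialZ _ sf Aa dq) Dq -hv; congr ((_)%:C%C *: _ + _).
  by apply: eq_bigr => mu _; rewrite cothG_aexp /ell -hv.
rewrite E2; exact: gauge_square.
Qed.

Lemma gauge_drift mu (f : sect S) a : Sigma D mu -> smooth_sect f -> Areg D a ->
  DM (drift E mu : dop) /\ Gam (drift E mu) f a =
  (2^-1 * ((mtp mu)%:R * cothG mu a))%:C%C *: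
    (partial (tvec E mu) f a + (coth_sum (gw (tvec E mu)) a)%:C%C *: f a).
Proof.
move=> Smu sf Aa; split; first exact: W_act_DM (W_act_drift S E (NKA1 D) Smu).
have ta := tvec_in E mu.
have Rq : REndM (fun a => ((2^-1 * ((mtp mu)%:R * cothG mu a))%:C%C)%:M : MV).
  apply: REndM_smult; apply: calRr_mul (calRr_cst _ _) _.
  by apply: calRr_mul (calRr_cst _ _) _; exact: calRr_coth.
apply: (etrans (gauge_lin GG Rq (DM_partial ta) sf Aa)).
rewrite -[LHS]/(_%:M *m Gam (partial (tvec E mu)) f a) mul_scalar_mx.
by rewrite (gauge_partialE ta sf Aa).
Qed.

Lemma inner_xb_tvec mu j : inner (tvec E mu) (x_ j) = mu (vsproj aR (x_ j)).
Proof. by apply: inner_tvec; exact: xb_aR. Qed.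

Lemma sum_xb_ip (mu nu : rdual) :
  \sum_j mu (vsproj aR (x_ j)) * nu (vsproj aR (x_ j)) = ip E mu nu.
Proof.
rewrite ip_inner (inner_parseval _ (tvec_in E nu)).
by apply: eq_bigr => j _; rewrite !inner_xb_tvec.
Qed.

(** The double sum [T2] enters with 1/16 from phi^2 and -1/8 from the drift, in total -1/16, so that
    [coth_root_sum] contributes -(rho, rho). As coth^2 - 1 = 4 / (xi - 1/xi)^2, the single sums add
    up to the couplings; the -1 in [coupling] is the derivative of phi. *)
Lemma zeroth_order a : Areg D a ->
  \sum_j (\sum_(mu <- Sgs D) gw (x_ j) mu * (mu (vsproj aR (x_ j)) * (1 - cothG mu a ^+ 2)) +
     coth_sum (gw (x_ j)) a ^+ 2) +
  \sum_(mu <- Sgs D) (2^-1 * ((mtp mu)%:R * cothG mu a)) * coth_sum (gw (tvec E mu)) a =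
  - (\sum_(mu <- Sgs D) coupling E mu / (xi mu a - xi (- mu) a) ^+ 2) -
  inner (tvec E (Defs.rho D)) (tvec E (Defs.rho D)).
Proof.
move=> Aa; have [F [al bF]] := cartan_basis_ex D.
have RS := coth_root_sum E bF Aa.
set T2 := \sum_(mu <- Sgs D) \sum_(nu <- Sgs D) _ in RS.
have E1 : \sum_j \sum_(mu <- Sgs D) gw (x_ j) mu * (mu (vsproj aR (x_ j)) * (1 - cothG mu a ^+ 2)) =
    4^-1 * \sum_(mu <- Sgs D) (mtp mu)%:R * (cothG mu a ^+ 2 - 1) * ip E mu mu.
  rewrite exchange_big mulr_sumr; apply: eq_bigr => mu _.
  rewrite -sum_xb_ip !mulr_sumr; apply: eq_bigr => j _.
  by rewrite /gw; ring.
have E2 : \sum_j coth_sum (gw (x_ j)) a ^+ 2 = 16^-1 * T2.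
  transitivity (\sum_j \sum_(mu <- Sgs D) \sum_(nu <- Sgs D)
    16^-1 * (((mtp mu)%:R * cothG mu a) * ((mtp nu)%:R * cothG nu a) *
      (mu (vsproj aR (x_ j)) * nu (vsproj aR (x_ j))))).
    apply: eq_bigr => j _; rewrite expr2 /coth_sum mulr_suml; apply: eq_bigr => mu _.
    rewrite mulr_sumr; apply: eq_bigr => nu _.
    have q4 : 16^-1 = 4^-1 * 4^-1 :> R by rewrite -invfM -natrM.
    by rewrite /gw q4; ring.
  rewrite exchange_big /T2 mulr_sumr; apply: eq_bigr => mu _.
  rewrite exchange_big mulr_sumr; apply: eq_bigr => nu _.
  by rewrite -sum_xb_ip -mulr_sumr -mulr_sumr.
have E3 : \sum_(mu <- Sgs D) (2^-1 * ((mtp mu)%:R * cothG mu a)) * coth_sum (gw (tvec E mu)) a =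
    - 8^-1 * T2.
  rewrite /T2 mulr_sumr; apply: eq_bigr => mu _; rewrite /coth_sum !mulr_sumr; apply: eq_bigr => nu _.
  have q8 : 8^-1 = 2^-1 * 4^-1 :> R by rewrite -invfM -natrM.
  by rewrite /gw /ip q8; ring.
rewrite big_split E1 E2 E3 RS.
have -> : \sum_(mu <- Sgs D) coupling E mu / (xi mu a - xi (- mu) a) ^+ 2 =
  8^-1 * \sum_(mu <- Sgs D) (mtp mu)%:R * (cothG mu a ^+ 2 - 1) *
    ((mtp mu)%:R + 2 * (mtp (mu *+ 2))%:R) * ip E mu mu -
  4^-1 * \sum_(mu <- Sgs D) (mtp mu)%:R * (cothG mu a ^+ 2 - 1) * ip E mu mu.
  rewrite !mulr_sumr -sumrB !big_seq; apply: eq_bigr => mu /mem_Sgs Smu.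
  have [u eu] := Areg_surj Aa; rewrite eu in Aa *.
  have u0 : ell mu u != 0 by have /Areg_aexp := Aa; apply.
  have := cothf_sqr u0.
  rewrite cothG_aexp !xi_aexp -[acoth mu u]/(cothf (ell mu u)) => ->.
  have -> : ell (- mu) u = - ell mu u by rewrite /ell opp_lfunE.
  rewrite /coupling -ip_inner; have := sinh_neq0 u0.
  move: (expR _ - expR _) => s s0; by field; rewrite s0.
move: (inner _ _) (\sum_(mu <- Sgs D) _ * ip E mu mu) (\sum_(mu <- Sgs D) _ * ip E mu mu) => x y z.
by rewrite /=; lra.
Qed.

(** Twice the factor -1/4 in [gw] is opposite to the 1/2 of the drift; summing over the orthonormal
    basis rebuilds the derivative along [tvec E mu]. *)
Lemma first_order (f : sect S) a : smooth_sect f -> Areg D a ->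
  \sum_j (2 * coth_sum (gw (x_ j)) a)%:C%C *: partial (x_ j) f a =
  - \sum_(mu <- Sgs D) (2^-1 * ((mtp mu)%:R * cothG mu a))%:C%C *: partial (tvec E mu) f a.
Proof.
move=> sf Aa.
transitivity (\sum_j \sum_(mu <- Sgs D) - ((2^-1 * ((mtp mu)%:R * cothG mu a)) *
    inner (tvec E mu) (x_ j))%:C%C *: partial (x_ j) f a).
  apply: eq_bigr => j _; rewrite -scaler_suml; congr (_ *: _).
  rewrite sumrN -rmorph_sum -rmorphN; congr (_%:C)%C.
  rewrite mulr_sumr -sumrN; apply: eq_bigr => mu _; rewrite inner_xb_tvec /gw.
  by field.
rewrite exchange_big -sumrN; apply: eq_bigr => mu _.
rewrite (partial_comb sf (tvec_in E mu) Aa) scaler_sumr -sumrN; apply: eq_bigr => j _.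
by rewrite scalerA -rmorphM scaleNr.
Qed.

Lemma scale_affine (p q : R) (Y Z : 'cV[C]_(dimV S)) :
  p%:C%C *: (Y + q%:C%C *: Z) = p%:C%C *: Y + (p * q)%:C%C *: Z.
Proof. by rewrite scalerDr scalerA rmorphM. Qed.

Lemma potential_rearrange (p q : R) (X Y Z V : 'cV[C]_(dimV S)) :
  X + Y + Z + (- p - q)%:C%C *: V =
  X + (- (p%:C%C *: V) - - Y) + Z - (q%:C%C)%:M *m V.
Proof.
rewrite mul_scalar_mx opprK rmorphD !rmorphN scalerDl !scaleNr [RHS]addrAC.
by rewrite -!addrA; congr (_ + _); rewrite [- _ + (Y + _)]addrCA; congr (_ + _); rewrite [RHS]addrA addrC.
Qed.

Lemma sum_rearrange (Z : zmodType) (l d z1 z2 o s : Z) :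
  l - d + z1 + (d + z2) + o + s = l + s + o + (z1 + z2).
Proof.
by rewrite addrACA subrK (addrAC l (z1 + z2) o) (addrAC (l + o) (z1 + z2) s) (addrAC l o s).
Qed.

Lemma gauge_Ham (f : sect S) a : smooth_sect f -> Areg D a ->
  Gam (Ham E) f a = Lap f a + (\sum_(mu <- Sgs D) (spin E mu : dop)) f a +
    Omega_m E (rho_r S) *m f a +
    (- (\sum_(mu <- Sgs D) coupling E mu / (xi mu a - xi (- mu) a) ^+ 2) -
      inner (tvec E (Defs.rho D)) (tvec E (Defs.rho D)))%:C%C *: f a.
Proof.
move=> sf Aa.
have DL : DM Lap := W_act_DM (W_act_Lap S (NKA1 D)).
have Ddr : forall mu, mu \in Sgs D -> DM (drift E mu : dop).
  by move=> mu /mem_Sgs Smu; have [] := gauge_drift Smu sf Aa.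
have DO := W_act_DM (W_act_Omega S E (NKA1 D)).
have Dsp : forall mu, mu \in Sgs D -> DM (spin E mu : dop).
  by move=> mu /mem_Sgs Smu; exact: W_act_DM (W_act_spin S E (NKA1 D) Smu).
have [DA EA] := gauge_sum Ddr; have [DB EB] := gauge_sum Dsp.
have [_ EO] := gauge_mult (REndM_cst (EndM_Omega E (kdiff_r S))).
have [_ EL] := gauge_sum (r := index_enum 'I_(rk D)) (fun j _ => DM_iter 2 j).
have DLA := DM_add DL DA; have DLAO := DM_add DLA DO.
apply: (etrans (gauge_add GG DLAO DB sf Aa)).
rewrite -[LHS]/(Gam (Lap + \sum_(mu <- Sgs D) drift E mu + mult (fun=> Omega_m E (rho_r S))) f a
  + Gam (\sum_(mu <- Sgs D) spin E mu) f a).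
have -> : Gam (\sum_(mu <- Sgs D) spin E mu) f a = (\sum_(mu <- Sgs D) (spin E mu : dop)) f a.
  apply: (etrans (EB f sf a Aa)); apply: (etrans (dop_sumE _ _ f a)).
  apply/esym/(etrans (dop_sumE _ _ f a))/esym; rewrite !big_seq.
  apply: eq_bigr => mu /mem_Sgs Smu.
  by have [_ ->] := gauge_mult (REndM_spin S E Smu).
have -> : Gam (Lap + \sum_(mu <- Sgs D) drift E mu + mult (fun=> Omega_m E (rho_r S))) f a =
  Gam Lap f a + Gam (\sum_(mu <- Sgs D) drift E mu) f a + Omega_m E (rho_r S) *m f a.
  apply: (etrans (gauge_add GG DLA DO sf Aa)).
  rewrite -[LHS]/(Gam (Lap + \sum_(mu <- Sgs D) drift E mu) f a + Gam (mult (fun=> Omega_m E (rho_r S))) f a).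
  by rewrite (EO f sf a Aa) (gauge_add GG DL DA sf Aa).
have -> : Gam Lap f a = Lap f a +
    \sum_j (2 * coth_sum (gw (x_ j)) a)%:C%C *: partial (x_ j) f a +
    (\sum_j (\sum_(mu <- Sgs D) gw (x_ j) mu * (mu (vsproj aR (x_ j)) * (1 - cothG mu a ^+ 2)) +
     coth_sum (gw (x_ j)) a ^+ 2))%:C%C *: f a.
  apply: (etrans (EL f sf a Aa)); apply: (etrans (dop_sumE _ _ f a)).
  rewrite rmorph_sum scaler_suml.
  have -> : Lap f a = \sum_j iter 2 (partial (x_ j)) f a by exact: dop_sumE.
  rewrite -!big_split; apply: eq_bigr => j _; exact: gauge_partial2.
have -> : Gam (\sum_(mu <- Sgs D) drift E mu) f a =
    \sum_(mu <- Sgs D) (2^-1 * ((mtp mu)%:R * cothG mu a))%:C%C *: partial (tvec E mu) f a +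
    (\sum_(mu <- Sgs D) (2^-1 * ((mtp mu)%:R * cothG mu a)) * coth_sum (gw (tvec E mu)) a)%:C%C *: f a.
  apply: (etrans (EA f sf a Aa)); apply: (etrans (dop_sumE _ _ f a)).
  rewrite rmorph_sum scaler_suml -big_split !big_seq; apply: eq_bigr => mu /mem_Sgs Smu.
  by have [_ ->] := gauge_drift Smu sf Aa; exact: scale_affine.
rewrite -(zeroth_order Aa) (first_order sf Aa) rmorphD scalerDl.
exact: sum_rearrange.
Qed.

End GaugeComputation.

Theorem proposition5p15 (R : realType) (N : nat) (G : lieGroup R N)
    (g : lieAlgebra G) (D : cartanData g) (E : rootData D) (S : repData D)
    (Gam : dop S -> dop S) :
  connected [set: G] -> finite_center G -> semisimple g -> is_gauge Gam ->
  DM_W (Gam (H_op E)) /\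
  dop_eq (Gam (H_op E))
    (\sum_(j < rk D) iter 2 (partial (S := S) (tnth (xb D) j))
     + potential E
     + mult (fun=> Omega_m E (rho_r S))
     - smult (fun=> (inner D (tvec E (rho D)) (tvec E (rho D)))%:C%C)).
Proof.
move=> _ _ _ GG; have HH := dop_eq_sym (@H_opE _ _ _ _ _ S E).
have WH k : NKA D k -> W_act k (H_op E : dop S) (H_op E).
  by move=> Nk; exact: (W_act_ext HH HH (W_act_Ham S E Nk)).
have DH : DM (H_op E : dop S) := W_act_DM (WH 1%g (NKA1 D)).
have DHam : DM (Ham E : dop S) := W_act_DM (W_act_Ham S E (NKA1 D)).
split.
  split; first exact: gauge_DM.
  by move=> k Nk; exact: (gauge_W GG Nk DH DH (WH k Nk)).
move=> f sf a Aa.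
(* [Gam] respects equality of operators only inside [DM], hence both memberships are needed to pass
   from [H_op] to [Ham]. *)
have [EH _] := gauge_eq GG DHam DH.
rewrite -(EH HH f sf a Aa) (gauge_Ham E GG sf Aa).
rewrite -[RHS]/(Lap f a +
  (- (\sum_(mu \in Sigma D) smult (fun a => (coupling E mu /
     (xi mu a - xi (- mu) a) ^+ 2)%:C%C)) f a - (\sum_(mu \in Sigma D) spin_term E mu) f a) +
  Omega_m E (rho_r S) *m f a -
  (inner D (tvec E (rho D)) (tvec E (rho D)))%:C%C%:M *m f a).
have -> : (\sum_(mu \in Sigma D) (spin_term E mu : dop S)) f a =
    - (\sum_(mu <- Sgs D) (spin E mu : dop S)) f a.
  rewrite sum_Sgs; apply: (etrans (dop_sumE _ _ f a)).
  rewrite -[LHS]opprK -sumrN; congr (- _); apply/esym/(etrans (dop_sumE _ _ f a))/eq_bigr => mu _.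
  by rewrite -[LHS]/(- spin_coef S E mu a *m f a) mulNmx.
have -> : (\sum_(mu \in Sigma D) (smult (fun a => (coupling E mu /
     (xi mu a - xi (- mu) a) ^+ 2)%:C%C) : dop S)) f a =
    (\sum_(mu <- Sgs D) coupling E mu / (xi mu a - xi (- mu) a) ^+ 2)%:C%C *: f a.
  rewrite sum_Sgs; apply: (etrans (dop_sumE _ _ f a)).
  rewrite rmorph_sum scaler_suml; apply: eq_bigr => mu _.
  by rewrite -[LHS]/(_%:M *m f a) mul_scalar_mx.
exact: potential_rearrange.
Qed.
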